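(* Suppose $\Omega\subset\mathbb C$ is a (bounded, simply connected) domain bounded by a $C^\infty$ smooth Jordan curve $b\Omega$. Let $z_0\in b\Omega$, and let $\mathbb D_r(z_0)$ be a (small) disc of radius $r$ about $z_0$ such that $\mathbb D_r(z_0)\cap\Omega$ is simply connected. Let $h$ be holomorphic on $\mathbb D_r(z_0)\cap\Omega$ with $L^2$ boundary limits on $\mathbb D_r(z_0)\cap b\Omega$. Then there is $f\in h^2(b\Omega)$ such that the difference $f-h$ extends $C^\infty$ smoothly to the boundary of $\Omega$ near $z_0$.
   Context: $h^2(b\Omega)$ is the Hardy space of $\Omega$: the space of boundary functions in $L^2(b\Omega)$ (with respect to arc length) of holomorphic functions $f$ on $\Omega$ whose non-tangential maximal function is in $L^2(b\Omega)$; equivalently, for which the $L^2$ arc-length norms of $f$ on the curves parallel to $b\Omega$ at small distance $\epsilon$ inside $\Omega$ are bounded uniformly in $\epsilon$. An element of $h^2(b\Omega)$ is identified with the corresponding holomorphic function on $\Omega$, also denoted $f$. ''$h$ has $L^2$ boundary limits on $\mathbb D_r(z_0)\cap b\Omega$'' is meant in the (local) Hardy space sense: there is a function in $L^2(\mathbb D_r(z_0)\cap b\Omega)$ which is the non-tangential limit of $h$ a.e. on $\mathbb D_r(z_0)\cap b\Omega$ and to which $z\mapsto h(z+i\epsilon T(z))$ converges in $L^2$, as $\epsilon\to0^+$, on compact subarcs of $\mathbb D_r(z_0)\cap b\Omega$. Here $T(z)$ is the complex unit tangent to $b\Omega$ at $z$ in the counterclockwise direction, so that $iT(z)$ is the inward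 unit normal. ''$f-h$ extends $C^\infty$ smoothly to the boundary of $\Omega$ near $z_0$'' means that there is a neighborhood $V\subset\mathbb D_r(z_0)$ of $z_0$ such that $f-h$, defined on $V\cap\Omega$, extends to a function in $C^\infty(V\cap\overline\Omega)$. *)

(* Defs.v *)
From HB Require Import structures.
From mathcomp Require Import all_boot all_order all_algebra.
From mathcomp Require Import complex.
From mathcomp Require Import all_classical all_reals all_analysis.

Set Implicit Arguments.
Unset Strict Implicit.
Unset Printing Implicit Defensive.

Import Order.TTheory GRing.Theory Num.Theory.
Import numFieldNormedType.Exports.
Import ComplexField.Normc.

Local Open Scope classical_set_scope.
Local Open Scope ring_scope.
Local Open Scope complex_scope.

(* R[i] carries the topology and the norm of every numFieldType K, defined by
   the library on K^o.  Balls have radius e : R[i] with 0 < e, i.e. e = r%:C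
   for a positive real r; the real modulus is normc, `|z| being its image in
   R[i]. *)
HB.instance Definition _ (R : rcfType) :=
  PseudoPointedMetric.copy R[i] R[i]^o.
HB.instance Definition _ (R : rcfType) := NormedModule.copy R[i] R[i]^o.

Definition disc (R : realType) (z0 : R[i]) (r : R) : set R[i] := ball z0 r%:C.

Definition boundary (R : realType) (A : set R[i]) : set R[i] :=
  closure A `\` interior A.

Definition path_connected (R : realType) (A : set R[i]) : Prop :=
  forall p q, A p -> A q ->
  exists c : R -> R[i], [/\ {within `[0, 1], continuous c},
    c @` `[0, 1] `<=` A, c 0 = p & c 1 = q].

Definition null_homotopic_in (R : realType) (A : set R[i]) (c : R -> R[i])
    : Prop :=
  exists H : R * R -> R[i],
  [/\ {within `[0, 1] `*` `[0, 1], continuous H},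
      H @` (`[0, 1] `*` `[0, 1]) `<=` A,
      forall t : R, t \in `[0, 1] -> H (0, t) = c t,
      forall t : R, t \in `[0, 1] -> H (1, t) = c 0 &
      forall s : R, s \in `[0, 1] -> H (s, 0) = c 0 /\ H (s, 1) = c 0].

Definition simply_connected (R : realType) (A : set R[i]) : Prop :=
  path_connected A /\
  forall c : R -> R[i], {within `[0, 1], continuous c} ->
    c @` `[0, 1] `<=` A -> c 0 = c 1 -> null_homotopic_in A c.

Definition holomorphic_on (R : realType) (U : set R[i]) (f : R[i] -> R[i])
    : Prop :=
  forall z, U z -> derivable f z 1.

(* Differentiation of complex-valued functions of a real variable, by
   components: R[i] carries no topological R-module structure. *)

Definition cderivable (R : realType) (c : R -> R[i]) (t : R) : Prop :=
  derivable (fun s => complex.Re (c s)) t 1 /\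
  derivable (fun s => complex.Im (c s)) t 1.

Definition cderiv (R : realType) (c : R -> R[i]) (t : R) : R[i] :=
  derive1 (fun s => complex.Re (c s)) t +i* derive1 (fun s => complex.Im (c s)) t.

Definition smooth_curve (R : realType) (c : R -> R[i]) : Prop :=
  forall n t, cderivable (iter n (@cderiv R) c) t.

(* Smoothness in the sense of real partial derivatives, v = 1 and v = 'i
   giving the derivatives in x and in y. *)

Definition pderivable (R : realType) (v : R[i]) (g : R[i] -> R[i]) (z : R[i])
    : Prop :=
  cderivable (fun s : R => g (z + s%:C * v)) 0.

Definition pderiv (R : realType) (v : R[i]) (g : R[i] -> R[i]) (z : R[i])
    : R[i] :=
  cderiv (fun s : R => g (z + s%:C * v)) 0.

Fixpoint Ck_on (R : realType) (k : nat) (U : set R[i]) (g : R[i] -> R[i])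
    : Prop :=
  (forall z, U z -> {for z, continuous g}) /\
  if k is k'.+1 then
    [/\ forall z, U z -> pderivable 1 g z /\ pderivable 'i g z,
        Ck_on k' U (pderiv 1 g) & Ck_on k' U (pderiv 'i g)]
  else True.

(* C^oo on an arbitrary subset A of the plane: locally the restriction of a
   C^oo function defined on an open set. *)
Definition smooth_on (R : realType) (A : set R[i]) (G : R[i] -> R[i]) : Prop :=
  forall p, A p -> exists U : set R[i], exists g : R[i] -> R[i],
  [/\ open U, U p, forall k, Ck_on k U g &
      forall z, U z -> A z -> g z = G z].

Definition speed (R : realType) (gamma : R -> R[i]) (t : R) : R :=
  normc (cderiv gamma t).

Definition tangent (R : realType) (gamma : R -> R[i]) (t : R) : R[i] :=
  cderiv gamma t / (speed gamma t)%:C.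

Definition parallel (R : realType) (gamma : R -> R[i]) (eps : R) (t : R)
    : R[i] :=
  gamma t + 'i * eps%:C * tangent gamma t.

(* A C^oo embedding of the circle R/Z in the plane. *)
Definition smooth_jordan_curve (R : realType) (gamma : R -> R[i]) : Prop :=
  [/\ smooth_curve gamma,
      forall t, gamma (t + 1) = gamma t,
      {in `[0, 1[ &, injective gamma} &
      forall t, cderiv gamma t != 0].

(* The counterclockwise (positive) orientation of the boundary is the one for
   which 'i times the unit tangent is the inward normal. *)
Definition smooth_jordan_domain (R : realType) (Omega : set R[i])
    (gamma : R -> R[i]) : Prop :=
  [/\ [/\ open Omega, Omega !=set0, connected Omega & bounded_set Omega],
      simply_connected Omega,
      smooth_jordan_curve gamma,
      range gamma = boundary Omega &
      forall t, \forall eps \near 0^'+, Omega (parallel gamma eps t)].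

(* The integral of phi >= 0 over E, a subset of the curve, with respect to
   arc length; [0, 1[ parametrizes the curve once. *)
Definition arc_params (R : realType) (gamma : R -> R[i]) (E : set R[i])
    : set R :=
  `[0, 1[ `&` gamma @^-1` E.

Definition L2_arc (R : realType) (gamma : R -> R[i]) (E : set R[i])
    (u : R[i] -> R[i]) : Prop :=
  [/\ measurable_fun (arc_params gamma E) (fun t => complex.Re (u (gamma t))),
      measurable_fun (arc_params gamma E) (fun t => complex.Im (u (gamma t))) &
      (\int[lebesgue_measure]_(t in arc_params gamma E)
         (normc (u (gamma t)) ^+ 2 * speed gamma t)%:E < +oo)%E].

(* The second condition says |z - p| <= (1 + alpha) dist(z, boundary Omega). *)
Definition approach_region (R : realType) (Omega : set R[i]) (alpha : R)
    (p : R[i]) : set R[i] :=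
  [set z | Omega z /\ forall w, boundary Omega w ->
    normc (z - p) <= (1 + alpha) * normc (z - w)].

Definition nontangential_limit (R : realType) (Omega : set R[i])
    (F : R[i] -> R[i]) (p l : R[i]) : Prop :=
  forall alpha : R, 0 < alpha ->
    F @ within (approach_region Omega alpha p) (nbhs p) --> l.

Definition nontangential_limit_ae (R : realType) (Omega : set R[i])
    (gamma : R -> R[i]) (E : set R[i]) (F u : R[i] -> R[i]) : Prop :=
  {ae @lebesgue_measure R, forall t, arc_params gamma E t ->
     nontangential_limit Omega F (gamma t) (u (gamma t))}.

(* u is the element of h^2(boundary Omega) whose holomorphic extension is F.
   Each integral is taken with respect to the arc length of the parallel curve
   itself; that curve lies in Omega for small eps > 0. *)
Definition hardy2 (R : realType) (Omega : set R[i]) (gamma : R -> R[i])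
    (F u : R[i] -> R[i]) : Prop :=
  [/\ holomorphic_on Omega F,
      exists M : R, \forall eps \near 0^'+,
        (\int[lebesgue_measure]_(t in `[0%R, 1%R[)
           (normc (F (parallel gamma eps t)) ^+ 2 *
            speed (parallel gamma eps) t)%:E <= M%:E)%E,
      L2_arc gamma (boundary Omega) u &
      nontangential_limit_ae Omega gamma (boundary Omega) F u].

(* Local version on the open subset E of the boundary; the compact subarcs of
   E are the gamma([a, b]) contained in E. *)
Definition L2_boundary_limits (R : realType) (Omega : set R[i])
    (gamma : R -> R[i]) (E : set R[i]) (h : R[i] -> R[i]) : Prop :=
  exists u : R[i] -> R[i],
  [/\ L2_arc gamma E u,
      nontangential_limit_ae Omega gamma E h u &
      forall a b : R, a < b -> b <= a + 1 -> gamma @` `[a, b] `<=` E ->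
        (fun eps : R => \int[lebesgue_measure]_(t in `[a, b])
           (normc (h (parallel gamma eps t) - u (gamma t)) ^+ 2 *
            speed gamma t)%:E)%E @ 0^'+ --> 0%E].

Definition extends_smoothly_near (R : realType) (Omega D : set R[i])
    (z0 : R[i]) (k : R[i] -> R[i]) : Prop :=
  exists V : set R[i], exists G : R[i] -> R[i],
  [/\ open V, V z0, V `<=` D,
      forall z, V z -> Omega z -> G z = k z &
      smooth_on (V `&` closure Omega) G].

(* Main.v *)
Require Import Defs.
From mathcomp Require Import all_boot all_order all_algebra.
From mathcomp Require Import complex.
From mathcomp Require Import all_classical all_reals all_analysis.
From mathcomp Require Import measurable_realfun.
From mathcomp Require Import ring lra zify.

Set Implicit Arguments.
Unset Strict Implicit.
Unset Printing Implicit Defensive.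

Import Order.TTheory GRing.Theory Num.Theory.
Import numFieldNormedType.Exports.
Import ComplexField.Normc.

Local Open Scope classical_set_scope.
Local Open Scope ring_scope.
Local Open Scope complex_scope.

(** The candidate is the Cauchy integral of the boundary values of [h], cut off
    near [z0].  The proof has three parts.

    Geometry.  The smooth curve has a collar on which the normal coordinates
    [Phi t s = gamma t + i s T t] are bi-Lipschitz ([collar_bilip]), where the
    distance of [Phi t s] to the curve is [|s|] ([collar_dist]), which contains
    all points close to the curve ([nearest_point]), and whose sides [s > 0] and
    [s < 0] lie inside and outside the domain ([collar_sides]).

    Cauchy's formula up to the boundary.  Take an arc [a, b] of parameters around
    [z0] whose end points are points where [h] has nontangential limits, and the
    rectangle of the collar based on it.  Cauchy's formula holds on the rectangle
    lifted off the curve ([cauchy_patch]; Goursat's bisection runs in the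
    parameters [t] and [s]).  Lowering the base onto the curve, the convergence
    of [h] in the quadratic mean on the base and its limits along the two normals
    give ([collar_cauchy])

      int_a^b w / (gamma - z) dt + I(z) = 2 pi i h(z),    w = u(gamma) gamma',

    where [u] is the boundary function of [h] and [I] is the integral over the
    other three sides, a holomorphic function near [z0].

    Localization.  Let [psi] be a Lipschitz cut-off, equal to [1] near [z0] and
    supported in a small disc, and let

      f(z) = 1 / (2 pi i) int_a^b w psi(gamma) / (gamma - z) dt.

    Writing [psi(gamma) = psi(z) + (psi(gamma) - psi(z))] and using the formula
    above, [f = psi h + g] on the domain ([local_fE]), where [g] is bounded and
    continuous on the whole plane, because the quotient of
    [psi(gamma) - psi(z)] by [gamma - z] is bounded: dominated convergence
    applies even for [z] on the curve ([lip_transform_continuous]).  Hence [f]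
    inherits from [h] the bound of the square integrals on parallel curves and
    the nontangential limits, with boundary function [psi u + g]
    ([glued_hardy]).  Near [z0], where [psi = 1], the difference [f - h] equals
    [- I(z) / (2 pi i)] plus the integral of [w (psi(gamma) - 1) / (gamma - z)],
    divided by [2 pi i]; only points of the curve away from [z0] contribute to
    it, so it can be differentiated under the integral sign indefinitely
    ([local_f_smooth]). *)

(** * Modulus and complex differentiability *)

Section Modulus.
Context {R : realType}.
Implicit Types (x y z w : R[i]) (r e d : R).

Lemma normc_ge0 z : 0 <= normc z.
Proof. by case: z => a b; exact: sqrtr_ge0. Qed.

Lemma normr_normc z : `|z| = (normc z)%:C.
Proof. by []. Qed.

Lemma normcN z : normc (- z) = normc z.
Proof. by case: z => a b /=; rewrite !sqrrN. Qed.

Lemma normcC z w : normc (z - w) = normc (w - z).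
Proof. by rewrite -normcN opprB. Qed.

Lemma normcD z w : normc (z + w) <= normc z + normc w.
Proof. by rewrite -lecR rmorphD /= -!normr_normc; exact: ler_normD. Qed.

Lemma normcB z w : normc (z - w) <= normc z + normc w.
Proof. by rewrite -[normc w]normcN; exact: normcD. Qed.

Lemma normc_tri w z y : normc (z - y) <= normc (z - w) + normc (w - y).
Proof. by rewrite -[z - y](subrKA w); exact: normcD. Qed.

Lemma normc_lowerD z w : normc z - normc w <= normc (z + w).
Proof. by rewrite lerBlDr -{1}[z](addrK w) normcB. Qed.

Lemma normc_eq0 z : (normc z == 0) = (z == 0).
Proof.
by apply/eqP/eqP => [/eq0_normc//|->]; exact: normc0.
Qed.

Lemma normc_gt0 z : (0 < normc z) = (z != 0).
Proof. by rewrite lt_def normc_ge0 andbT normc_eq0. Qed.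

Lemma normcR r : normc r%:C = `|r|.
Proof. by rewrite /= expr0n /= addr0 sqrtr_sqr. Qed.

Lemma normc_i : normc ('i%R : R[i]) = 1.
Proof. by rewrite /= expr0n /= add0r expr1n sqrtr1. Qed.

Lemma normcX z n : normc (z ^+ n) = normc z ^+ n.
Proof.
elim: n => [|n IHn]; first by rewrite !expr0; exact: normc1.
by rewrite !exprS normcM IHn.
Qed.

Lemma normc_sqr z : normc z ^+ 2 = complex.Re z ^+ 2 + complex.Im z ^+ 2.
Proof. by case: z => a b /=; rewrite sqr_sqrtr // addr_ge0 ?sqr_ge0. Qed.

Lemma Re_le_normc z : `|complex.Re z| <= normc z.
Proof.
case: z => a b /=; rewrite -[leLHS]sqrtr_sqr ler_wsqrtr //.
by rewrite lerDl sqr_ge0.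
Qed.

Lemma Im_le_normc z : `|complex.Im z| <= normc z.
Proof.
case: z => a b /=; rewrite -[leLHS]sqrtr_sqr ler_wsqrtr //.
by rewrite lerDr sqr_ge0.
Qed.

Lemma normc_le_ReIm z : normc z <= `|complex.Re z| + `|complex.Im z|.
Proof.
rewrite {1}[z]complexE; apply: le_trans (normcD _ _) _.
by rewrite normcM complexiE normc_i mul1r !normcR.
Qed.

Lemma cReD z w : complex.Re (z + w) = complex.Re z + complex.Re w.
Proof. by case: z w => [? ?] [? ?]. Qed.
Lemma cImD z w : complex.Im (z + w) = complex.Im z + complex.Im w.
Proof. by case: z w => [? ?] [? ?]. Qed.
Lemma cReN z : complex.Re (- z) = - complex.Re z.
Proof. by case: z. Qed.
Lemma cImN z : complex.Im (- z) = - complex.Im z.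
Proof. by case: z. Qed.
Lemma cReM z w : complex.Re (z * w) =
  complex.Re z * complex.Re w - complex.Im z * complex.Im w.
Proof. by case: z w => [? ?] [? ?]. Qed.
Lemma cImM z w : complex.Im (z * w) =
  complex.Re z * complex.Im w + complex.Im z * complex.Re w.
Proof. by case: z w => [? ?] [? ?]. Qed.

Lemma cReR r : complex.Re (r%:C : R[i]) = r.
Proof. by []. Qed.
Lemma cImR r : complex.Im (r%:C : R[i]) = 0.
Proof. by []. Qed.
Lemma cRe_i : complex.Re ('i%R : R[i]) = 0.
Proof. by []. Qed.
Lemma cIm_i : complex.Im ('i%R : R[i]) = 1.
Proof. by []. Qed.
Definition cpx_simp := (cRe_i, cIm_i, cReD, cReN, cReM, cReR, cImD, cImN, cImM, cImR).

Lemma complex_ext z w :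
  complex.Re z = complex.Re w -> complex.Im z = complex.Im w -> z = w.
Proof. by case: z w => [? ?] [? ?] /= -> ->. Qed.

Lemma nbhs_normcP z (A : set R[i]) :
  nbhs z A <-> exists2 e, 0 < e & forall y, normc (y - z) < e -> A y.
Proof.
split.
  move/nbhs_ballP => -[e /= e0 eA]; move: e0; rewrite ltcE => /andP[/eqP ei er].
  exists (complex.Re e) => // y yz; apply: eA.
  rewrite -ball_normE /= normr_normc normcC ltcE /= ei eqxx /=; exact: yz.
move=> [e e0 eA]; apply/nbhs_ballP; exists e%:C => /=; first by rewrite ltcR.
by move=> y; rewrite -ball_normE /= normr_normc ltcR normcC; exact: eA.
Qed.

Lemma discE z r y : disc z r y <-> normc (y - z) < r.
Proof. by rewrite /disc -ball_normE /= normr_normc ltcR normcC. Qed.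

Lemma cvg_normcP (T : Type) (F : set_system T) (FF : Filter F)
    (f : T -> R[i]) (l : R[i]) :
  f @ F --> l <-> forall e, 0 < e -> \forall x \near F, normc (f x - l) < e.
Proof.
split=> [fl e e0|fl A /nbhs_normcP[e e0 eA]].
  have /fl : nbhs l [set y | normc (y - l) < e] by apply/nbhs_normcP; exists e.
  by [].
by apply: filterS (fl _ e0) => x; exact: eA.
Qed.

Lemma open_normcP (U : set R[i]) : open U <->
  forall z, U z -> exists2 e, 0 < e & forall y, normc (y - z) < e -> U y.
Proof.
by rewrite openE; split=> Uo z /Uo /nbhs_normcP.
Qed.

Lemma continuous_normcP (f : R[i] -> R[i]) z : {for z, continuous f} <->
  forall e, 0 < e -> exists2 d, 0 < d &
    forall y, normc (y - z) < d -> normc (f y - f z) < e.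
Proof.
split=> [fz e e0|fz].
  have /(cvg_normcP (nbhs_filter z)) := fz.
  by move=> /(_ _ e0) /nbhs_normcP.
apply/(cvg_normcP (nbhs_filter z)) => e e0; apply/nbhs_normcP; exact: fz.
Qed.

(** Complex differentiability with derivative [l], as a linear error bound
    rather than a limit of quotients: in this form it composes with curves. *)
Definition cdiff (f : R[i] -> R[i]) (z l : R[i]) : Prop :=
  forall e, 0 < e -> exists2 d, 0 < d & forall y, normc (y - z) < d ->
    normc (f y - f z - l * (y - z)) <= e * normc (y - z).

Lemma derivable_cdiffP (f : R[i] -> R[i]) z :
  derivable f z 1 <-> exists l, cdiff f z l.
Proof.
split.
  move=> /cvg_ex[l /= fl]; exists l => e e0.
  have /cvg_normcP/(_ _ e0) := fl.
  rewrite near_withinE => /nbhs_normcP[d d0 dl]; exists d => // y yd.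
  have [->|yz] := eqVneq y z.
    by rewrite !subrr mulr0 subr0 normc0 mulr0.
  have yz0 : y - z != 0 by rewrite subr_eq0.
  have := dl (y - z); rewrite subr0 => /(_ yd yz0).
  have -> : (y - z) *: 1 = y - z by exact: mulr1.
  rewrite subrK.
  have -> : (y - z)^-1 *: (f y - f z) - l =
    (y - z)^-1 * (f y - f z - l * (y - z)).
    rewrite mulrBr mulrCA mulVf // mulr1//.
  by rewrite normcM normcV mulrC ltr_pdivrMr ?normc_gt0 // => /ltW.
move=> [l fl]; apply/cvg_ex; exists l; apply/cvg_normcP => e e0.
have e20 : 0 < e / 2 by rewrite divr_gt0.
have [d d0 dl] := fl _ e20.
rewrite near_withinE; apply/nbhs_normcP; exists d => // y; rewrite subr0 => yd y0.
have := dl (y + z); rewrite addrK => /(_ yd) h.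
have -> : y *: 1 = y by exact: mulr1.
have -> : y^-1 *: (f (y + z) - f z) - l = y^-1 * (f (y + z) - f z - l * y).
  by rewrite mulrBr mulrCA mulVf // mulr1.
rewrite normcM normcV mulrC ltr_pdivrMr ?normc_gt0 //.
apply: le_lt_trans h _; rewrite ltr_pM2r ?normc_gt0 //.
by rewrite ltr_pdivrMr // mulr2n mulrDr mulr1 ltrDl.
Qed.

Lemma cdiff_continuous f z l : cdiff f z l -> {for z, continuous f}.
Proof.
move=> fl; apply/continuous_normcP => e e0.
have [d d0 dl] := fl 1 ltr01.
pose m := normc l + 1.
have m0 : 0 < m by rewrite ltr_wpDl // normc_ge0.
exists (Num.min d (e / m)); first by rewrite lt_min d0 divr_gt0.
move=> y; rewrite lt_min => /andP[/dl h1 h2].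
rewrite -[f y - f z](subrK (l * (y - z))).
apply: le_lt_trans (normcD _ _) _; rewrite normcM.
apply: (@le_lt_trans _ _ (m * normc (y - z))).
  by rewrite /m mulrDl addrC lerD2l.
by rewrite mulrC -ltr_pdivlMr.
Qed.

Lemma cdiff_comp_eq f g z l d : 0 < d ->
  (forall y, normc (y - z) < d -> f y = g y) -> cdiff f z l -> cdiff g z l.
Proof.
move=> d0 fg fl e e0; have [d' d'0 h] := fl _ e0.
exists (Num.min d d'); first by rewrite lt_min d0.
move=> y; rewrite lt_min => /andP[yd yd'].
by rewrite -!fg ?subrr ?normc0 // h.
Qed.

Lemma cdiffD f g z l m : cdiff f z l -> cdiff g z m ->
  cdiff (fun y => f y + g y) z (l + m).
Proof.
move=> fl gm e e0; have e20 : 0 < e / 2 by rewrite divr_gt0.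
have [d d0 dl] := fl _ e20; have [d' d'0 dl'] := gm _ e20.
exists (Num.min d d'); first by rewrite lt_min d0.
move=> y; rewrite lt_min => /andP[/dl h1 /dl' h2].
have -> : f y + g y - (f z + g z) - (l + m) * (y - z) =
  (f y - f z - l * (y - z)) + (g y - g z - m * (y - z)) by ring.
apply: le_trans (normcD _ _) _; apply: le_trans (lerD h1 h2) _.
by rewrite -mulrDl -splitr.
Qed.

Lemma cdiffZ k f z l : cdiff f z l -> cdiff (fun y => k * f y) z (k * l).
Proof.
move=> fl e e0.
have m0 : 0 < normc k + 1 by rewrite ltr_wpDl // normc_ge0.
have e20 : 0 < e / (normc k + 1) by rewrite divr_gt0.
have [d d0 dl] := fl _ e20; exists d => // y /dl h.
have -> : k * f y - k * f z - k * l * (y - z) = k * (f y - f z - l * (y - z)).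
  by ring.
rewrite normcM; apply: le_trans (ler_wpM2l (normc_ge0 _) h) _.
rewrite mulrA ler_wpM2r ?normc_ge0 // mulrCA ger_pMr // ler_pdivrMr // mul1r.
by rewrite lerDl.
Qed.

Lemma cdiff_inv_sub (w : R[i]) (u : R[i]) : u - w != 0 ->
  cdiff (fun y => (y - w)^-1) u (- (u - w)^-1 ^+ 2).
Proof.
move=> uw e e0; have nu : 0 < normc (u - w) by rewrite normc_gt0.
pose r := normc (u - w) / 2; have r0 : 0 < r by rewrite divr_gt0.
exists (Num.min r (e * (r * (r * r)))).
  by rewrite lt_min r0 !mulr_gt0.
move=> y; rewrite lt_min => /andP[y1 y2].
have k1 : r <= normc (y - w).
  have := normc_tri y u w; rewrite normcC /r in y1 *; lra.
have yw : y - w != 0 by rewrite -normc_gt0 (lt_le_trans r0).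
have -> : (y - w)^-1 - (u - w)^-1 - - (u - w)^-1 ^+ 2 * (y - u) =
    (y - u) / ((y - w) * ((u - w) * (u - w))) * (y - u).
  by field; rewrite uw yw.
rewrite normcM ler_wpM2r ?normc_ge0 // normcM normcV !normcM.
have k2 : r <= normc (u - w) by rewrite /r; lra.
rewrite ler_pdivrMr ?mulr_gt0 ?(lt_le_trans r0) //.
apply: (le_trans (ltW y2)); apply: ler_wpM2l; first exact: ltW.
apply: ler_pM => //; first exact: ltW.
  by apply: mulr_ge0; exact: ltW.
by apply: ler_pM => //; exact: ltW.
Qed.

Lemma cdiffM (f g : R[i] -> R[i]) u l l' : cdiff f u l -> cdiff g u l' ->
  cdiff (fun y => f y * g y) u (l * g u + f u * l').
Proof.
move=> fl gl e e0.
have gc := cdiff_continuous gl.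
pose A := normc (g u) + 1; pose B := normc (f u) + 1; pose C := normc l + 1.
have A0 : 0 < A by rewrite ltr_wpDl // normc_ge0.
have B0 : 0 < B by rewrite ltr_wpDl // normc_ge0.
have C0 : 0 < C by rewrite ltr_wpDl // normc_ge0.
pose eA := e / 3 / A; pose eB := e / 3 / B; pose eC := e / 3 / C.
have eA0 : 0 < eA by rewrite !divr_gt0.
have eB0 : 0 < eB by rewrite !divr_gt0.
have eC0 : 0 < eC by rewrite !divr_gt0.
have [d1 d10 h1] := fl _ eA0; have [d2 d20 h2] := gl _ eB0.
have /continuous_normcP gc' := gc.
have [d3 d30 h3] := gc' _ eC0; have [d4 d40 h4] := gc' _ ltr01.
exists (Num.min (Num.min d1 d2) (Num.min d3 d4)); first by rewrite !lt_min d10 d20 d30.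
move=> y; rewrite !lt_min => /andP[/andP[/h1 k1 /h2 k2] /andP[/h3 k3 /h4 k4]].
have -> : f y * g y - f u * g u - (l * g u + f u * l') * (y - u) =
    (f y - f u - l * (y - u)) * g y + l * (g y - g u) * (y - u) +
    f u * (g y - g u - l' * (y - u)) by ring.
have gA : normc (g y) <= A.
  have := normc_tri (g u) (g y) 0; rewrite !subr0 /A; lra.
have fB : normc (f u) <= B by rewrite /B; lra.
have lC : normc l <= C by rewrite /C; lra.
have n0 := normc_ge0.
set N := normc (y - u) in k1 k2 *.
have N0 : 0 <= N by exact: n0.
have t1 : normc (f y - f u - l * (y - u)) * normc (g y) <= e / 3 * N.
  apply: (@le_trans _ _ (eA * N * A)); first by apply: ler_pM.
  by rewrite /eA le_eqVlt; apply/orP; left; apply/eqP; field; rewrite gt_eqF.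
have t2 : normc l * normc (g y - g u) * N <= e / 3 * N.
  apply: ler_wpM2r => //; apply: (@le_trans _ _ (C * eC)).
    by apply: ler_pM => //; exact: ltW.
  by rewrite /eC le_eqVlt; apply/orP; left; apply/eqP; field; rewrite gt_eqF.
have t3 : normc (f u) * normc (g y - g u - l' * (y - u)) <= e / 3 * N.
  apply: (@le_trans _ _ (B * (eB * N))); first by apply: ler_pM.
  by rewrite /eB le_eqVlt; apply/orP; left; apply/eqP; field; rewrite gt_eqF.
apply: (le_trans (normcD _ _)); rewrite normcM.
apply: (le_trans (lerD (normcD _ _) (lexx _))); rewrite !normcM -/N; lra.
Qed.

End Modulus.

(** * Curves in the plane and their integrals *)

Section Cint.
Context {R : realType}.
Implicit Types (c f g : R -> R[i]) (a b t : R).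

Lemma ccontM f g t : {for t, continuous f} -> {for t, continuous g} ->
  {for t, continuous (fun s => f s * g s)}.
Proof. exact: cvgM. Qed.
Lemma ccontD f g t : {for t, continuous f} -> {for t, continuous g} ->
  {for t, continuous (fun s => f s + g s)}.
Proof. exact: cvgD. Qed.
Lemma ccontN f t : {for t, continuous f} ->
  {for t, continuous (fun s => - f s)}.
Proof. exact: cvgN. Qed.
Lemma ccontV f t : {for t, continuous f} -> f t != 0 ->
  {for t, continuous (fun s => (f s)^-1)}.
Proof. by move=> fc f0; exact: cvgV. Qed.
Lemma ccont_cst k t : {for t, continuous (fun _ : R => k : R[i])}.
Proof. exact: cvg_cst. Qed.

Lemma ccontP c t : {for t, continuous c} <->
  forall e, 0 < e -> exists2 d, 0 < d &
    forall s, `|s - t| < d -> normc (c s - c t) < e.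
Proof.
split=> [fz e e0|fz].
  have /(cvg_normcP (nbhs_filter t)) := fz.
  move=> /(_ _ e0) /nbhs_ballP[d /= d0 dP]; exists d => // s st; apply: dP.
  by rewrite /ball /= distrC.
apply/(cvg_normcP (nbhs_filter t)) => e e0; have [d d0 dP] := fz _ e0.
by apply/nbhs_ballP; exists d => //= s; rewrite /ball /= distrC; exact: dP.
Qed.

Lemma rcontP (c : R -> R) t : {for t, continuous c} <->
  forall e, 0 < e -> exists2 d, 0 < d &
    forall s, `|s - t| < d -> `|c s - c t| < e.
Proof.
split=> [fz e e0|fz].
  have /cvgrPdist_lt := fz.
  move=> /(_ _ e0) /nbhs_ballP[d /= d0 dP]; exists d => // s st.
  rewrite distrC; apply: dP.
  by rewrite /ball /= distrC.
apply/cvgrPdist_lt => e e0; have [d d0 dP] := fz _ e0.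
apply/nbhs_ballP; exists d => //= s; rewrite /ball /= distrC.
by move/dP; rewrite distrC.
Qed.

Lemma ccont_ReIm c t : {for t, continuous c} <->
  {for t, continuous (fun s => complex.Re (c s))} /\
  {for t, continuous (fun s => complex.Im (c s))}.
Proof.
split=> [/ccontP ct|[/rcontP ct /rcontP ct']].
  split; apply/rcontP => e /ct[d d0 dP]; exists d => // s /dP; apply: le_lt_trans.
  - by rewrite -cReN -cReD Re_le_normc.
  - by rewrite -cImN -cImD Im_le_normc.
apply/ccontP => e e0; have e20 : 0 < e / 2 by rewrite divr_gt0.
have [d d0 dP] := ct _ e20; have [d' d'0 dP'] := ct' _ e20.
exists (Num.min d d'); first by rewrite lt_min d0.
move=> s; rewrite lt_min => /andP[/dP h1 /dP' h2].
apply: le_lt_trans (normc_le_ReIm _) _.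
by rewrite cReD cReN cImD cImN [e]splitr ltrD.
Qed.

Lemma ccont_real (c : R -> R) t :
  {for t, continuous c} -> {for t, continuous (fun s => (c s)%:C)}.
Proof. by move=> h; apply/ccont_ReIm; split => //=; exact: cvg_cst. Qed.

Lemma ccont_comp (F : R[i] -> R[i]) c t : {for t, continuous c} ->
  {for c t, continuous F} -> {for t, continuous (fun s => F (c s))}.
Proof. by move=> h1 h2; exact: (continuous_comp h1 h2). Qed.

Lemma ccont_normc c t : {for t, continuous c} ->
  {for t, continuous (fun s => normc (c s))}.
Proof.
move=> /ccontP h; apply/rcontP => e /h[d d0 dP]; exists d => // s /dP.
apply: le_lt_trans; rewrite ler_norml; apply/andP; split.
  rewrite lerNl opprB normcC lerBlDr -{1}[c t](subrK (c s)); exact: normcD.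
by rewrite lerBlDr -{1}[c s](subrK (c t)); exact: normcD.
Qed.

(** The counterpart of [cdiff] for curves; see [rdiff_comp]. *)
Definition rdiff c t (v : R[i]) : Prop :=
  forall e, 0 < e -> exists2 d, 0 < d & forall s, `|s - t| < d ->
    normc (c s - c t - (s - t)%:C * v) <= e * `|s - t|.

Lemma is_derive_distP (f : R -> R) t l : is_derive t 1 f l <->
  forall e, 0 < e -> exists2 d, 0 < d & forall s, `|s - t| < d ->
    `|f s - f t - (s - t) * l| <= e * `|s - t|.
Proof.
split=> [[fd fl] e e0|fl].
  have : (fun h => h^-1 *: (f (h *: 1 + t) - f t)) @ 0^' --> l.
    by rewrite -fl; exact: fd.
  move=> /cvgrPdist_lt/(_ _ e0).
  rewrite near_withinE => /nbhs_ballP[d /= d0 dP]; exists d => // s st.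
  have [->|nst] := eqVneq s t; first by rewrite !subrr mul0r subr0 normr0 mulr0.
  have nst0 : s - t != 0 by rewrite subr_eq0.
  have := dP (s - t); rewrite /ball /= sub0r normrN => /(_ st nst0).
  rewrite /GRing.scale /= mulr1 subrK distrC => h.
  have -> : f s - f t - (s - t) * l =
    ((s - t)^-1 * (f s - f t) - l) * (s - t) by field.
  by rewrite normrM ler_wpM2r // ltW.
suff h : (fun h => h^-1 *: (f (h *: 1 + t) - f t)) @ 0^' --> l.
  by apply: DeriveDef; [apply/cvg_ex; exists l|exact: cvg_lim].
apply/cvgrPdist_lt => e e0; have e20 : 0 < e / 2 by rewrite divr_gt0.
have [d d0 dP] := fl _ e20.
rewrite near_withinE; apply/nbhs_ballP; exists d => //= s.
rewrite /ball /= sub0r normrN => sd s0.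
have := dP (s + t); rewrite addrK => /(_ sd) h.
rewrite /GRing.scale /= mulr1 distrC.
have -> : s^-1 * (f (s + t) - f t) - l = (f (s + t) - f t - s * l) / s by field.
rewrite normrM normfV ltr_pdivrMr ?normr_gt0 //.
apply: le_lt_trans h _; rewrite ltr_pM2r ?normr_gt0 //; lra.
Qed.

Lemma rdiff_ReIm c t v : rdiff c t v <->
  is_derive t 1 (fun s => complex.Re (c s)) (complex.Re v) /\
  is_derive t 1 (fun s => complex.Im (c s)) (complex.Im v).
Proof.
have reE s : complex.Re (c s) - complex.Re (c t) - (s - t) * complex.Re v =
  complex.Re (c s - c t - (s - t)%:C * v).
  by rewrite !cpx_simp mul0r subr0.
have imE s : complex.Im (c s) - complex.Im (c t) - (s - t) * complex.Im v =
  complex.Im (c s - c t - (s - t)%:C * v).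
  by rewrite !cpx_simp mul0r addr0.
split=> [h|[/is_derive_distP h1 /is_derive_distP h2]].
  split; apply/is_derive_distP => e /h[d d0 dP]; exists d => // s /dP.
  - by apply: le_trans; rewrite reE Re_le_normc.
  - by apply: le_trans; rewrite imE Im_le_normc.
move=> e e0; have e20 : 0 < e / 2 by rewrite divr_gt0.
have [d d0 dP] := h1 _ e20; have [d' d'0 dP'] := h2 _ e20.
exists (Num.min d d'); first by rewrite lt_min d0.
move=> s; rewrite lt_min => /andP[/dP k1 /dP' k2].
apply: le_trans (normc_le_ReIm _) _; rewrite -reE -imE.
apply: le_trans (lerD k1 k2) _; lra.
Qed.

Lemma rdiff_continuous c t v : rdiff c t v -> {for t, continuous c}.
Proof.
move=> /rdiff_ReIm[h1 h2]; apply/ccont_ReIm; split.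
- apply: differentiable_continuous; apply/derivable1_diffP.
  exact: (@ex_derive _ _ _ _ _ _ _ h1).
- apply: differentiable_continuous; apply/derivable1_diffP.
  exact: (@ex_derive _ _ _ _ _ _ _ h2).
Qed.

Lemma rdiffD f g t v w : rdiff f t v -> rdiff g t w ->
  rdiff (fun s => f s + g s) t (v + w).
Proof.
move=> fl gm e e0; have e20 : 0 < e / 2 by rewrite divr_gt0.
have [d d0 dl] := fl _ e20; have [d' d'0 dl'] := gm _ e20.
exists (Num.min d d'); first by rewrite lt_min d0.
move=> y; rewrite lt_min => /andP[/dl h1 /dl' h2].
have -> : f y + g y - (f t + g t) - (y - t)%:C * (v + w) =
  (f y - f t - (y - t)%:C * v) + (g y - g t - (y - t)%:C * w) by ring.
apply: le_trans (normcD _ _) _; apply: le_trans (lerD h1 h2) _; lra.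
Qed.

Lemma rdiff_comp (F : R[i] -> R[i]) c t l v :
  cdiff F (c t) l -> rdiff c t v -> rdiff (fun s => F (c s)) t (l * v).
Proof.
move=> Fl cv e e0.
have nl : 0 < normc l + 1 by rewrite ltr_wpDl // normc_ge0.
have nv : 0 < normc v + 1 by rewrite ltr_wpDl // normc_ge0.
pose e1 := e / 2 / (normc v + 1); pose e2 := e / 2 / (normc l + 1).
have e10 : 0 < e1 by rewrite !divr_gt0.
have e20 : 0 < e2 by rewrite !divr_gt0.
have [d d0 dP] := Fl _ e10.
have [d1 d10 d1P] := cv _ e20.
have [d2 d20 d2P] := cv 1 ltr01.
have /ccontP/(_ _ d0)[d3 d30 d3P] := rdiff_continuous cv.
exists (Num.min d1 (Num.min d2 d3)); first by rewrite !lt_min d10 d20.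
move=> s; rewrite !lt_min => /and3P[/d1P k1 /d2P k2 /d3P/dP k3].
have -> : F (c s) - F (c t) - (s - t)%:C * (l * v) =
  (F (c s) - F (c t) - l * (c s - c t)) + l * (c s - c t - (s - t)%:C * v).
  by ring.
have k4 : normc (c s - c t) <= (normc v + 1) * `|s - t|.
  rewrite -[c s - c t](subrK ((s - t)%:C * v)).
  apply: le_trans (normcD _ _) _; rewrite normcM normcR mulrDl addrC.
  by rewrite lerD // mulrC.
apply: le_trans (normcD _ _) _; rewrite normcM.
rewrite [e]splitr mulrDl lerD //.
  apply: le_trans k3 _; apply: le_trans (ler_wpM2l (ltW e10) k4) _.
  by rewrite /e1 mulrA divfK ?gt_eqF.
apply: le_trans (ler_wpM2l (normc_ge0 _) k1) _; rewrite /e2.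
have : normc l * (e / 2 / (normc l + 1)) <= e / 2.
  rewrite mulrCA ger_pMr ?divr_gt0 // ler_pdivrMr // mul1r; lra.
by move=> h; rewrite mulrA ler_wpM2r.
Qed.


Local Notation mu := (@lebesgue_measure R).

Definition cint a b f : R[i] :=
  (\int[mu]_(t in `[a, b]) complex.Re (f t)) +i*
  (\int[mu]_(t in `[a, b]) complex.Im (f t)).

Definition cintegrable a b f : Prop :=
  mu.-integrable `[a, b] (fun t => (complex.Re (f t))%:E) /\
  mu.-integrable `[a, b] (fun t => (complex.Im (f t))%:E).

Lemma rcont_integrable (f : R -> R) a b :
  (forall t, a <= t <= b -> {for t, continuous f}) ->
  mu.-integrable `[a, b] (fun t => (f t)%:E).
Proof.
move=> h; apply: continuous_compact_integrable; first exact: segment_compact.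
apply: continuous_in_subspaceT => t; rewrite inE /= in_itv /= => /h//.
Qed.

Lemma ccont_cintegrable f a b :
  (forall t, a <= t <= b -> {for t, continuous f}) -> cintegrable a b f.
Proof.
by move=> h; split; apply: rcont_integrable => t /h/ccont_ReIm[].
Qed.

Lemma eq_cint f g a b :
  (forall t, a <= t <= b -> f t = g t) -> cint a b f = cint a b g.
Proof.
move=> h; congr (_ +i* _); apply: eq_Rintegral => t; rewrite inE /= in_itv /=;
  by move=> /h ->.
Qed.

Lemma measurable_seg a b : measurable (`[a, b] : set (measurableTypeR R)).
Proof. exact: measurable_itv. Qed.

Lemma eq_rintegrable (f g : R -> R) a b :
  (forall t, a <= t <= b -> f t = g t) ->
  mu.-integrable `[a, b] (fun t => (f t)%:E) ->
  mu.-integrable `[a, b] (fun t => (g t)%:E).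
Proof.
move=> h; apply: (@eq_integrable _ _ _ mu _ (measurable_seg a b)
  (fun t => (f t)%:E) (fun t => (g t)%:E)) => t.
by rewrite inE /= in_itv /= => /h ->.
Qed.

Lemma rintegrableD (f g : R -> R) a b :
  mu.-integrable `[a, b] (fun t => (f t)%:E) ->
  mu.-integrable `[a, b] (fun t => (g t)%:E) ->
  mu.-integrable `[a, b] (fun t => (f t + g t)%:E).
Proof. by move=> h1 h2; exact: (integrableD (measurable_seg a b) h1 h2). Qed.

Lemma rintegrableZ k (f : R -> R) a b :
  mu.-integrable `[a, b] (fun t => (f t)%:E) ->
  mu.-integrable `[a, b] (fun t => (k * f t)%:E).
Proof. by move=> h; exact: (integrableZl (measurable_seg a b) k h). Qed.

Lemma rintegrableB (f g : R -> R) a b :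
  mu.-integrable `[a, b] (fun t => (f t)%:E) ->
  mu.-integrable `[a, b] (fun t => (g t)%:E) ->
  mu.-integrable `[a, b] (fun t => (f t - g t)%:E).
Proof. by move=> h1 h2; exact: (integrableB (measurable_seg a b) h1 h2). Qed.

Lemma eq_cintegrable f g a b :
  (forall t, a <= t <= b -> f t = g t) ->
  cintegrable a b f -> cintegrable a b g.
Proof.
move=> h [h1 h2]; split.
  by apply: eq_rintegrable h1 => t /h ->.
by apply: eq_rintegrable h2 => t /h ->.
Qed.

Lemma cintegrableD f g a b : cintegrable a b f -> cintegrable a b g ->
  cintegrable a b (fun t => f t + g t).
Proof.
move=> [f1 f2] [g1 g2]; split.
  by apply: eq_rintegrable (rintegrableD f1 g1) => t _; rewrite cReD.
by apply: eq_rintegrable (rintegrableD f2 g2) => t _; rewrite cImD.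
Qed.

Lemma cintegrableZ k f a b : cintegrable a b f ->
  cintegrable a b (fun t => k * f t).
Proof.
move=> [f1 f2]; split.
  apply: eq_rintegrable (rintegrableB (rintegrableZ (complex.Re k) f1)
    (rintegrableZ (complex.Im k) f2)) => t _.
  by rewrite cReM.
apply: eq_rintegrable (rintegrableD (rintegrableZ (complex.Re k) f2)
    (rintegrableZ (complex.Im k) f1)) => t _.
by rewrite cImM.
Qed.

Lemma cintD f g a b : cintegrable a b f -> cintegrable a b g ->
  cint a b (fun t => f t + g t) = cint a b f + cint a b g.
Proof.
move=> [f1 f2] [g1 g2]; apply: complex_ext; rewrite !cpx_simp /=.
  by rewrite -RintegralD //; apply: eq_Rintegral => t _; rewrite cReD.
by rewrite -RintegralD //; apply: eq_Rintegral => t _; rewrite cImD.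
Qed.

Lemma cintZ k f a b : cintegrable a b f ->
  cint a b (fun t => k * f t) = k * cint a b f.
Proof.
move=> [f1 f2]; have mab := measurable_seg a b.
apply: complex_ext; rewrite !cpx_simp /=.
  rewrite -!RintegralZl // -RintegralB //; last 2 first.
  - exact: (rintegrableZ (complex.Re k) f1).
  - exact: (rintegrableZ (complex.Im k) f2).
  by apply: eq_Rintegral => t _; rewrite cReM.
rewrite -!RintegralZl // -RintegralD //; last 2 first.
- exact: (rintegrableZ (complex.Re k) f2).
- exact: (rintegrableZ (complex.Im k) f1).
by apply: eq_Rintegral => t _; rewrite cImM.
Qed.

Lemma cintegrableB f g a b : cintegrable a b f -> cintegrable a b g ->
  cintegrable a b (fun t => f t - g t).
Proof.
move=> fi gi.
apply: eq_cintegrable (cintegrableD fi (cintegrableZ (-1) gi)) => t _.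
by rewrite mulN1r.
Qed.

Lemma cintB f g a b : cintegrable a b f -> cintegrable a b g ->
  cint a b (fun t => f t - g t) = cint a b f - cint a b g.
Proof.
move=> fi gi; rewrite -[RHS]/(cint a b f + - cint a b g) -mulN1r -cintZ //.
rewrite -cintD //; last exact: cintegrableZ.
by apply: eq_cint => t _; rewrite mulN1r.
Qed.

(** The factor 2 comes from bounding the two components separately. *)
Lemma normc_cint_le f (g : R -> R) a b : cintegrable a b f ->
  mu.-integrable `[a, b] (fun t => (g t)%:E) ->
  (forall t, a <= t <= b -> normc (f t) <= g t) ->
  normc (cint a b f) <= 2 * \int[mu]_(t in `[a, b]) g t.
Proof.
move=> [f1 f2] ig fg; have mab := measurable_seg a b.
apply: le_trans (normc_le_ReIm _) _; rewrite /= mulr2n mulrDl mul1r.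
apply: lerD.
  apply: le_trans (le_normr_Rintegral _ f1) _ => //.
  apply: le_Rintegral => //; first exact: integrable_norm f1.
  by move=> t /=; rewrite in_itv /= => /fg; apply: le_trans; exact: Re_le_normc.
apply: le_trans (le_normr_Rintegral _ f2) _ => //.
apply: le_Rintegral => //; first exact: integrable_norm f2.
by move=> t /=; rewrite in_itv /= => /fg; apply: le_trans; exact: Im_le_normc.
Qed.

Lemma Rintegral_cst_itv a b (M : R) : a <= b ->
  \int[mu]_(t in `[a, b]) M = M * (b - a).
Proof.
move=> ab; rewrite Rintegral_cst //= lebesgue_measure_itv /= lte_fin.
by case: ltgtP ab => //= -> _; rewrite subrr.
Qed.

Lemma integrable_cst_itv a b (M : R) :
  mu.-integrable `[a, b] (fun t => M%:E).
Proof. by apply: rcont_integrable => t _; exact: cvg_cst. Qed.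

Lemma normc_cint_bound f M a b : a <= b -> cintegrable a b f ->
  (forall t, a <= t <= b -> normc (f t) <= M) ->
  normc (cint a b f) <= 2 * M * (b - a).
Proof.
move=> ab fi fM; apply: le_trans (normc_cint_le fi (integrable_cst_itv a b M) fM) _.
by rewrite Rintegral_cst_itv // mulrA.
Qed.

Lemma cintegrableS f a b a' b' : a' <= a -> b <= b' ->
  cintegrable a' b' f -> cintegrable a b f.
Proof.
move=> aa bb [f1 f2]; split; [apply: integrableS f1|apply: integrableS f2] => //;
  by apply: subset_itv; rewrite bnd_simp.
Qed.

Lemma cint_split f a m b : a <= m <= b -> cintegrable a b f ->
  cint a b f = cint a m f + cint m b f.
Proof.
move=> /andP[am mb] [f1 f2].
have sub : `]m, b] `<=` (`[a, b] : set R).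
  by apply: subset_itv; rewrite bnd_simp.
apply: complex_ext; rewrite !cpx_simp /=.
  rewrite -[X in _ + X]Rintegral_itv_obnd_cbnd; last exact: integrableS f1.
  by rewrite -(@Rintegral_itvB _ _ _ _ m f1) ?bnd_simp // subrKC.
rewrite -[X in _ + X]Rintegral_itv_obnd_cbnd; last exact: integrableS f2.
by rewrite -(@Rintegral_itvB _ _ _ _ m f2) ?bnd_simp // subrKC.
Qed.

Lemma rcont_FTC (F f : R -> R) a b : a <= b ->
  (forall t, a <= t <= b -> is_derive t 1 F (f t)) ->
  (forall t, a <= t <= b -> {for t, continuous f}) ->
  \int[mu]_(t in `[a, b]) f t = F b - F a.
Proof.
rewrite le_eqVlt => /predU1P[<- _ _|ab dF cf].
  by rewrite set_itv1 Rintegral_set1 subrr.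
have cF t : a <= t <= b -> {for t, continuous F}.
  move=> /dF h; apply: differentiable_continuous; apply/derivable1_diffP.
  exact: (@ex_derive _ _ _ _ _ _ _ h).
rewrite /Rintegral (@continuous_FTC2 _ f F) //.
- apply: continuous_in_subspaceT => t; rewrite inE /= in_itv /= => /cf//.
- split.
  + move=> t; rewrite in_itv /= => /andP[ta tb].
    by apply: (@ex_derive _ _ _ _ _ _ _ (dF t _)); rewrite !ltW.
  + by apply: cvg_at_right_filter; apply: cF; rewrite lexx ltW.
  + by apply: cvg_at_left_filter; apply: cF; rewrite lexx ltW.
- move=> t; rewrite in_itv /= => /andP[ta tb]; rewrite derive1E.
  by apply: (@derive_val _ _ _ _ _ _ _ (dF t _)); rewrite !ltW.
Qed.

Lemma cint_FTC F f a b : a <= b ->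
  (forall t, a <= t <= b -> rdiff F t (f t)) ->
  (forall t, a <= t <= b -> {for t, continuous f}) ->
  cint a b f = F b - F a.
Proof.
move=> ab dF cf; apply: complex_ext; rewrite !cpx_simp /=.
  apply: (rcont_FTC ab (F := fun t => complex.Re (F t))) => t tab.
    by have /rdiff_ReIm[] := dF _ tab.
  by have /ccont_ReIm[] := cf _ tab.
apply: (rcont_FTC ab (F := fun t => complex.Im (F t))) => t tab.
  by have /rdiff_ReIm[] := dF _ tab.
by have /ccont_ReIm[] := cf _ tab.
Qed.

(** Mean value inequality, again with a factor 2. *)
Lemma normc_mvt F f a b M : a <= b ->
  (forall t, a <= t <= b -> rdiff F t (f t)) ->
  (forall t, a <= t <= b -> normc (f t) <= M) ->
  normc (F b - F a) <= 2 * M * (b - a).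
Proof.
rewrite le_eqVlt => /predU1P[<- _ _|ab dF fM].
  by rewrite !subrr normc0 mulr0.
have key (G g : R -> R) : (forall t, a <= t <= b -> is_derive t 1 G (g t)) ->
    (forall t, a <= t <= b -> `|g t| <= M) -> `|G b - G a| <= M * (b - a).
  move=> dG gM; have [] := MVT ab (f := G) (df := g).
  - move=> t; rewrite in_itv /= => /andP[ta tb]; apply: dG; by rewrite !ltW.
  - apply: continuous_in_subspaceT => t; rewrite inE /= in_itv /= => /dG h.
    apply: differentiable_continuous; apply/derivable1_diffP.
    exact: (@ex_derive _ _ _ _ _ _ _ h).
  move=> t; rewrite in_itv /= => /andP[ta tb] ->.
  rewrite normrM [X in _ * X]gtr0_norm ?subr_gt0 // ler_wpM2r ?subr_ge0 ?(ltW ab) //.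
  by apply: gM; rewrite !ltW.
apply: le_trans (normc_le_ReIm _) _; rewrite !cpx_simp -mulrA mulr2n mulrDl mul1r.
apply: lerD.
  apply: (key (fun t => complex.Re (F t)) (fun t => complex.Re (f t))).
    by move=> t /dF/rdiff_ReIm[].
  by move=> t /fM; apply: le_trans; exact: Re_le_normc.
apply: (key (fun t => complex.Im (F t)) (fun t => complex.Im (f t))).
  by move=> t /dF/rdiff_ReIm[].
by move=> t /fM; apply: le_trans; exact: Im_le_normc.
Qed.

End Cint.

(** * Repeated quartering of a rectangle *)

Section Bisection.
Context {R : realType}.

Lemma half_pow_small (w d : R) : 0 < d -> exists n, w / 2 ^+ n < d.
Proof.
move=> d0; have [n hn] : exists n, w / d < n%:R.
  have [w0|w0] := ltP (w / d) 0; first by exists 0%N.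
  exists (Num.trunc (w / d)).+1; exact: truncnS_gt.
exists n; rewrite ltr_pdivrMr ?exprn_gt0 // mulrC -ltr_pdivrMr //.
apply: lt_le_trans hn _; rewrite -natrX ler_nat; apply: ltnW; exact: ltn_expl.
Qed.

Lemma nested_intervals (x w : nat -> R) :
  (forall n, x n <= x n.+1) -> (forall n, x n.+1 + w n.+1 <= x n + w n) ->
  (forall n, 0 <= w n) -> exists p, forall n, x n <= p <= x n + w n.
Proof.
move=> xS xw w0.
have xm m n : x m <= x (m + n)%N.
  elim: n => [|n IHn]; first by rewrite addn0.
  by rewrite addnS; apply: le_trans IHn (xS _).
have xwm m n : x (m + n)%N + w (m + n)%N <= x m + w m.
  elim: n => [|n IHn]; first by rewrite addn0.
  by rewrite addnS; apply: le_trans (xw _) IHn.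
have bnd m n : x m <= x n + w n.
  apply: le_trans (xm m n) _; rewrite addnC.
  by apply: le_trans (xwm n m); rewrite lerDl.
have xub n : ubound (range x) (x n + w n) by move=> _ [m _ <-]; exact: bnd.
have hs : has_sup (range x).
  by split; [exists (x 0%N), 0%N|exists (x 0%N + w 0%N); exact: xub].
exists (sup (range x)) => n; apply/andP; split.
  by apply: sup_upper_bound => //; exists n.
by apply: sup_le_ub; [exists (x 0%N), 0%N|exact: xub].
Qed.

(** A subadditive rectangle function that is [o(size ^ 2)] at every point
    vanishes: otherwise repeated quartering would produce nested rectangles on
    which it is at least a fixed multiple of the area. *)
Lemma rect_bisection (E : R -> R -> R -> R -> R) (a b c d : R) :
  a <= b -> c <= d ->
  (forall x w y h, a <= x -> 0 <= w -> x + w + w <= b ->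
     c <= y -> 0 <= h -> y + h + h <= d ->
     E x (x + w + w) y (y + h + h) <=
       E x (x + w) y (y + h) + E (x + w) (x + w + w) y (y + h) +
       (E x (x + w) (y + h) (y + h + h) +
        E (x + w) (x + w + w) (y + h) (y + h + h))) ->
  (forall p q, a <= p <= b -> c <= q <= d -> forall e, 0 < e ->
     exists2 r, 0 < r & forall x w y h, a <= x -> x + w <= b -> c <= y ->
       y + h <= d -> x <= p <= x + w -> y <= q <= y + h -> w < r -> h < r ->
       E x (x + w) y (y + h) <= e * (w + h) ^+ 2) ->
  E a b c d <= 0.
Proof.
move=> ab cd sub loc; rewrite leNgt; apply/negP => E0.
pose W := b - a; pose H := d - c.
have W0 : 0 <= W by rewrite subr_ge0.
have H0 : 0 <= H by rewrite subr_ge0.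
pose w n : R := W / 2 ^+ n; pose h n : R := H / 2 ^+ n.
have wS n : w n.+1 + w n.+1 = w n.
  by rewrite /w exprS invfM mulrCA -mulrDl; field.
have hS n : h n.+1 + h n.+1 = h n.
  by rewrite /h exprS invfM mulrCA -mulrDl; field.
have w0 n : 0 <= w n by rewrite divr_ge0 // exprn_ge0.
have h0 n : 0 <= h n by rewrite divr_ge0 // exprn_ge0.
pose Q n (z : R * R) := E z.1 (z.1 + w n) z.2 (z.2 + h n).
(* Some quarter carries at least a fourth of [E]; if it is not one of the
   first three, it is the last one. *)
pose step n (z : R * R) :=
  let k := n.+1 in
  if Q n z <= 4 * Q k z then z
  else if Q n z <= 4 * Q k (z.1 + w k, z.2) then (z.1 + w k, z.2)
  else if Q n z <= 4 * Q k (z.1, z.2 + h k) then (z.1, z.2 + h k)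
  else (z.1 + w k, z.2 + h k).
pose z := fix z n := if n is m.+1 then step m (z m) else (a, c).
have zS n : [/\ (z n).1 <= (z n.+1).1, (z n.+1).1 + w n.+1 <= (z n).1 + w n,
    (z n).2 <= (z n.+1).2 & (z n.+1).2 + h n.+1 <= (z n).2 + h n].
  have h1 := w0 n.+1; have h2 := h0 n.+1; rewrite -(wS n) -(hS n) /= /step.
  by case: ifP => _; [|case: ifP => _; [|case: ifP => _]] => /=; split; lra.
have za n : a <= (z n).1.
  by elim: n => //= n IHn; case: (zS n) => k _ _ _; apply: le_trans IHn k.
have zc n : c <= (z n).2.
  by elim: n => //= n IHn; case: (zS n) => _ _ k _; apply: le_trans IHn k.
have zb n : (z n).1 + w n <= b.
  elim: n => [|n IHn]; first by rewrite /w /W /= expr0; lra.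
  by case: (zS n) => _ k _ _; apply: le_trans k IHn.
have zd n : (z n).2 + h n <= d.
  elim: n => [|n IHn]; first by rewrite /h /H /= expr0; lra.
  by case: (zS n) => _ _ _ k; apply: le_trans k IHn.
have zQ n : E a b c d <= 4 ^+ n * Q n (z n).
  elim: n => [|n IHn].
    by rewrite expr0 mul1r /Q /w /h /W /H /= expr0 !divr1 !subrKC.
  apply: le_trans IHn _; rewrite exprSr -mulrA ler_wpM2l ?exprn_ge0 //.
  have := sub (z n).1 (w n.+1) (z n).2 (h n.+1) (za n) (w0 _).
  rewrite -!addrA !wS !hS => /(_ (zb n) (zc n) (h0 _) (zd n)).
  rewrite [z n.+1]/= /step; case: ifP => // /negbT; rewrite -ltNge => k1.
  case: ifP => // /negbT; rewrite -ltNge => k2.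
  case: ifP => // /negbT; rewrite -ltNge => k3.
  move: k1 k2 k3; rewrite /Q /= -!addrA !wS !hS; lra.
have [p pP] : exists p, forall n, (z n).1 <= p <= (z n).1 + w n.
  by apply: nested_intervals => // n; case: (zS n).
have [q qP] : exists q, forall n, (z n).2 <= q <= (z n).2 + h n.
  by apply: (@nested_intervals (fun n => (z n).2)) => // n; case: (zS n).
pose M := (W + H) ^+ 2 + 1; have M0 : 0 < M by rewrite ltr_wpDl // sqr_ge0.
have e0 : 0 < E a b c d / (2 * M) by rewrite divr_gt0 // mulr_gt0.
have pab : a <= p <= b.
  have /andP[k1 k2] := pP 0%N; rewrite (le_trans (za 0%N)) //=.
  exact: le_trans k2 (zb 0%N).
have qcd : c <= q <= d.
  have /andP[k1 k2] := qP 0%N; rewrite (le_trans (zc 0%N)) //=.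
  exact: le_trans k2 (zd 0%N).
have [r r0 rP] := loc _ _ pab qcd _ e0.
have [n nP] := half_pow_small (Num.max W H) r0.
have wr : w n < r.
  by apply: le_lt_trans nP; rewrite ler_wpM2r ?invr_ge0 ?exprn_ge0 // le_max lexx.
have hr : h n < r.
  apply: le_lt_trans nP; rewrite ler_wpM2r ?invr_ge0 ?exprn_ge0 // le_max lexx.
  by rewrite orbT.
have := rP _ _ _ _ (za n) (zb n) (zc n) (zd n) (pP n) (qP n) wr hr.
move=> /(ler_wpM2l (exprn_ge0 n (ler0n R 4))) /(le_trans (zQ n)).
have -> : (w n + h n) ^+ 2 = (W + H) ^+ 2 / 4 ^+ n.
  rewrite /w /h -mulrDl expr_div_n -exprM mulnC exprM.
  by congr (_ / _ ^+ _); rewrite expr2; lra.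
have f0 : (4 ^+ n : R) != 0 by rewrite gt_eqF // exprn_gt0.
have -> : 4 ^+ n * (E a b c d / (2 * M) * ((W + H) ^+ 2 / 4 ^+ n)) =
    E a b c d * ((W + H) ^+ 2 / (2 * M)).
  by field; rewrite f0 gt_eqF.
rewrite -ler_pdivrMl // mulVf ?gt_eqF // ler_pdivlMr ?mulr_gt0 // /M.
have := sqr_ge0 (W + H); lra.
Qed.

End Bisection.

(** * Goursat's theorem on a parametrized rectangle *)

Section Goursat.
Context {R : realType}.
Implicit Types (K F : R[i] -> R[i]) (Phi Pt Ps : R -> R -> R[i]).

(** One constant [L] bounds both partial derivatives and is a Lipschitz constant
    of the map: it controls integrals along the sides as well as distances. *)
Record C1_patch Phi Pt Ps (L a b c d : R) : Prop := C1Patch {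
  patch_dt : forall t s, a <= t <= b -> c <= s <= d ->
    rdiff (fun t => Phi t s) t (Pt t s);
  patch_ds : forall t s, a <= t <= b -> c <= s <= d ->
    rdiff (Phi t) s (Ps t s);
  patch_ct : forall t s, a <= t <= b -> c <= s <= d ->
    {for t, continuous (fun t => Pt t s)};
  patch_cs : forall t s, a <= t <= b -> c <= s <= d ->
    {for s, continuous (Ps t)};
  patch_bt : forall t s, a <= t <= b -> c <= s <= d -> normc (Pt t s) <= L;
  patch_bs : forall t s, a <= t <= b -> c <= s <= d -> normc (Ps t s) <= L;
  patch_lip : forall t s t' s', a <= t <= b -> c <= s <= d ->
    a <= t' <= b -> c <= s' <= d ->
    normc (Phi t s - Phi t' s') <= L * (`|t - t'| + `|s - s'|) }.

Lemma C1_patchS Phi Pt Ps L a b c d a' b' c' d' :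
  a <= a' -> b' <= b -> c <= c' -> d' <= d ->
  C1_patch Phi Pt Ps L a b c d -> C1_patch Phi Pt Ps L a' b' c' d'.
Proof.
move=> aa bb cc dd [h1 h2 h3 h4 h5 h6 h7].
have it t : a' <= t <= b' -> a <= t <= b.
  by move=> /andP[k1 k2]; rewrite (le_trans aa) //= (le_trans k2).
have is_ t : c' <= t <= d' -> c <= t <= d.
  by move=> /andP[k1 k2]; rewrite (le_trans cc) //= (le_trans k2).
split => [t s /it k /is_ l|t s /it k /is_ l|t s /it k /is_ l|t s /it k /is_ l
         |t s /it k /is_ l|t s /it k /is_ l|t s t' s' /it k /is_ l /it k' /is_ l'].
- exact: h1.
- exact: h2.
- exact: h3.
- exact: h4.
- exact: h5.
- exact: h6.
- exact: h7.
Qed.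

(** The integral of [K dz] along the image under [Phi] of the positively
    oriented boundary of [[a, b] x [c, d]]. *)
Definition rectint Phi Pt Ps K (a b c d : R) : R[i] :=
  cint a b (fun t => K (Phi t c) * Pt t c) +
  cint c d (fun s => K (Phi b s) * Ps b s) -
  cint a b (fun t => K (Phi t d) * Pt t d) -
  cint c d (fun s => K (Phi a s) * Ps a s).

Section Fixed.
Variables (Phi Pt Ps : R -> R -> R[i]) (L : R).

Lemma patch_integrable_t F a b c d s :
  C1_patch Phi Pt Ps L a b c d -> c <= s <= d ->
  (forall t, a <= t <= b -> {for Phi t s, continuous F}) ->
  cintegrable a b (fun t => F (Phi t s) * Pt t s).
Proof.
move=> P sP cF; apply: ccont_cintegrable => t tab; apply: ccontM.
  apply: (ccont_comp (c := fun t => Phi t s)); last exact: cF.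
  exact: rdiff_continuous (patch_dt P tab sP).
exact (patch_ct P tab sP).
Qed.

Lemma patch_integrable_s F a b c d t :
  C1_patch Phi Pt Ps L a b c d -> a <= t <= b ->
  (forall s, c <= s <= d -> {for Phi t s, continuous F}) ->
  cintegrable c d (fun s => F (Phi t s) * Ps t s).
Proof.
move=> P tP cF; apply: ccont_cintegrable => s sP; apply: ccontM.
  apply: (ccont_comp (c := Phi t)); last exact: cF.
  exact: rdiff_continuous (patch_ds P tP sP).
exact (patch_cs P tP sP).
Qed.

Lemma rectintD K F a b c d : a <= b -> c <= d ->
  C1_patch Phi Pt Ps L a b c d ->
  (forall t s, a <= t <= b -> c <= s <= d -> {for Phi t s, continuous K}) ->
  (forall t s, a <= t <= b -> c <= s <= d -> {for Phi t s, continuous F}) ->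
  rectint Phi Pt Ps (fun z => K z + F z) a b c d =
  rectint Phi Pt Ps K a b c d + rectint Phi Pt Ps F a b c d.
Proof.
move=> ab cd P cK cF.
have [aa bb cc dd] : [/\ a <= a <= b, a <= b <= b, c <= c <= d & c <= d <= d].
  by rewrite !lexx ab cd.
have et s : c <= s <= d -> cint a b (fun t => (K (Phi t s) + F (Phi t s)) * Pt t s) =
    cint a b (fun t => K (Phi t s) * Pt t s) +
    cint a b (fun t => F (Phi t s) * Pt t s).
  move=> sP; rewrite -cintD; last 2 first.
  - by apply: (patch_integrable_t P sP) => t tP; exact: cK.
  - by apply: (patch_integrable_t P sP) => t tP; exact: cF.
  by apply: eq_cint => t _; rewrite mulrDl.
have es t : a <= t <= b -> cint c d (fun s => (K (Phi t s) + F (Phi t s)) * Ps t s) =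
    cint c d (fun s => K (Phi t s) * Ps t s) +
    cint c d (fun s => F (Phi t s) * Ps t s).
  move=> tP; rewrite -cintD; last 2 first.
  - by apply: (patch_integrable_s P tP) => s sP; exact: cK.
  - by apply: (patch_integrable_s P tP) => s sP; exact: cF.
  by apply: eq_cint => s _; rewrite mulrDl.
by rewrite /rectint !et // !es //; ring.
Qed.

(** By the fundamental theorem of calculus each side contributes the difference
    of the values of the primitive at two corners, and these cancel. *)
Lemma rectint_exact F K a b c d : a <= b -> c <= d ->
  C1_patch Phi Pt Ps L a b c d ->
  (forall t s, a <= t <= b -> c <= s <= d -> cdiff F (Phi t s) (K (Phi t s))) ->
  (forall t s, a <= t <= b -> c <= s <= d -> {for Phi t s, continuous K}) ->
  rectint Phi Pt Ps K a b c d = 0.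
Proof.
move=> ab cd P dF cK.
have [aa bb cc dd] : [/\ a <= a <= b, a <= b <= b, c <= c <= d & c <= d <= d].
  by rewrite !lexx ab cd.
have et s : c <= s <= d ->
    cint a b (fun t => K (Phi t s) * Pt t s) = F (Phi b s) - F (Phi a s).
  move=> sP; apply: (cint_FTC (F := fun t => F (Phi t s))) => // t tP.
    exact: (rdiff_comp (dF _ _ tP sP) (patch_dt P tP sP)).
  apply: ccontM; last exact (patch_ct P tP sP).
  apply: (ccont_comp (c := fun t => Phi t s)); last exact: cK.
  exact: rdiff_continuous (patch_dt P tP sP).
have es t : a <= t <= b ->
    cint c d (fun s => K (Phi t s) * Ps t s) = F (Phi t d) - F (Phi t c).
  move=> tP; apply: (cint_FTC (F := fun s => F (Phi t s))) => // s sP.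
    exact: (rdiff_comp (dF _ _ tP sP) (patch_ds P tP sP)).
  apply: ccontM; last exact (patch_cs P tP sP).
  apply: (ccont_comp (c := Phi t)); last exact: cK.
  exact: rdiff_continuous (patch_ds P tP sP).
by rewrite /rectint !et // !es //; ring.
Qed.

(** The integrand is at most [M * L] on each side; of the factor 4, one 2 comes
    from the componentwise bound of the integral and one from opposite sides. *)
Lemma rectint_bound K M a b c d : a <= b -> c <= d ->
  C1_patch Phi Pt Ps L a b c d -> 0 <= M ->
  (forall t s, a <= t <= b -> c <= s <= d -> {for Phi t s, continuous K}) ->
  (forall t s, a <= t <= b -> c <= s <= d -> normc (K (Phi t s)) <= M) ->
  normc (rectint Phi Pt Ps K a b c d) <= 4 * (M * L) * ((b - a) + (d - c)).
Proof.
move=> ab cd P M0 cK KM.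
have [aa bb cc dd] : [/\ a <= a <= b, a <= b <= b, c <= c <= d & c <= d <= d].
  by rewrite !lexx ab cd.
have et s : c <= s <= d ->
    normc (cint a b (fun t => K (Phi t s) * Pt t s)) <= 2 * (M * L) * (b - a).
  move=> sP; apply: normc_cint_bound => //.
    by apply: (patch_integrable_t P sP) => t tP; exact: cK.
  move=> t tP; rewrite normcM ler_pM ?normc_ge0 //; first exact: KM.
  exact (patch_bt P tP sP).
have es t : a <= t <= b ->
    normc (cint c d (fun s => K (Phi t s) * Ps t s)) <= 2 * (M * L) * (d - c).
  move=> tP; apply: normc_cint_bound => //.
    by apply: (patch_integrable_s P tP) => s sP; exact: cK.
  move=> s sP; rewrite normcM ler_pM ?normc_ge0 //; first exact: KM.
  exact (patch_bs P tP sP).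
rewrite /rectint; apply: le_trans (normcB _ _) _.
have := es _ aa; have := es _ bb; have := et _ cc; have := et _ dd.
move: (normcB (cint a b (fun t => K (Phi t c) * Pt t c) +
  cint c d (fun s => K (Phi b s) * Ps b s))
  (cint a b (fun t => K (Phi t d) * Pt t d))).
move: (normcD (cint a b (fun t => K (Phi t c) * Pt t c))
  (cint c d (fun s => K (Phi b s) * Ps b s))).
lra.
Qed.

Lemma rectint_split_t K a m b c d : a <= m <= b -> c <= d ->
  C1_patch Phi Pt Ps L a b c d ->
  (forall t s, a <= t <= b -> s = c \/ s = d -> {for Phi t s, continuous K}) ->
  rectint Phi Pt Ps K a b c d =
  rectint Phi Pt Ps K a m c d + rectint Phi Pt Ps K m b c d.
Proof.
move=> amb cd P cK.
have et s : s = c \/ s = d -> cint a b (fun t => K (Phi t s) * Pt t s) =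
    cint a m (fun t => K (Phi t s) * Pt t s) +
    cint m b (fun t => K (Phi t s) * Pt t s).
  move=> sP; apply: cint_split => //.
  apply: (patch_integrable_t P) => [|t tP]; last exact: cK.
  by case: sP => ->; rewrite lexx cd.
by rewrite /rectint (et c (or_introl erefl)) (et d (or_intror erefl)); ring.
Qed.

Lemma rectint_split_s K a b c m d : a <= b -> c <= m <= d ->
  C1_patch Phi Pt Ps L a b c d ->
  (forall t s, t = a \/ t = b -> c <= s <= d -> {for Phi t s, continuous K}) ->
  rectint Phi Pt Ps K a b c d =
  rectint Phi Pt Ps K a b c m + rectint Phi Pt Ps K a b m d.
Proof.
move=> ab cmd P cK.
have es t : t = a \/ t = b -> cint c d (fun s => K (Phi t s) * Ps t s) =
    cint c m (fun s => K (Phi t s) * Ps t s) +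
    cint m d (fun s => K (Phi t s) * Ps t s).
  move=> tP; apply: cint_split => //.
  apply: (patch_integrable_s P) => [|s sP]; last exact: cK.
  by case: tP => ->; rewrite lexx ab.
by rewrite /rectint (es a (or_introl erefl)) (es b (or_intror erefl)); ring.
Qed.

Lemma cdiff_quadratic (k0 k1 w z : R[i]) :
  cdiff (fun y => k0 * y + k1 / 2 * (y - w) ^+ 2) z (k0 + k1 * (z - w)).
Proof.
move=> e e0; have m0 : 0 < normc (k1 / 2) + 1.
  by rewrite ltr_wpDl // normc_ge0.
exists (e / (normc (k1 / 2) + 1)); first by rewrite divr_gt0.
move=> y yz.
have -> : k0 * y + k1 / 2 * (y - w) ^+ 2 - (k0 * z + k1 / 2 * (z - w) ^+ 2) -
  (k0 + k1 * (z - w)) * (y - z) = k1 / 2 * (y - z) * (y - z) by field.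
rewrite 2!normcM ler_wpM2r ?normc_ge0 //.
move: yz; rewrite ltr_pdivlMr // mulrC => /ltW; apply: le_trans.
by rewrite ler_wpM2r ?normc_ge0 // lerDl.
Qed.

(** The affine part of [K] at the point has a primitive, so it contributes
    nothing; the remainder is [o(size)] on a boundary of length [O(size)]. *)
Lemma goursat_local K a b c d p q :
  C1_patch Phi Pt Ps L a b c d -> a <= p <= b -> c <= q <= d ->
  (forall t s, a <= t <= b -> c <= s <= d ->
     exists l, cdiff K (Phi t s) l) ->
  forall e, 0 < e -> exists2 r, 0 < r & forall x w y h, a <= x -> x + w <= b ->
    c <= y -> y + h <= d -> x <= p <= x + w -> y <= q <= y + h ->
    w < r -> h < r ->
    normc (rectint Phi Pt Ps K x (x + w) y (y + h)) <= e * (w + h) ^+ 2.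
Proof.
move=> P pab qcd dK e e0.
have L0 : 0 <= L := le_trans (normc_ge0 _) (patch_bt P pab qcd).
have L10 : 0 < 4 * L * L + 1 by rewrite ltr_wpDl // !mulr_ge0.
have [k1 dk] := dK _ _ pab qcd.
have e10 : 0 < e / (4 * L * L + 1) by rewrite divr_gt0.
have [r r0 rP] := dk _ e10.
pose z0 := Phi p q; pose k0 := K z0.
pose r' := r / (2 * (L + 1)).
have L2 : 0 < 2 * (L + 1) by rewrite mulr_gt0 // ltr_wpDl.
exists r'; first by rewrite divr_gt0.
move=> x w y h ax xb cy yd /andP[xp px] /andP[yq qy] wr hr.
have ex : x <= x + w by rewrite (le_trans xp).
have ey : y <= y + h by rewrite (le_trans yq).
have P' := C1_patchS ax xb cy yd P.
have cK t s : x <= t <= x + w -> y <= s <= y + h ->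
    {for Phi t s, continuous K}.
  move=> /andP[t1 t2] /andP[s1 s2].
  have [||l] := dK t s; last by move/cdiff_continuous.
  - by rewrite (le_trans ax) // (le_trans t2).
  - by rewrite (le_trans cy) // (le_trans s2).
pose A z := k0 + k1 * (z - z0).
have cA z : {for z, continuous A}.
  apply: (@cdiff_continuous _ _ _ k1) => e' e'0; exists 1 => // y' _.
  have -> : A y' - A z - k1 * (y' - z) = 0 by rewrite /A; ring.
  by rewrite normc0 mulr_ge0 ?normc_ge0 // ltW.
have cKA t s : x <= t <= x + w -> y <= s <= y + h ->
    {for Phi t s, continuous (fun z => K z - A z)}.
  by move=> tP sP; exact: (cvgB (cK _ _ tP sP) (cA _)).
have KE : K = (fun z => (K z - A z) + A z).
  by apply/funext => z; rewrite subrK.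
have exA := rectint_exact ex ey P' (fun t s _ _ => cdiff_quadratic k0 k1 z0 (Phi t s))
  (fun t s _ _ => cA (Phi t s)).
have cA' t s : x <= t <= x + w -> y <= s <= y + h -> {for Phi t s, continuous A}.
  by move=> _ _; exact: cA.
rewrite KE (rectintD ex ey P' cKA cA') exA.
rewrite addr0; set e1 := e / _ in e10 rP.
pose M := e1 * (L * (w + h)).
have w0 : 0 <= w by rewrite -(lerDl x).
have h0 : 0 <= h by rewrite -(lerDl y).
have M0 : 0 <= M.
  by apply: mulr_ge0; [exact: ltW|apply: mulr_ge0 => //; exact: addr_ge0].
have KM t s : x <= t <= x + w -> y <= s <= y + h ->
    normc (K (Phi t s) - A (Phi t s)) <= M.
  move=> /andP[t1 t2] /andP[s1 s2].
  have lip : normc (Phi t s - z0) <= L * (w + h).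
    apply: le_trans (patch_lip P' _ _ _ _) _.
    - by rewrite t1.
    - by rewrite s1.
    - by rewrite xp.
    - by rewrite yq.
    by apply: ler_wpM2l => //; apply: lerD; rewrite ler_norml; lra.
  have lip' : normc (Phi t s - z0) < r.
    apply: le_lt_trans lip _; apply: (@le_lt_trans _ _ ((L + 1) * (w + h))).
      by rewrite ler_wpM2r ?addr_ge0 // lerDl.
    rewrite -ltr_pdivlMl ?ltr_wpDl //.
    have -> : (L + 1)^-1 * r = r' + r' by rewrite /r'; field; lra.
    by rewrite ltrD.
  rewrite /A opprD addrA; apply: le_trans (rP _ lip') _.
  by apply: ler_wpM2l => //; exact: ltW.
apply: (le_trans (rectint_bound ex ey P' M0 cKA KM)).
have -> : x + w - x + (y + h - y) = w + h by ring.
have -> : 4 * (M * L) * (w + h) = e1 * (4 * L * L) * (w + h) ^+ 2.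
  by rewrite /M; ring.
apply: ler_wpM2r; first exact: sqr_ge0.
by rewrite /e1 mulrAC ler_pdivrMr // ler_wpM2l ?(ltW e0) // lerDl.
Qed.

(** Goursat's argument takes place in the parameter rectangle: the modulus of
    the boundary integral is subadditive under quartering, and [goursat_local]
    makes it negligible on small rectangles. *)
Theorem goursat K a b c d : a <= b -> c <= d ->
  C1_patch Phi Pt Ps L a b c d ->
  (forall t s, a <= t <= b -> c <= s <= d ->
     exists l, cdiff K (Phi t s) l) ->
  rectint Phi Pt Ps K a b c d = 0.
Proof.
move=> ab cd P dK; apply/eqP; rewrite -normc_eq0 eq_le normc_ge0 andbT.
apply: (rect_bisection (E := fun a b c d =>
  normc (rectint Phi Pt Ps K a b c d)) ab cd); last first.
  by move=> p q pab qcd; exact: (goursat_local P pab qcd dK).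
move=> x w y h ax w0 xb cy h0 yd.
have P' := C1_patchS ax xb cy yd P.
have cK t s : x <= t <= x + w + w -> y <= s <= y + h + h ->
    {for Phi t s, continuous K}.
  move=> /andP[t1 t2] /andP[s1 s2].
  have [||l] := dK t s; last by move/cdiff_continuous.
  - by rewrite (le_trans ax) // (le_trans t2).
  - by rewrite (le_trans cy) // (le_trans s2).
have ex : x <= x + w + w by lra.
have ey : y <= y + h <= y + h + h by lra.
rewrite (rectint_split_s ex ey P'); last first.
  by move=> t s [->|->] sP; apply: cK => //; lra.
apply: (le_trans (normcD _ _)); apply: lerD.
  have ew : x <= x + w <= x + w + w by lra.
  have eh : y <= y + h by lra.
  have P2 : C1_patch Phi Pt Ps L x (x + w + w) y (y + h).
    by apply: (C1_patchS _ _ _ _ P') => //; lra.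
  rewrite (rectint_split_t ew eh P2); first exact: normcD.
  by move=> t s tP [->|->]; apply: cK => //; lra.
have ew : x <= x + w <= x + w + w by lra.
have eh : y + h <= y + h + h by lra.
have P2 : C1_patch Phi Pt Ps L x (x + w + w) (y + h) (y + h + h).
  by apply: (C1_patchS _ _ _ _ P') => //; lra.
rewrite (rectint_split_t ew eh P2); first exact: normcD.
by move=> t s tP [->|->]; apply: cK => //; lra.
Qed.

End Fixed.
End Goursat.

(** * Cauchy's formula on a parametrized rectangle *)

Section Residue.
Context {R : realType}.
Local Notation mu := (@lebesgue_measure R).

Lemma integral_poisson (x0 w : R) : 0 < w ->
  \int[mu]_(x in `[x0 - w, x0 + w]) (w / ((x - x0) ^+ 2 + w ^+ 2)) = pi / 2.
Proof.
move=> w0; have wN0 : w != 0 by rewrite gt_eqF.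
have den (x : R) : (x - x0) ^+ 2 + w ^+ 2 != 0.
  by rewrite gt_eqF // ltr_wpDl ?sqr_ge0 // exprn_gt0.
have Da (x : R) : is_derive x 1 (fun y : R => w^-1 * (y - x0)) w^-1.
  by apply: is_derive_eq; rewrite /GRing.scale /= oppr0 addr0 mulr1 ?mulr0 ?addr0.
have ww : x0 - w <= x0 + w by lra.
have -> : pi / 2 = atan (w^-1 * (x0 + w - x0)) - atan (w^-1 * (x0 - w - x0)) :> R.
- have -> : w^-1 * (x0 + w - x0) = 1 by field.
  have -> : w^-1 * (x0 - w - x0) = - 1 by field.
  by rewrite atanN atan1; lra.
apply: (rcont_FTC (F := fun x => atan (w^-1 * (x - x0))) ww).
- move=> x _; have h := is_derive1_comp (is_derive1_atan _) (Da x).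
  apply: (is_derive_eq h); by field; rewrite wN0 den.
- move=> x _; apply: cvgM; first exact: cvg_cst.
  apply: cvgV => //; apply: cvgD; last exact: cvg_cst.
  have c1 : {for x, continuous (fun y : R => y - x0)}.
    by apply: cvgB; [exact: cvg_id|exact: cvg_cst].
  exact: (cvgM c1 c1).
Qed.

(** Stability of a quotient at the scale [dl] of its denominator; it compares
    the Cauchy kernel on a small rectangle with that of the linearized map. *)
Lemma quotient_error (N D N1 D1 : R[i]) (m e dl : R) : 0 < m -> 0 < dl ->
  normc (N - N1) <= e -> normc (D1 - D) <= e * dl ->
  m * dl <= normc D -> m * dl <= normc D1 ->
  normc (N / D - N1 / D1) <= (1 / m + normc N1 / m ^+ 2) * e / dl.
Proof.
move=> m0 d0 NN DD mD mD1; have md0 : 0 < m * dl by rewrite mulr_gt0.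
have D0 : D != 0 by rewrite -normc_gt0 (lt_le_trans md0).
have D10 : D1 != 0 by rewrite -normc_gt0 (lt_le_trans md0).
have e0 : 0 <= e := le_trans (normc_ge0 _) NN.
have -> : N / D - N1 / D1 = (N - N1) / D + N1 * (D1 - D) / (D * D1).
  by field; rewrite D0 D10.
apply: (le_trans (normcD _ _)); rewrite !normcM !normcV normcM.
have -> : (1 / m + normc N1 / m ^+ 2) * e / dl =
  e / (m * dl) + normc N1 * (e * dl) / ((m * dl) * (m * dl)).
  by field; rewrite !gt_eqF.
have iD : (normc D)^-1 <= (m * dl)^-1 by rewrite lef_pV2 ?posrE // (lt_le_trans md0).
have iD1 : (normc D1)^-1 <= (m * dl)^-1 by rewrite lef_pV2 ?posrE // (lt_le_trans md0).
have p1 : 0 <= (normc D)^-1 by rewrite invr_ge0 normc_ge0.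
have p2 : 0 <= (normc D1)^-1 by rewrite invr_ge0 normc_ge0.
apply: lerD; first by apply: ler_pM => //; exact: normc_ge0.
rewrite [(normc D * _)^-1]invfM [(m * dl * _)^-1]invfM; apply: ler_pM.
- by apply: mulr_ge0; exact: normc_ge0.
- exact: mulr_ge0.
- by apply: ler_wpM2l => //; exact: normc_ge0.
- exact: ler_pM.
Qed.

Lemma small_eq0 (x : R[i]) (C : R) :
  (forall e, 0 < e -> e <= 1 -> normc x <= C * e) -> x = 0.
Proof.
move=> h; apply/eqP; rewrite -normc_eq0; apply/negPn/negP => x0.
have xp : 0 < normc x by rewrite lt_def x0 normc_ge0.
have C0 : 0 < C by have := h 1 ltr01 (lexx _); rewrite mulr1; exact: lt_le_trans.
pose e := Num.min 1 (normc x / (2 * C)).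
have e0 : 0 < e by rewrite lt_min ltr01 divr_gt0 // mulr_gt0.
have e1 : e <= 1 by rewrite ge_min lexx.
have := h e e0 e1; have : e <= normc x / (2 * C) by rewrite ge_min lexx orbT.
move=> /(ler_wpM2l (ltW C0)) k1 /le_trans /(_ k1).
have -> : C * (normc x / (2 * C)) = normc x / 2 by field; lra.
lra.
Qed.

End Residue.

Section Residue2.
Context {R : realType}.
Local Notation mu := (@lebesgue_measure R).

Lemma cint_real (p : R -> R) (a b : R) :
  cint a b (fun t => (p t)%:C) = (\int[mu]_(t in `[a, b]) p t)%:C.
Proof.
apply: complex_ext => //=; rewrite -[RHS](@Rintegral_set0 _ _ _ mu (fun => 0)).
by rewrite /Rintegral integral0 integral_set0.
Qed.

Lemma real_den_neq0 (x w : R) : 0 < w ->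
  x%:C - 'i * w%:C != 0 :> R[i] /\ x%:C + 'i * w%:C != 0 :> R[i].
Proof.
move=> w0; split; apply/eqP => /(congr1 (@complex.Im R));
  rewrite !cpx_simp; lra.
Qed.

Lemma ball_sub_itv (x x1 dl lo hi : R) : `|x - x1| <= dl -> lo <= x1 - dl ->
  x1 + dl <= hi -> lo <= x <= hi.
Proof.
by rewrite ler_norml => /andP[h1 h2] h3 h4; apply/andP; split; lra.
Qed.

Lemma scaled_margin (k dl g : R) : 0 < k -> 0 < dl -> dl * (k + 1) < g ->
  k * dl < g /\ dl < g.
Proof.
move=> k0 dl0 h; have kd := mulr_gt0 k0 dl0.
by split; rewrite mulrDr mulr1 mulrC in h; lra.
Qed.

Lemma ccont_id_real (x0 t : R) : {for t, continuous (fun s : R => (s - x0)%:C : R[i])}.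
Proof. by apply: ccont_real; apply: cvgB; [exact: cvg_id|exact: cvg_cst]. Qed.

Lemma cauchy_kernel_integrable (x0 w a b : R) : 0 < w ->
  cintegrable a b (fun x => ((x - x0)%:C - 'i * w%:C : R[i])^-1) /\
  cintegrable a b (fun x => ((x - x0)%:C + 'i * w%:C : R[i])^-1).
Proof.
move=> w0; split; apply: ccont_cintegrable => t _.
  apply: (@ccontV _ (fun x => (x - x0)%:C - 'i * w%:C)); last exact: (real_den_neq0 _ w0).1.
  by apply: ccontD; [exact: ccont_id_real|exact: ccont_cst].
apply: (@ccontV _ (fun x => (x - x0)%:C + 'i * w%:C)); last exact: (real_den_neq0 _ w0).2.
by apply: ccontD; [exact: ccont_id_real|exact: ccont_cst].
Qed.

(** Two opposite sides of a square seen from its center: the difference of the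
    kernels is a Poisson kernel, and each side spans a right angle. *)
Lemma cauchy_kernel_pair (x0 w : R) : 0 < w ->
  cint (x0 - w) (x0 + w) (fun x => ((x - x0)%:C - 'i * w%:C)^-1) -
  cint (x0 - w) (x0 + w) (fun x => ((x - x0)%:C + 'i * w%:C)^-1) =
  'i * pi%:C :> R[i].
Proof.
move=> w0; have [i1 i2] := cauchy_kernel_integrable x0 (x0 - w) (x0 + w) w0.
rewrite -cintB //.
pose p x := w / ((x - x0) ^+ 2 + w ^+ 2).
rewrite (@eq_cint _ _ (fun x => ('i * 2%:C) * (p x)%:C)); last first.
  move=> x _; have [d1 d2] := real_den_neq0 (x - x0) w0.
  have d3 : (x - x0) ^+ 2 + w ^+ 2 != 0.
    by rewrite gt_eqF // ltr_wpDl ?sqr_ge0 // exprn_gt0.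
  have e3 : ((x - x0)%:C - 'i * w%:C) * ((x - x0)%:C + 'i * w%:C) =
      ((x - x0) ^+ 2 + w ^+ 2)%:C.
    by apply: complex_ext; rewrite !cpx_simp; ring.
  have -> : (p x)%:C = w%:C / ((x - x0) ^+ 2 + w ^+ 2)%:C.
    by rewrite /p rmorphM /= fmorphV.
  rewrite -e3.
  have -> : 2%:C = 2 :> R[i] by rewrite rmorph_nat.
  by field; rewrite -!(rmorphB (real_complex R)) d1 d2.
rewrite cintZ; last first.
  apply: ccont_cintegrable => t _; apply: ccont_real; apply: cvgM.
    exact: cvg_cst.
  apply: cvgV; first by rewrite gt_eqF // ltr_wpDl ?sqr_ge0 // exprn_gt0.
  apply: cvgD; last exact: cvg_cst.
  have c1 : {for t, continuous (fun y : R => y - x0)}.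
    by apply: cvgB; [exact: cvg_id|exact: cvg_cst].
  exact: (cvgM c1 c1).
rewrite cint_real integral_poisson //.
by apply: complex_ext; rewrite !cpx_simp; lra.
Qed.

(* By [PsE] the map agrees to first order at [(t1, s1)] with a conformal map of
   [(t, k * s)]: a small rectangle whose sides are in the ratio [k] is mapped
   almost to a square about [z].  The bound [low] makes the map injective at
   that point. *)
Variables (Phi Pt Ps : R -> R -> R[i]) (L a b c d t1 s1 k m : R).
Variable (h : R[i] -> R[i]).
Let z := Phi t1 s1.
Let q w := h w / (w - z).
Hypothesis P : C1_patch Phi Pt Ps L a b c d.
Hypothesis t1in : a < t1 < b.
Hypothesis s1in : c < s1 < d.
Hypothesis k0 : 0 < k.
Hypothesis PsE : Ps t1 s1 = 'i * k%:C * Pt t1 s1.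
Hypothesis Pt0 : Pt t1 s1 != 0.
Hypothesis m0 : 0 < m.
Hypothesis low : forall t s, a <= t <= b -> c <= s <= d ->
  m * (`|t - t1| + `|s - s1|) <= normc (Phi t s - z).
Hypothesis J : forall e, 0 < e -> exists2 r, 0 < r & forall t s,
  `|t - t1| < r -> `|s - s1| < r ->
  [/\ normc (Phi t s - z -
        Pt t1 s1 * ((t - t1)%:C + 'i * (k * (s - s1))%:C)) <=
        e * (`|t - t1| + `|s - s1|),
      normc (Pt t s - Pt t1 s1) <= e &
      normc (Ps t s - Ps t1 s1) <= e].
Hypothesis dh : forall t s, a <= t <= b -> c <= s <= d ->
  exists l, cdiff h (Phi t s) l.

Let m' := Num.min (m * Num.min k 1) (normc (Pt t1 s1) * k).
Let G := L + normc (h z) + k + 1.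
Let E := (1 / m' + normc (h z) * L / m' ^+ 2) * G.

Let m'0 : 0 < m'.
Proof.
by rewrite lt_min mulr_gt0 ?lt_min ?k0 ?ltr01 //= mulr_gt0 ?normc_gt0.
Qed.

Let t1ab : a <= t1 <= b.
Proof. by case/andP: t1in => k1 k2; rewrite !ltW. Qed.
Let s1cd : c <= s1 <= d.
Proof. by case/andP: s1in => k1 k2; rewrite !ltW. Qed.

Lemma patch_ne t s : a <= t <= b -> c <= s <= d -> t != t1 \/ s != s1 ->
  Phi t s - z != 0.
Proof.
move=> tab scd ts; rewrite -normc_gt0; apply: lt_le_trans (low tab scd).
apply: mulr_gt0 => //; case: ts => ts.
  by rewrite ltr_wpDr // normr_gt0 subr_eq0.
by rewrite ltr_wpDl // normr_gt0 subr_eq0.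
Qed.

Lemma patch_q_cdiff t s : a <= t <= b -> c <= s <= d -> t != t1 \/ s != s1 ->
  exists l, cdiff q (Phi t s) l.
Proof.
move=> tab scd ts; have [l hl] := dh tab scd.
have ne := patch_ne tab scd ts.
eexists; exact: (cdiffM hl (cdiff_inv_sub ne)).
Qed.

Let lin t s : R[i] := (t - t1)%:C + 'i * (k * (s - s1))%:C.

Let L0 : 0 <= L.
Proof. exact: le_trans (normc_ge0 _) (patch_bt P t1ab s1cd). Qed.

Let G0 : 0 < G.
Proof.
by rewrite /G; move: k0 L0 (normc_ge0 (h z)); lra.
Qed.

Let E0 : 0 <= E.
Proof.
apply: mulr_ge0; last exact: ltW.
apply: addr_ge0; first by apply: divr_ge0 => //; exact: ltW.
by apply: divr_ge0; [apply: mulr_ge0 => //; exact: normc_ge0|apply: exprn_ge0; exact: ltW].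
Qed.

(** Numerator and denominator of the pulled back kernel are known up to a factor
    [1 + O(e)], and the kernel has size [1 / dl] on the boundary. *)
Lemma local_kernel e : 0 < e -> exists2 r, 0 < r & forall dl, 0 < dl -> dl < r ->
  [/\ a <= t1 - k * dl, t1 + k * dl <= b, c <= s1 - dl, s1 + dl <= d &
   forall t s, `|t - t1| <= k * dl -> `|s - s1| <= dl ->
     `|t - t1| = k * dl \/ `|s - s1| = dl ->
     normc (q (Phi t s) * Pt t s - h z * (lin t s)^-1) <= E * e / dl /\
     normc (q (Phi t s) * Ps t s - h z * ('i * k%:C / lin t s)) <= E * e / dl].
Proof.
move=> e0; have [r1 r10 J1] := J e0.
have [l hl] := dh t1ab s1cd.
have /continuous_normcP/(_ _ e0)[r2 r20 h2] := cdiff_continuous hl.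
have [ta tb] := andP t1in; have [sc sd] := andP s1in.
have L10 : 0 < L + 1 by rewrite ltr_wpDl.
have k10 : 0 < k + 1 by rewrite ltr_wpDl // ltW.
pose r3 := Num.min (Num.min (t1 - a) (b - t1)) (Num.min (s1 - c) (d - s1)).
have r30 : 0 < r3 by rewrite !lt_min !subr_gt0 ta tb sc sd.
pose r := Num.min (Num.min r1 (r2 / (L + 1))) r3 / (k + 1).
have r0 : 0 < r.
  by rewrite divr_gt0 // lt_min r30 andbT lt_min r10 divr_gt0.
exists r => // dl dl0; rewrite ltr_pdivlMr // !lt_min => /andP[/andP[d1 d2]].
move=> /andP[/andP[d3 d4] /andP[d5 d6]].
have kd0 : 0 < k * dl by rewrite mulr_gt0.
rewrite ltr_pdivlMr // in d2.
have [ma _] := scaled_margin k0 dl0 d3; have [mb _] := scaled_margin k0 dl0 d4.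
have [_ mc] := scaled_margin k0 dl0 d5; have [_ md] := scaled_margin k0 dl0 d6.
have [rk rd] := scaled_margin k0 dl0 d1.
have [lo_t hi_t] : a <= t1 - k * dl /\ t1 + k * dl <= b.
  by rewrite lerBrDl -lerBrDr -lerBrDl !ltW.
have [lo_s hi_s] : c <= s1 - dl /\ s1 + dl <= d.
  by rewrite lerBrDl -lerBrDr -lerBrDl !ltW.
split => // t s tk sk ts.
have tab := ball_sub_itv tk lo_t hi_t; have scd := ball_sub_itv sk lo_s hi_s.
have sum_le : `|t - t1| + `|s - s1| <= (k + 1) * dl.
  by rewrite mulrDl mul1r; exact: lerD.
have [J2 J3 J4] := J1 t s (le_lt_trans tk rk) (le_lt_trans sk rd).
have dist : normc (Phi t s - z) <= L * (`|t - t1| + `|s - s1|).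
  exact: (patch_lip P tab scd t1ab s1cd).
have hz : normc (h (Phi t s) - h z) <= e.
  apply/ltW/h2; apply: (le_lt_trans dist).
  apply: (@le_lt_trans _ _ (dl * (k + 1) * (L + 1))) => //.
  rewrite [leRHS]mulrC [dl * _]mulrC; apply: ler_pM => //.
  by rewrite lerDl.
have Dm : m' * dl <= normc (Phi t s - z).
  apply: le_trans (low tab scd).
  apply: (@le_trans _ _ (m * Num.min k 1 * dl)).
    by apply: ler_wpM2r; [exact: ltW|rewrite ge_min lexx].
  rewrite -mulrA; apply: ler_wpM2l; first exact: ltW.
  case: ts => ->.
    apply: (@le_trans _ _ (k * dl)); last by rewrite lerDl.
    by apply: ler_wpM2r; [exact: ltW|rewrite ge_min lexx].
  apply: (@le_trans _ _ (1 * dl)); last by rewrite mul1r lerDr.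
  by apply: ler_wpM2r; [exact: ltW|rewrite ge_min lexx orbT].
have lin_low : k * dl <= normc (lin t s).
  case: ts => ts.
    by apply: le_trans (Re_le_normc _); rewrite !cpx_simp mul0r mulr0 subr0 addr0 ts.
  apply: le_trans (Im_le_normc _); rewrite !cpx_simp mul0r mul1r !add0r.
  by rewrite normrM ts gtr0_norm.
have D1m : m' * dl <= normc (Pt t1 s1 * lin t s).
  rewrite normcM; apply: (@le_trans _ _ (normc (Pt t1 s1) * k * dl)).
    by apply: ler_wpM2r; [exact: ltW|rewrite ge_min lexx orbT].
  by rewrite -mulrA; apply: ler_wpM2l => //; exact: normc_ge0.
have DD : normc (Pt t1 s1 * lin t s - (Phi t s - z)) <= e * G * dl.
  rewrite normcC; apply: (le_trans J2); rewrite -mulrA; apply: ler_wpM2l; first exact: ltW.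
  apply: (le_trans sum_le); apply: ler_wpM2r; first exact: ltW.
  by rewrite /G -addrA lerDr addr_ge0 ?normc_ge0.
have lin0 : lin t s != 0 by rewrite -normc_gt0; exact: lt_le_trans lin_low.
have Phi0 : Phi t s - z != 0.
  by rewrite -normc_gt0; apply: lt_le_trans Dm; exact: mulr_gt0.
have NN (X Y : R[i]) : normc X <= L -> normc Y <= L -> normc (X - Y) <= e ->
    normc (h (Phi t s) * X - h z * Y) <= e * G.
  move=> XL YL XY.
  have -> : h (Phi t s) * X - h z * Y = (h (Phi t s) - h z) * X + h z * (X - Y).
    by ring.
  apply: (le_trans (normcD _ _)); rewrite !normcM.
  apply: (@le_trans _ _ (e * L + normc (h z) * e)).
    by apply: lerD; apply: ler_pM => //; exact: normc_ge0.
  have -> : e * L + normc (h z) * e = e * (L + normc (h z)) by ring.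
  apply: ler_wpM2l; first exact: ltW.
  by rewrite /G -addrA lerDl addr_ge0 // ltW.
have fin (X Y : R[i]) : normc X <= L -> normc Y <= L -> normc (X - Y) <= e ->
    normc (q (Phi t s) * X - h z * Y / (Pt t1 s1 * lin t s)) <= E * e / dl.
  move=> XL YL XY.
  have -> : q (Phi t s) * X = h (Phi t s) * X / (Phi t s - z).
    by rewrite /q mulrAC.
  apply: (le_trans (quotient_error m'0 dl0 (NN X Y XL YL XY) DD Dm D1m)).
  apply: ler_wpM2r; first by rewrite invr_ge0 ltW.
  rewrite [e * G]mulrC mulrA; apply: ler_wpM2r; first exact: ltW.
  apply: ler_wpM2r; first exact: ltW.
  apply: lerD => //; apply: ler_wpM2r; first by rewrite invr_ge0 exprn_ge0 // ltW.
  by rewrite normcM; apply: ler_wpM2l => //; exact: normc_ge0.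
split.
  have -> : h z * (lin t s)^-1 = h z * Pt t1 s1 / (Pt t1 s1 * lin t s).
    by field; rewrite Pt0 lin0.
  exact: (fin _ _ (patch_bt P tab scd) (patch_bt P t1ab s1cd) J3).
have -> : h z * ('i * k%:C / lin t s) = h z * Ps t1 s1 / (Pt t1 s1 * lin t s).
  by rewrite PsE; field; rewrite Pt0 lin0.
exact: (fin _ _ (patch_bs P tab scd) (patch_bs P t1ab s1cd) J4).
Qed.

Lemma normc_cint_diff (F H : R -> R[i]) (x y M : R) : x <= y ->
  cintegrable x y F -> cintegrable x y H ->
  (forall t, x <= t <= y -> normc (F t - H t) <= M) ->
  normc (cint x y F - cint x y H) <= 2 * M * (y - x).
Proof.
move=> xy iF iH FH; rewrite -cintB //.
by apply: normc_cint_bound => //; exact: cintegrableB.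
Qed.

(** The boundary has length [O(dl)], so the error of [local_kernel] integrates to
    [O(e)]; in the linear model each pair of opposite sides contributes
    [i pi h z]. *)
Lemma residue_square e : 0 < e -> exists2 r, 0 < r & forall dl, 0 < dl -> dl < r ->
  [/\ a <= t1 - k * dl, t1 + k * dl <= b, c <= s1 - dl, s1 + dl <= d &
   normc (rectint Phi Pt Ps q (t1 - k * dl) (t1 + k * dl) (s1 - dl) (s1 + dl) -
          h z * ('i * (2 * pi)%:C)) <= 8 * (k + 1) * E * e].
Proof.
move=> e0; have [r r0 rP] := local_kernel e0; exists r => // dl dl0 dlr.
have [b1 b2 b3 b4 est] := rP _ dl0 dlr; split => //.
have kd0 : 0 < k * dl by exact: mulr_gt0.
have [nkd nd] : `|- (k * dl)| = k * dl /\ `|- dl| = dl.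
  by rewrite !normrN !gtr0_norm.
have [pkd pd] : `|k * dl| = k * dl /\ `|dl| = dl by rewrite !gtr0_norm.
have [ea eb ec ed] : [/\ t1 - k * dl - t1 = - (k * dl), t1 + k * dl - t1 = k * dl,
  s1 - dl - s1 = - dl & s1 + dl - s1 = dl] by split; ring.
have ww : t1 - k * dl <= t1 + k * dl by lra.
have hh : s1 - dl <= s1 + dl by lra.
have P' := C1_patchS b1 b2 b3 b4 P.
have tt t : t1 - k * dl <= t <= t1 + k * dl -> `|t - t1| <= k * dl.
  by rewrite ler_distl.
have ss s : s1 - dl <= s <= s1 + dl -> `|s - s1| <= dl.
  by rewrite ler_distl.
have cq t s : t1 - k * dl <= t <= t1 + k * dl -> s1 - dl <= s <= s1 + dl ->
    `|t - t1| = k * dl \/ `|s - s1| = dl -> {for Phi t s, continuous q}.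
  move=> tP sP ts; have [|||l] := @patch_q_cdiff t s.
  - by have [u1 u2] := andP tP; rewrite (le_trans b1 u1) (le_trans u2 b2).
  - by have [u1 u2] := andP sP; rewrite (le_trans b3 u1) (le_trans u2 b4).
  - case: ts => ts; [left|right]; apply/eqP => E1; move: ts; rewrite E1 subrr normr0.
      by move=> E2; move: kd0; rewrite -E2 ltxx.
    by move=> E2; move: dl0; rewrite -E2 ltxx.
  exact: cdiff_continuous.
have et s : `|s - s1| = dl -> s1 - dl <= s <= s1 + dl ->
    cintegrable (t1 - k * dl) (t1 + k * dl) (fun t => q (Phi t s) * Pt t s).
  move=> sd sP; apply: (patch_integrable_t P' sP) => t tP.
  by apply: cq => //; right.
have es t : `|t - t1| = k * dl -> t1 - k * dl <= t <= t1 + k * dl ->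
    cintegrable (s1 - dl) (s1 + dl) (fun s => q (Phi t s) * Ps t s).
  move=> sd sP; apply: (patch_integrable_s P' sP) => s' s'P.
  by apply: cq => //; left.
have [k1 k2] := cauchy_kernel_integrable t1 (t1 - k * dl) (t1 + k * dl) kd0.
have [k3 k4] := cauchy_kernel_integrable s1 (s1 - dl) (s1 + dl) dl0.
have kC : k%:C != 0 :> R[i] by rewrite fmorph_eq0 gt_eqF.
pose M := E * e / dl.
have dsm : `|s1 - dl - s1| = dl by rewrite ec.
have dsp : `|s1 + dl - s1| = dl by rewrite ed.
have dtm : `|t1 - k * dl - t1| = k * dl by rewrite ea.
have dtp : `|t1 + k * dl - t1| = k * dl by rewrite eb.
have [ssm ssp] : s1 - dl <= s1 - dl <= s1 + dl /\ s1 - dl <= s1 + dl <= s1 + dl.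
  by rewrite !lexx hh.
have [ttm ttp] : t1 - k * dl <= t1 - k * dl <= t1 + k * dl /\
    t1 - k * dl <= t1 + k * dl <= t1 + k * dl by rewrite !lexx ww.
have H1 : normc (cint (t1 - k * dl) (t1 + k * dl)
      (fun t => q (Phi t (s1 - dl)) * Pt t (s1 - dl)) -
    cint (t1 - k * dl) (t1 + k * dl)
      (fun t => h z * ((t - t1)%:C - 'i * (k * dl)%:C)^-1)) <=
    2 * M * (t1 + k * dl - (t1 - k * dl)).
  apply: normc_cint_diff ww (et _ dsm ssm) (cintegrableZ _ k1) _ => t tP.
  have [] := est t (s1 - dl) (tt _ tP); [by rewrite dsm|by right|].
  by rewrite /lin ec mulrN rmorphN mulrN.
have H3 : normc (cint (t1 - k * dl) (t1 + k * dl)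
      (fun t => q (Phi t (s1 + dl)) * Pt t (s1 + dl)) -
    cint (t1 - k * dl) (t1 + k * dl)
      (fun t => h z * ((t - t1)%:C + 'i * (k * dl)%:C)^-1)) <=
    2 * M * (t1 + k * dl - (t1 - k * dl)).
  apply: normc_cint_diff ww (et _ dsp ssp) (cintegrableZ _ k2) _ => t tP.
  have [] := est t (s1 + dl) (tt _ tP); [by rewrite dsp|by right|].
  by rewrite /lin ed.
have H2 : normc (cint (s1 - dl) (s1 + dl)
      (fun s => q (Phi (t1 + k * dl) s) * Ps (t1 + k * dl) s) -
    cint (s1 - dl) (s1 + dl)
      (fun s => h z * ((s - s1)%:C - 'i * dl%:C)^-1)) <=
    2 * M * (s1 + dl - (s1 - dl)).
  apply: normc_cint_diff hh (es _ dtp ttp) (cintegrableZ _ k3) _ => s sP.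
  have [] := est (t1 + k * dl) s _ (ss _ sP); [by rewrite dtp|by left|move=> _].
  have [n1 _] := real_den_neq0 (s - s1) dl0.
  rewrite /lin eb.
  have -> // : 'i * k%:C / ((k * dl)%:C + 'i * (k * (s - s1))%:C) =
    ((s - s1)%:C - 'i * dl%:C)^-1.
  have -> : (k * dl)%:C + 'i * (k * (s - s1))%:C =
    'i * k%:C * ((s - s1)%:C - 'i * dl%:C).
    by apply: complex_ext; rewrite !cpx_simp; ring.
  by rewrite invfM mulrA divff ?mul1r // mulf_neq0 // neq0Ci.
have H4 : normc (cint (s1 - dl) (s1 + dl)
      (fun s => q (Phi (t1 - k * dl) s) * Ps (t1 - k * dl) s) -
    cint (s1 - dl) (s1 + dl)
      (fun s => h z * ((s - s1)%:C + 'i * dl%:C)^-1)) <=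
    2 * M * (s1 + dl - (s1 - dl)).
  apply: normc_cint_diff hh (es _ dtm ttm) (cintegrableZ _ k4) _ => s sP.
  have [] := est (t1 - k * dl) s _ (ss _ sP); [by rewrite dtm|by left|move=> _].
  have [_ n1] := real_den_neq0 (s - s1) dl0.
  rewrite /lin ea.
  have -> // : 'i * k%:C / ((- (k * dl))%:C + 'i * (k * (s - s1))%:C) =
    ((s - s1)%:C + 'i * dl%:C)^-1.
  have -> : (- (k * dl))%:C + 'i * (k * (s - s1))%:C =
    'i * k%:C * ((s - s1)%:C + 'i * dl%:C).
    by apply: complex_ext; rewrite !cpx_simp; ring.
  by rewrite invfM mulrA divff ?mul1r // mulf_neq0 // neq0Ci.
move: H1 H2 H3 H4; rewrite !cintZ //.
have := cauchy_kernel_pair t1 kd0; have := cauchy_kernel_pair s1 dl0.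
set u1 := cint _ _ (fun x => ((x - s1)%:C - _)^-1).
set u2 := cint _ _ (fun x => ((x - s1)%:C + _)^-1).
set u3 := cint _ _ (fun x => ((x - t1)%:C - _)^-1).
set u4 := cint _ _ (fun x => ((x - t1)%:C + _)^-1).
move=> U1 U2; rewrite /rectint.
set v1 := cint _ _ _; set v2 := cint _ _ _; set v3 := cint _ _ _; set v4 := cint _ _ _.
move=> H1 H2 H3 H4.
have -> : v1 + v2 - v3 - v4 - h z * ('i * (2 * pi)%:C) =
  (v1 - h z * u3) + (v2 - h z * u1) - (v3 - h z * u4) - (v4 - h z * u2).
  have -> : (2 * pi)%:C = pi%:C + pi%:C :> R[i].
    by rewrite -rmorphD /=; congr (_%:C); ring.
  by rewrite mulrDr -{1}U1 -U2; ring.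
have n1 := normcB ((v1 - h z * u3) + (v2 - h z * u1) - (v3 - h z * u4)) (v4 - h z * u2).
have n2 := normcB ((v1 - h z * u3) + (v2 - h z * u1)) (v3 - h z * u4).
have n3 := normcD (v1 - h z * u3) (v2 - h z * u1).
apply: (le_trans n1); apply: (le_trans (lerD (le_trans n2 (lerD n3 (lexx _))) (lexx _))).
apply: (le_trans (lerD (lerD (lerD H1 H2) H3) H4)).
rewrite le_eqVlt; apply/orP; left; apply/eqP; rewrite /M; field.
by rewrite gt_eqF.
Qed.

(** The lines bounding the small rectangle of [residue_square] cut off four
    rectangles on which [q] is holomorphic, where [goursat] applies. *)
Theorem cauchy_patch : rectint Phi Pt Ps q a b c d = h z * ('i * (2 * pi)%:C).
Proof.
apply/eqP; rewrite -subr_eq0; apply/eqP.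
apply: (@small_eq0 _ _ (8 * (k + 1) * E)) => e e0 _.
have [r r0 rP] := residue_square e0.
have r20 : 0 < r / 2 by rewrite divr_gt0.
have r2r : r / 2 < r by rewrite ltr_pdivrMr // ltr_pMr // ltr1n.
have [b1 b2 b3 b4] := rP _ r20 r2r; set dl := r / 2 in r20 b1 b2 b3 b4 *.
suff -> : rectint Phi Pt Ps q a b c d =
  rectint Phi Pt Ps q (t1 - k * dl) (t1 + k * dl) (s1 - dl) (s1 + dl) by [].
have kd0 : 0 < k * dl by exact: mulr_gt0.
have [ab cd] : a <= b /\ c <= d.
  by split; [have [u1 u2] := andP t1ab|have [u1 u2] := andP s1cd]; exact: le_trans u2.
have lt_t : t1 - k * dl < t1 by rewrite ltrBlDr ltrDl.
have gt_t : t1 < t1 + k * dl by rewrite ltrDl.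
have lt_s : s1 - dl < s1 by rewrite ltrBlDr ltrDl.
have gt_s : s1 < s1 + dl by rewrite ltrDl.
have ww := ltW (lt_trans lt_t gt_t); have hh := ltW (lt_trans lt_s gt_s).
have cq t s : a <= t <= b -> c <= s <= d -> t != t1 \/ s != s1 ->
    {for Phi t s, continuous q}.
  by move=> tP sP ts; have [l] := patch_q_cdiff tP sP ts; exact: cdiff_continuous.
have aa : a <= a <= b by rewrite lexx.
have bb : a <= b <= b by rewrite lexx andbT.
have [sm sp] : c <= s1 - dl <= d /\ c <= s1 + dl <= d.
  by rewrite b3 b4 (le_trans hh b4) (le_trans b3 hh).
have [tm tp] : a <= t1 - k * dl <= b /\ a <= t1 + k * dl <= b.
  by rewrite b1 b2 (le_trans ww b2) (le_trans b1 ww).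
have gzero x y u v : a <= x -> y <= b -> c <= u -> v <= d -> x <= y -> u <= v ->
    (forall t s, x <= t <= y -> u <= s <= v -> t != t1 \/ s != s1) ->
    rectint Phi Pt Ps q x y u v = 0.
  move=> ax yb cu vd xy uv ne; apply: (goursat xy uv (C1_patchS ax yb cu vd P)).
  move=> t s tP sP; apply: patch_q_cdiff; last exact: ne.
    by have [p1 p2] := andP tP; rewrite (le_trans ax p1) (le_trans p2 yb).
  by have [p1 p2] := andP sP; rewrite (le_trans cu p1) (le_trans p2 vd).
have tne : a != t1 /\ b != t1.
  by have [u1 u2] := andP t1in; rewrite lt_eqF // gt_eqF.
rewrite (rectint_split_s ab sm P); last first.
  by move=> t s [->|->] sP; apply: cq => //; left; [exact: tne.1|exact: tne.2].
have z1 : rectint Phi Pt Ps q a b c (s1 - dl) = 0.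
  apply: (gzero a b c (s1 - dl) (lexx _) (lexx _) (lexx _) _ ab b3).
    by have [] := andP sm.
  by move=> t s _ /andP[_ sP]; right; rewrite lt_eqF // (le_lt_trans sP).
rewrite z1 add0r.
have sP1 : s1 - dl <= s1 + dl <= d by rewrite hh b4.
have P1 := C1_patchS (lexx a) (lexx b) b3 (lexx d) P.
rewrite (rectint_split_s ab sP1 P1); last first.
  move=> t s [->|->] /andP[u1 u2]; apply: cq; rewrite ?(le_trans b3 u1) //.
    by left; exact: tne.1.
  by left; exact: tne.2.
have z2 : rectint Phi Pt Ps q a b (s1 + dl) d = 0.
  apply: (gzero a b (s1 + dl) d (lexx _) (lexx _) _ (lexx _) ab b4).
    by have [] := andP sp.
  by move=> t s _ /andP[sP _]; right; rewrite gt_eqF // (lt_le_trans gt_s).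
rewrite z2 addr0.
have P2 := C1_patchS (lexx a) (lexx b) b3 b4 P.
have sne s : s = s1 - dl \/ s = s1 + dl -> s != s1 /\ c <= s <= d.
  by case=> ->; split => //; [rewrite lt_eqF|rewrite gt_eqF].
rewrite (rectint_split_t tm hh P2); last first.
  by move=> t s tP /sne[s0 sP]; apply: cq => //; right.
have z3 : rectint Phi Pt Ps q a (t1 - k * dl) (s1 - dl) (s1 + dl) = 0.
  apply: (gzero a (t1 - k * dl) (s1 - dl) (s1 + dl) (lexx _) _ b3 b4 b1 hh).
    by have [] := andP tm.
  by move=> t s /andP[_ tP] _; left; rewrite lt_eqF // (le_lt_trans tP).
rewrite z3 add0r.
have tP1 : t1 - k * dl <= t1 + k * dl <= b by rewrite ww b2.
have P3 := C1_patchS b1 (lexx b) b3 b4 P.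
rewrite (rectint_split_t tP1 hh P3); last first.
  move=> t s /andP[u1 u2] /sne[s0 sP]; apply: cq => //; last by right.
  by rewrite (le_trans b1 u1).
have z4 : rectint Phi Pt Ps q (t1 + k * dl) b (s1 - dl) (s1 + dl) = 0.
  apply: (gzero (t1 + k * dl) b (s1 - dl) (s1 + dl) _ (lexx _) b3 b4 b2 hh).
    by have [] := andP tp.
  by move=> t s /andP[tP _] _; left; rewrite gt_eqF // (lt_le_trans gt_t).
by rewrite z4 addr0.
Qed.

End Residue2.

(** * Integrals of Cauchy type *)

Section CauchyType.
Context {R : realType}.
Local Notation mu := (@lebesgue_measure R).

Lemma seg_within (f : R -> R) (a b : R) :
  (forall t, a <= t <= b -> {for t, continuous f}) ->
  {within `[a, b], continuous f}.
Proof.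
by move=> h; apply: continuous_in_subspaceT => t; rewrite inE /= in_itv /= => /h.
Qed.

Lemma seg_bounded (f : R -> R) (a b : R) :
  (forall t, a <= t <= b -> {for t, continuous f}) ->
  exists2 M, 0 <= M & forall t, a <= t <= b -> `|f t| <= M.
Proof.
move=> cf; have [ab|ab] := leP a b; last first.
  by exists 0 => // t /andP[t1 t2]; have := le_trans t1 t2; rewrite leNgt ab.
have cn : {within `[a, b], continuous (fun t => `|f t|)}.
  by apply: seg_within => t /cf h; exact: cvg_norm.
have [c _ cP] := EVT_max ab cn; by exists `|f c|.
Qed.

Lemma seg_cbounded (f : R -> R[i]) (a b : R) :
  (forall t, a <= t <= b -> {for t, continuous f}) ->
  exists2 M, 0 <= M & forall t, a <= t <= b -> normc (f t) <= M.
Proof.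
move=> cf; have [M M0 MP] : exists2 M, 0 <= M &
    forall t, a <= t <= b -> `|normc (f t)| <= M.
  by apply: seg_bounded => t /cf; exact: ccont_normc.
by exists M => // t /MP; apply: le_trans; exact: ler_norm.
Qed.

Lemma rintegrableM (w k : R -> R) (a b : R) :
  mu.-integrable `[a, b] (fun t => (w t)%:E) ->
  (forall t, a <= t <= b -> {for t, continuous k}) ->
  mu.-integrable `[a, b] (fun t => (w t * k t)%:E).
Proof.
move=> iw ck; have mab := measurable_seg a b.
have mk : measurable_fun (`[a, b] : set (measurableTypeR R)) k.
  by apply/measurable_EFinP; exact: (measurable_int mu (rcont_integrable ck)).
have [M M0 MP] := seg_bounded ck.
apply: (integrableMl mab iw mk); exists M; split; first exact: num_real.
move=> x Mx t /=; rewrite in_itv /= => /MP h; apply: (le_trans h); exact: ltW.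
Qed.

Lemma cintegrableM (w k : R -> R[i]) (a b : R) : cintegrable a b w ->
  (forall t, a <= t <= b -> {for t, continuous k}) ->
  cintegrable a b (fun t => w t * k t).
Proof.
move=> [w1 w2] ck.
have k1 t : a <= t <= b -> {for t, continuous (fun s => complex.Re (k s))}.
  by move=> /ck/ccont_ReIm[].
have k2 t : a <= t <= b -> {for t, continuous (fun s => complex.Im (k s))}.
  by move=> /ck/ccont_ReIm[].
split.
  apply: eq_rintegrable (rintegrableB (rintegrableM w1 k1) (rintegrableM w2 k2)).
  by move=> t _; rewrite cReM.
apply: eq_rintegrable (rintegrableD (rintegrableM w1 k2) (rintegrableM w2 k1)).
by move=> t _; rewrite cImM.
Qed.

(** A majorant of the modulus whose integrability is immediate from that of the
    components. *)
Definition l1 (w : R -> R[i]) (t : R) : R :=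
  `|complex.Re (w t)| + `|complex.Im (w t)|.

Lemma l1_ge (w : R -> R[i]) t : normc (w t) <= l1 w t.
Proof. exact: normc_le_ReIm. Qed.

Lemma l1_integrable (w : R -> R[i]) (a b : R) : cintegrable a b w ->
  mu.-integrable `[a, b] (fun t => (l1 w t)%:E).
Proof.
move=> [w1 w2]; apply: rintegrableD.
  exact: (integrable_norm w1).
exact: (integrable_norm w2).
Qed.

Lemma normc_cintM_le (w k : R -> R[i]) (a b M : R) : cintegrable a b w ->
  cintegrable a b (fun t => w t * k t) ->
  (forall t, a <= t <= b -> normc (k t) <= M) ->
  normc (cint a b (fun t => w t * k t)) <=
    2 * (M * \int[mu]_(t in `[a, b]) l1 w t).
Proof.
move=> iw iwk kM; have il := l1_integrable iw.
have iM := rintegrableZ M il.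
rewrite -(RintegralZl M (measurable_seg a b) il).
apply: (normc_cint_le iwk iM) => t tP; rewrite normcM mulrC.
by apply: ler_pM; rewrite ?normc_ge0 ?l1_ge // kM.
Qed.

Definition cauchy_int (a b : R) (w c : R -> R[i]) (n : nat) (z : R[i]) : R[i] :=
  cint a b (fun t => w t * (c t - z)^-1 ^+ n).

(** For [p = (c - y)^-1], [q = (c - z)^-1] and [k = y - z] the hypothesis is the
    resolvent identity: this is the Taylor bound for powers of the kernel,
    uniform along the curve. *)
Lemma pow_taylor (p q k : R[i]) (D : R) (n : nat) :
  p - q = k * p * q -> normc p <= D -> normc q <= D ->
  normc (p ^+ n - q ^+ n - n%:R * k * q ^+ n.+1) <=
    (n ^ 2)%:R * D ^+ n.+2 * normc k ^+ 2.
Proof.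
move=> pq pD qD; have D0 : 0 <= D := le_trans (normc_ge0 _) pD.
elim: n => [|n IHn].
  by rewrite !expr0 subrr mul0r sub0r normcN mul0r normc0 !mul0r.
have -> : p ^+ n.+1 - q ^+ n.+1 - n.+1%:R * k * q ^+ n.+2 =
   p * (p ^+ n - q ^+ n - n%:R * k * q ^+ n.+1) +
   n.+1%:R * k * q ^+ n.+1 * (k * p * q).
  transitivity (p * (p ^+ n - q ^+ n - n%:R * k * q ^+ n.+1) +
     n.+1%:R * k * q ^+ n.+1 * (k * p * q) +
     q ^+ n * (1 + n.+1%:R * k * q) * (p - q - k * p * q)).
    by rewrite !exprS -natr1; ring.
  by rewrite pq subrr mulr0 addr0.
apply: (le_trans (normcD _ _)); rewrite !normcM normcX.
have qn : normc q ^+ n.+1 <= D ^+ n.+1.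
  by apply: lerXn2r => //; rewrite nnegrE ?normc_ge0.
have h1 : normc p * normc (p ^+ n - q ^+ n - n%:R * k * q ^+ n.+1) <=
   D * ((n ^ 2)%:R * D ^+ n.+2 * normc k ^+ 2).
  by apply: ler_pM => //; exact: normc_ge0.
have nn : normc (n.+1%:R : R[i]) = n.+1%:R.
  by rewrite -(rmorph_nat (real_complex R)) normcR normr_nat.
have h2 : normc (n.+1%:R : R[i]) * normc k * normc q ^+ n.+1 *
    (normc k * normc p * normc q) <=
   n.+1%:R * normc k * D ^+ n.+1 * (normc k * D * D).
  have k0 := normc_ge0 k; have p0 := normc_ge0 p; have q0 := normc_ge0 q.
  rewrite nn; apply: ler_pM.
  - by rewrite !mulr_ge0 // exprn_ge0.
  - by rewrite !mulr_ge0.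
  - by apply: ler_wpM2l => //; rewrite mulr_ge0.
  - apply: ler_pM => //; first exact: mulr_ge0.
    exact: ler_wpM2l.
apply: (le_trans (lerD h1 h2)).
have -> : D * ((n ^ 2)%:R * D ^+ n.+2 * normc k ^+ 2) +
  n.+1%:R * normc k * D ^+ n.+1 * (normc k * D * D) =
  ((n ^ 2)%:R + n.+1%:R) * (D ^+ n.+3 * normc k ^+ 2).
  by rewrite !exprS; ring.
rewrite -mulrA; apply: ler_wpM2r.
  by rewrite mulr_ge0 // exprn_ge0 // normc_ge0.
by rewrite -natrD ler_nat -!mulnn mulSn mulnS addnC leq_add2l leq_addl.
Qed.

(** Differentiation under the integral sign: away from the curve, [pow_taylor]
    makes the second order error uniform. *)
Lemma cauchy_int_cdiff (a b d : R) (w c : R -> R[i]) (n : nat) (z : R[i]) :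
  cintegrable a b w ->
  (forall t, a <= t <= b -> {for t, continuous c}) -> 0 < d ->
  (forall t, a <= t <= b -> d <= normc (c t - z)) ->
  cdiff (cauchy_int a b w c n) z (n%:R * cauchy_int a b w c n.+1 z).
Proof.
move=> iw cc d0 far e e0.
pose I := \int[mu]_(t in `[a, b]) l1 w t.
have I0 : 0 <= I by apply: Rintegral_ge0 => t _; apply: addr_ge0.
pose D := 2 / d; have D0 : 0 < D by rewrite divr_gt0.
pose A := 2 * ((n ^ 2)%:R * D ^+ n.+2 * I) + 1.
have A0 : 0 < A.
  have Dn : 0 <= D ^+ n.+2 by rewrite exprn_ge0 // ltW.
  by rewrite ltr_wpDl // mulr_ge0 // mulr_ge0 // mulr_ge0.
exists (Num.min (d / 2) (e / A)); first by rewrite lt_min !divr_gt0.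
move=> y; rewrite lt_min => /andP[y1 y2].
have far' t : a <= t <= b -> d / 2 <= normc (c t - y).
  move=> /far; have := normc_tri y (c t) z; lra.
have kc u m : (forall t, a <= t <= b -> d / 2 <= normc (c t - u)) ->
    forall t, a <= t <= b -> {for t, continuous (fun t => (c t - u)^-1 ^+ m)}.
  move=> fu t tP.
  have ct : {for t, continuous (fun t => (c t - u)^-1)}.
    apply: (@ccontV _ (fun t => c t - u)).
      apply: ccontD; [exact: cc|exact: ccont_cst].
    by rewrite -normc_gt0; apply: lt_le_trans (fu _ tP); rewrite divr_gt0.
  elim: m => [|m IHm]; first exact: ccont_cst.
  have -> : (fun t => (c t - u)^-1 ^+ m.+1) =
    (fun t => (c t - u)^-1 * (c t - u)^-1 ^+ m).
    by apply/funext => s; rewrite exprS.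
  exact: (ccontM ct IHm).
have farz t : a <= t <= b -> d / 2 <= normc (c t - z) by move=> /far; lra.
have iy m := cintegrableM iw (kc y m far').
have iz m := cintegrableM iw (kc z m farz).
have iz' : cintegrable a b (fun t => n%:R * (y - z) * (w t * (c t - z)^-1 ^+ n.+1)).
  exact: cintegrableZ.
rewrite /cauchy_int.
have -> : cint a b (fun t => w t * (c t - y)^-1 ^+ n) -
    cint a b (fun t => w t * (c t - z)^-1 ^+ n) -
    n%:R * cint a b (fun t => w t * (c t - z)^-1 ^+ n.+1) * (y - z) =
  cint a b (fun t => w t * ((c t - y)^-1 ^+ n - (c t - z)^-1 ^+ n -
     n%:R * (y - z) * (c t - z)^-1 ^+ n.+1)).
  rewrite mulrAC -cintZ // -cintB // -cintB //; last exact: cintegrableB.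
  by apply: eq_cint => t _; ring.
have ik : cintegrable a b (fun t => w t * ((c t - y)^-1 ^+ n - (c t - z)^-1 ^+ n -
     n%:R * (y - z) * (c t - z)^-1 ^+ n.+1)).
  apply: eq_cintegrable (cintegrableB (cintegrableB (iy n) (iz n)) iz') => t _.
  by ring.
have bnd t : a <= t <= b -> normc ((c t - y)^-1 ^+ n - (c t - z)^-1 ^+ n -
    n%:R * (y - z) * (c t - z)^-1 ^+ n.+1) <=
    (n ^ 2)%:R * D ^+ n.+2 * normc (y - z) ^+ 2.
  move=> tP; have [f1 f2] := (far' _ tP, farz _ tP).
  have d20 : 0 < d / 2 by rewrite divr_gt0.
  have n1 : c t - y != 0 by rewrite -normc_gt0 (lt_le_trans d20).
  have n2 : c t - z != 0 by rewrite -normc_gt0 (lt_le_trans d20).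
  have DE : D = (d / 2)^-1 by rewrite /D invf_div.
  apply: pow_taylor.
  - by field; rewrite n1 n2.
  - by rewrite normcV DE lef_pV2 ?posrE ?(lt_le_trans d20).
  - by rewrite normcV DE lef_pV2 ?posrE ?(lt_le_trans d20).
apply: (le_trans (normc_cintM_le iw ik bnd)).
have yz0 := normc_ge0 (y - z).
rewrite -/I [_ * I]mulrAC.
have -> : 2 * ((n ^ 2)%:R * D ^+ n.+2 * I * normc (y - z) ^+ 2) =
  (A - 1) * normc (y - z) * normc (y - z) by rewrite /A expr2; ring.
apply: ler_wpM2r => //.
move: y2; rewrite ltr_pdivlMr // => /ltW; apply: le_trans.
by rewrite mulrC; apply: ler_wpM2l => //; rewrite gerBl.
Qed.

Lemma cauchy_int_bound (a b d : R) (w c : R -> R[i]) (z : R[i]) :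
  cintegrable a b w ->
  (forall t, a <= t <= b -> {for t, continuous c}) -> 0 < d ->
  (forall t, a <= t <= b -> d <= normc (c t - z)) ->
  normc (cauchy_int a b w c 1 z) <= 2 * (d^-1 * \int[mu]_(t in `[a, b]) l1 w t).
Proof.
move=> iw cc d0 far.
have ck t : a <= t <= b -> {for t, continuous (fun t => (c t - z)^-1 ^+ 1)}.
  move=> tP; apply: (ccontV (f := fun t => c t - z)).
    by apply: ccontD; [exact: cc|exact: ccont_cst].
  by rewrite -normc_gt0 (lt_le_trans d0) // far.
apply: (normc_cintM_le iw (cintegrableM iw ck)) => t tP.
rewrite expr1 normcV lef_pV2 ?posrE //; first exact: far.
exact: lt_le_trans (far t tP).
Qed.

Lemma cdiff_rdiff_line (f : R[i] -> R[i]) (z l v : R[i]) : cdiff f z l ->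
  rdiff (fun s : R => f (z + s%:C * v)) 0 (l * v).
Proof.
move=> fl; have z0 : z + (0 : R)%:C * v = z by rewrite rmorph0 mul0r addr0.
apply: (@rdiff_comp _ f (fun s => z + s%:C * v)); first by rewrite z0.
move=> e e0; exists 1 => // s _.
have -> : z + s%:C * v - (z + (0 : R)%:C * v) - (s - 0)%:C * v = 0.
  by rewrite z0 subr0; ring.
by rewrite normc0 mulr_ge0 // ltW.
Qed.

Lemma rdiff_cderiv (c : R -> R[i]) t v : rdiff c t v ->
  cderivable c t /\ cderiv c t = v.
Proof.
move=> /rdiff_ReIm[h1 h2]; split.
  by split; [exact: (@ex_derive _ _ _ _ _ _ _ h1)|exact: (@ex_derive _ _ _ _ _ _ _ h2)].
apply: complex_ext; rewrite /= derive1E.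
  exact: (@derive_val _ _ _ _ _ _ _ h1).
exact: (@derive_val _ _ _ _ _ _ _ h2).
Qed.

Lemma cderivable_rdiff (c : R -> R[i]) t : cderivable c t ->
  rdiff c t (cderiv c t).
Proof.
move=> [h1 h2]; apply/rdiff_ReIm.
by split; [apply: (DeriveDef h1)|apply: (DeriveDef h2)]; exact/esym/derive1E.
Qed.

(** Both partial derivatives of a multiple of [g n] are multiples of [g n.+1], so
    that the induction on [k] stays within multiples of the family. *)
Lemma tower_Ck (U : set R[i]) (g : nat -> R[i] -> R[i]) : open U ->
  (forall n z, U z -> cdiff (g n) z (g n.+1 z)) ->
  forall k n (x : R[i]) f, (forall z, U z -> f z = x * g n z) -> Ck_on k U f.
Proof.
move=> oU dg; elim=> [|k IHk] n x f fg.
  split=> // z Uz; have [e e0 eU] := (open_normcP U).1 oU z Uz.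
  apply: (@cdiff_continuous _ _ _ (x * g n.+1 z)).
  apply: (@cdiff_comp_eq _ (fun y => x * g n y) f z _ e e0).
    by move=> y /eU/fg.
  exact: cdiffZ (dg _ _ Uz).
have fd z : U z -> cdiff f z (x * g n.+1 z).
  move=> Uz; have [e e0 eU] := (open_normcP U).1 oU z Uz.
  apply: (@cdiff_comp_eq _ (fun y => x * g n y) f z _ e e0).
    by move=> y /eU/fg.
  exact: cdiffZ (dg _ _ Uz).
split; first by move=> z /fd; exact: cdiff_continuous.
have pd v z : U z -> pderivable v f z /\ pderiv v f z = (x * v) * g n.+1 z.
  move=> Uz; have [h1 h2] := rdiff_cderiv (cdiff_rdiff_line v (fd _ Uz)).
  by split => //; rewrite /pderiv h2; ring.
split.
- by move=> z Uz; split; [exact: (pd _ _ Uz).1|exact: (pd _ _ Uz).1].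
- apply: (IHk n.+1 (x * 1)) => z Uz; exact: (pd _ _ Uz).2.
- apply: (IHk n.+1 (x * 'i%C)) => z Uz; exact: (pd _ _ Uz).2.
Qed.

End CauchyType.

(** * The Cauchy kernel tempered by a Lipschitz function *)

Section Dominated.
Context {R : realType}.
Local Notation mu := (@lebesgue_measure R).

(** Inversion, with value 0 at 0, is the pointwise limit of continuous
    functions. *)
Lemma measurable_inv : measurable_fun [set: measurableTypeR R] (fun x : R => x^-1).
Proof.
have pos n (x : R) : 0 < x ^+ 2 + n.+1%:R^-1.
  by rewrite ltr_wpDl ?sqr_ge0 // invr_gt0 ltr0n.
apply: (@measurable_fun_cvg _ _ _ setT (fun n (x : measurableTypeR R) =>
    (x * (x ^+ 2 + n.+1%:R^-1)^-1 : R))) => //.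
  move=> n; apply: continuous_measurable_fun => x.
  apply: cvgM; first exact: cvg_id.
  apply: cvgV; first by rewrite gt_eqF.
  apply: cvgD; last exact: cvg_cst.
  by apply: (@cvgM _ _ _ _ id id); exact: cvg_id.
move=> x _; have [->|x0] := eqVneq x 0.
  by rewrite invr0; under eq_fun do rewrite mul0r; exact: cvg_cst.
have -> : x^-1 = x * (x ^+ 2 + 0)^-1 by field.
apply: cvgM; first exact: cvg_cst.
apply: cvgV; first by rewrite addr0 expf_neq0.
by apply: cvgD; [exact: cvg_cst|exact: cvg_harmonic].
Qed.

Lemma rintegrable_bounded (w h : R -> R) (a b M : R) :
  mu.-integrable `[a, b] (fun t => (w t)%:E) ->
  measurable_fun (`[a, b] : set (measurableTypeR R)) h ->
  (forall t, a <= t <= b -> `|h t| <= M) ->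
  mu.-integrable `[a, b] (fun t => (w t * h t)%:E).
Proof.
move=> iw mh hM; apply: (integrableMl (measurable_seg a b) iw mh).
exists M; split; first exact: num_real.
move=> x Mx t /=; rewrite in_itv /= => /hM k; apply: (le_trans k); exact: ltW.
Qed.

(** The exceptional parameter [t0] is the one at which the curve passes through
    the point where the kernel below is singular. *)
Lemma rintegral_dct (f_ : nat -> R -> R) (f g : R -> R) (a b t0 : R) :
  (forall n, measurable_fun (`[a, b] : set (measurableTypeR R)) (f_ n)) ->
  measurable_fun (`[a, b] : set (measurableTypeR R)) f ->
  (forall t, a <= t <= b -> t != t0 -> f_ n t @[n --> \oo] --> f t) ->
  mu.-integrable `[a, b] (fun t => (g t)%:E) ->
  (forall n t, a <= t <= b -> `|f_ n t| <= g t) ->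
  \int[mu]_(t in `[a, b]) f_ n t @[n --> \oo] --> \int[mu]_(t in `[a, b]) f t.
Proof.
move=> mf_ mf cf ig fg.
have [||||i1 _ h] := @dominated_convergence _ _ _ mu _ (measurable_seg a b)
    (fun n t => (f_ n t)%:E) (fun t => (f t)%:E) (fun t => (g t)%:E) _ _ _ ig _.
- by move=> n; apply/measurable_EFinP; exact: mf_.
- by apply/measurable_EFinP.
- exists [set t0]; split => //; first exact: lebesgue_measure_set1.
  move=> t /= ct; apply/eqP/negPn/negP => tt0; apply: ct; rewrite in_itv /= => tP.
  by apply/fine_cvgP; split; [near=> n|exact: cf].
- by apply: aeW => t n /=; rewrite in_itv /= => tP; rewrite lee_fin; exact: fg.
apply: fine_cvg; rewrite fineK //; apply: integrable_fin_num => //; exact: measurable_seg.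
Unshelve. all: by end_near. Qed.


Lemma cRe_inv (z : R[i]) : complex.Re z^-1 =
  complex.Re z * (complex.Re z ^+ 2 + complex.Im z ^+ 2)^-1.
Proof. by case: z. Qed.

Lemma cIm_inv (z : R[i]) : complex.Im z^-1 =
  - (complex.Im z * (complex.Re z ^+ 2 + complex.Im z ^+ 2)^-1).
Proof. by case: z. Qed.

Section SmoothedKernel.
Variables (a b Lam : R) (w c : R -> R[i]) (Psi : R[i] -> R).
Hypothesis iw : cintegrable a b w.
Hypothesis cc : forall t, a <= t <= b -> {for t, continuous c}.
Hypothesis PsiL : forall y z, `|Psi y - Psi z| <= Lam * normc (y - z).

(** The Cauchy kernel is not integrable along the curve when [z] lies on it; the
    difference of the values of a Lipschitz function compensates its pole. *)
Definition lip_kernel (z : R[i]) (t : R) : R[i] :=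
  (Psi (c t) - Psi z)%:C / (c t - z).

Let Lam0 : 0 <= Lam.
Proof.
by have := le_trans (normr_ge0 _) (PsiL 1 0); rewrite subr0 normc1 mulr1.
Qed.

Lemma Psi_continuous z : {for z, continuous (fun y => (Psi y)%:C : R[i])}.
Proof.
apply/continuous_normcP => e e0; have L1 : 0 < Lam + 1 by rewrite ltr_wpDl.
exists (e / (Lam + 1)); first exact: divr_gt0.
move=> y; rewrite ltr_pdivlMr // => h; rewrite -rmorphB normcR.
apply: le_lt_trans (PsiL _ _) _; apply: le_lt_trans h; rewrite mulrC.
by apply: ler_wpM2l; rewrite ?normc_ge0 // lerDl.
Qed.

Lemma lip_kernel_bound z t : normc (lip_kernel z t) <= Lam.
Proof.
rewrite /lip_kernel; have [->|cz] := eqVneq (c t) z.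
  by rewrite subrr mul0r normc0.
rewrite normcM normcV normcR ler_pdivrMr; first exact: PsiL.
by rewrite normc_gt0 subr_eq0.
Qed.

Let mcont (f : R -> R) : (forall t, a <= t <= b -> {for t, continuous f}) ->
  measurable_fun (`[a, b] : set (measurableTypeR R)) f.
Proof.
by move=> cf; apply/measurable_EFinP; exact: (measurable_int mu (rcont_integrable cf)).
Qed.

Lemma lip_kernel_measurable z :
  measurable_fun (`[a, b] : set (measurableTypeR R))
    (fun t => complex.Re (lip_kernel z t)) /\
  measurable_fun (`[a, b] : set (measurableTypeR R))
    (fun t => complex.Im (lip_kernel z t)).
Proof.
have c1 t : a <= t <= b -> {for t, continuous (fun s => c s - z)}.
  by move=> tP; apply: ccontD; [exact: cc|exact: ccont_cst].
have m1 : measurable_fun (`[a, b] : set (measurableTypeR R)) (fun t => complex.Re (c t - z)).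
  by apply: mcont => t /c1/ccont_ReIm[].
have m2 : measurable_fun (`[a, b] : set (measurableTypeR R)) (fun t => complex.Im (c t - z)).
  by apply: mcont => t /c1/ccont_ReIm[].
have m3 : measurable_fun (`[a, b] : set (measurableTypeR R)) (fun t => Psi (c t) - Psi z).
  apply: mcont => t tP; apply: cvgB; last exact: cvg_cst.
  have := ccont_comp (cc tP) (@Psi_continuous (c t)).
  by move=> /ccont_ReIm[].
pose N t := (complex.Re (c t - z) ^+ 2 + complex.Im (c t - z) ^+ 2)^-1.
have m4 : measurable_fun (`[a, b] : set (measurableTypeR R)) N.
  apply: (measurableT_comp measurable_inv).
  by apply: measurable_funD; rewrite -[X in measurable_fun _ X]/(_ \* _);
    apply: measurable_funM.
split.
  rewrite (_ : (fun t => _) = fun t => (Psi (c t) - Psi z) * (complex.Re (c t - z) * N t)).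
    by apply: measurable_funM => //; exact: measurable_funM.
  by apply/funext => t; rewrite cReM cReR cImR cRe_inv mul0r subr0.
rewrite (_ : (fun t => _) = fun t => (Psi (c t) - Psi z) * - (complex.Im (c t - z) * N t)).
  apply: measurable_funM => //; apply: measurableT_comp => //.
  exact: measurable_funM.
by apply/funext => t; rewrite cImM cReR cImR cIm_inv mul0r addr0.
Qed.

Lemma lip_kernel_integrable z : cintegrable a b (fun t => w t * lip_kernel z t).
Proof.
have [m1 m2] := lip_kernel_measurable z; have [w1 w2] := iw.
have b1 t : a <= t <= b -> `|complex.Re (lip_kernel z t)| <= Lam.
  by move=> _; apply: le_trans (Re_le_normc _) (lip_kernel_bound _ _).
have b2 t : a <= t <= b -> `|complex.Im (lip_kernel z t)| <= Lam.
  by move=> _; apply: le_trans (Im_le_normc _) (lip_kernel_bound _ _).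
split.
  have h := rintegrableB (rintegrable_bounded w1 m1 b1) (rintegrable_bounded w2 m2 b2).
  by apply: eq_rintegrable h => t _; rewrite (cReM (w t)).
have h := rintegrableD (rintegrable_bounded w1 m2 b2) (rintegrable_bounded w2 m1 b1).
by apply: eq_rintegrable h => t _; rewrite (cImM (w t)).
Qed.

Definition lip_transform (z : R[i]) : R[i] :=
  cint a b (fun t => w t * lip_kernel z t).

Lemma lip_transform_bound z :
  normc (lip_transform z) <= 2 * (Lam * \int[mu]_(t in `[a, b]) l1 w t).
Proof.
apply: (normc_cintM_le iw (lip_kernel_integrable z)) => t _.
exact: lip_kernel_bound.
Qed.

Hypothesis inj : forall p, exists t0, forall t, a <= t <= b -> c t = p -> t = t0.

(** Dominated convergence: the integrands are bounded by a multiple of [l1 w] and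
    converge at every parameter but one. *)
Lemma lip_transform_continuous p : {for p, continuous lip_transform}.
Proof.
apply/continuous_normcP => e e0; apply: contrapT => H.
have {}H n : exists y, normc (y - p) < n.+1%:R^-1 /\
    e <= normc (lip_transform y - lip_transform p).
  apply: contrapT => K; apply: H; exists n.+1%:R^-1; first by rewrite invr_gt0.
  move=> y yp; rewrite ltNge; apply/negP => h; apply: K; by exists y.
have [y yP] := choice H.
have yp : y n @[n --> \oo] --> p.
  apply/cvg_normcP => d d0; near=> n.
  apply: (lt_trans (yP n).1); near: n.
  have /cvgrPdist_lt/(_ _ d0) := @cvg_harmonic R.
  by apply: filterS => n; rewrite sub0r normrN ger0_norm ?invr_ge0.
have [t0 t0P] := inj p.
have kc t : a <= t <= b -> t != t0 -> lip_kernel (y n) t @[n --> \oo] --> lip_kernel p t.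
  move=> tP tt0; have cp : c t - p != 0.
    by rewrite subr_eq0; apply/eqP => /(t0P t tP)/eqP; exact/negP.
  rewrite /lip_kernel; apply: cvgM.
    have -> : (fun n => (Psi (c t) - Psi (y n))%:C) =
        (fun n => (Psi (c t))%:C - (Psi (y n))%:C :> R[i]).
      by apply/funext => n; rewrite rmorphB.
    have h : (Psi (y n))%:C @[n --> \oo] --> ((Psi p)%:C : R[i]).
      exact: (continuous_cvg _ (@Psi_continuous p) yp).
    by rewrite rmorphB; apply: (cvgB _ h); exact: cvg_cst.
  have h : c t - y n @[n --> \oo] --> c t - p.
    by apply: cvgB; [exact: cvg_cst|exact: yp].
  exact: (cvgV cp h).
have wk t : a <= t <= b -> t != t0 ->
    w t * lip_kernel (y n) t @[n --> \oo] --> w t * lip_kernel p t.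
  by move=> tP tt0; apply: cvgM; [exact: cvg_cst|exact: kc].
have ReImc (u : nat -> R[i]) (l : R[i]) : u n @[n --> \oo] --> l ->
    (complex.Re (u n) @[n --> \oo] --> complex.Re l) /\
    (complex.Im (u n) @[n --> \oo] --> complex.Im l).
  move=> /cvg_normcP h; split; apply/cvgrPdist_lt => d /h; apply: filterS => n;
    apply: le_lt_trans; rewrite normcC.
  - by rewrite -cReN -cReD; exact: Re_le_normc.
  - by rewrite -cImN -cImD; exact: Im_le_normc.
have il := rintegrableZ Lam (l1_integrable iw).
have bnd z t : normc (w t * lip_kernel z t) <= Lam * l1 w t.
  rewrite normcM mulrC; apply: ler_pM; rewrite ?normc_ge0 //.
    exact: lip_kernel_bound.
  exact: l1_ge.
have meas z : measurable_fun (`[a, b] : set (measurableTypeR R))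
    (fun t => complex.Re (w t * lip_kernel z t)) /\
  measurable_fun (`[a, b] : set (measurableTypeR R))
    (fun t => complex.Im (w t * lip_kernel z t)).
  have [i1 i2] := lip_kernel_integrable z.
  by split; apply/measurable_EFinP; [exact: measurable_int i1|exact: measurable_int i2].
have lim : lip_transform (y n) @[n --> \oo] --> lip_transform p.
  have h1 : complex.Re (lip_transform (y n)) @[n --> \oo] -->
      complex.Re (lip_transform p).
    apply: (@rintegral_dct _ _ _ a b t0 (fun n => (meas (y n)).1) (meas p).1 _ il).
      by move=> t tP tt0; have [] := ReImc _ _ (wk _ tP tt0).
    by move=> n t _; apply: le_trans (Re_le_normc _) (bnd _ _).
  have h2 : complex.Im (lip_transform (y n)) @[n --> \oo] -->
      complex.Im (lip_transform p).
    apply: (@rintegral_dct _ _ _ a b t0 (fun n => (meas (y n)).2) (meas p).2 _ il).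
      by move=> t tP tt0; have [] := ReImc _ _ (wk _ tP tt0).
    by move=> n t _; apply: le_trans (Im_le_normc _) (bnd _ _).
  apply/cvg_normcP => d d0; have d20 : 0 < d / 2 by rewrite divr_gt0.
  move: h1 h2 => /cvgrPdist_lt/(_ _ d20) h1 /cvgrPdist_lt/(_ _ d20) h2.
  near=> n; apply: le_lt_trans (normc_le_ReIm _) _.
  rewrite !cpx_simp [d]splitr; apply: ltrD; rewrite distrC.
    by near: n.
  by near: n.
have /cvg_normcP/(_ _ e0) := lim.
move=> [N _ /(_ N (leqnn N))] /= h; have := (yP N).2.
by rewrite leNgt h.
Unshelve. all: by end_near. Qed.

End SmoothedKernel.

End Dominated.

(** * The moving frame of the curve *)

Section RealContinuity.
Context {R : realType}.
Implicit Types (f g : R -> R) (t : R).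

Lemma rcontM f g t : {for t, continuous f} -> {for t, continuous g} ->
  {for t, continuous (fun s => f s * g s)}.
Proof. exact: cvgM. Qed.
Lemma rcontD f g t : {for t, continuous f} -> {for t, continuous g} ->
  {for t, continuous (fun s => f s + g s)}.
Proof. exact: cvgD. Qed.
Lemma rcontN f t : {for t, continuous f} -> {for t, continuous (fun s => - f s)}.
Proof. exact: cvgN. Qed.
Lemma rcontV f t : {for t, continuous f} -> f t != 0 ->
  {for t, continuous (fun s => (f s)^-1)}.
Proof. by move=> fc f0; exact: cvgV. Qed.

End RealContinuity.

Section Curve.
Context {R : realType}.
Variable gamma : R -> R[i].
Hypothesis gammaJ : smooth_jordan_curve gamma.

Local Notation g1 := (cderiv gamma).
Local Notation g2 := (cderiv (cderiv gamma)).
Local Notation v := (speed gamma).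
Local Notation T := (tangent gamma).

Lemma rdiff_gamma t : rdiff gamma t (g1 t).
Proof. by case: gammaJ => /(_ 0%N t) h _ _ _; exact: cderivable_rdiff. Qed.

Lemma rdiff_g1 t : rdiff g1 t (g2 t).
Proof. by case: gammaJ => /(_ 1%N t) h _ _ _; exact: cderivable_rdiff. Qed.

Lemma cont_gamma t : {for t, continuous gamma}.
Proof. exact: rdiff_continuous (rdiff_gamma t). Qed.

Lemma cont_g1 t : {for t, continuous g1}.
Proof. exact: rdiff_continuous (rdiff_g1 t). Qed.

Lemma cont_g2 t : {for t, continuous g2}.
Proof.
case: gammaJ => /(_ 2%N t) h _ _ _.
exact: rdiff_continuous (cderivable_rdiff h).
Qed.

Lemma speed_gt0 t : 0 < v t.
Proof. by case: gammaJ => _ _ _ h; rewrite normc_gt0. Qed.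

Lemma rdiff_scale (p : R -> R) (c : R -> R[i]) (t dp : R) (w : R[i]) :
  is_derive t 1 p dp -> rdiff c t w ->
  rdiff (fun s => (p s)%:C * c s) t (dp%:C * c t + (p t)%:C * w).
Proof.
move=> hp /rdiff_ReIm[h1 h2]; apply/rdiff_ReIm; split.
  have h := is_deriveM hp h1.
  have -> : (fun s => complex.Re ((p s)%:C * c s)) =
      p * (fun s => complex.Re (c s)).
    by apply/funext => s; rewrite cReM cReR cImR mul0r subr0.
  apply: (is_derive_eq h).
  by rewrite !cpx_simp /GRing.scale /= !mul0r !subr0 addrC; congr (_ + _); rewrite mulrC.
have h := is_deriveM hp h2.
have -> : (fun s => complex.Im ((p s)%:C * c s)) =
    p * (fun s => complex.Im (c s)).
  by apply/funext => s; rewrite cImM cReR cImR mul0r addr0.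
apply: (is_derive_eq h).
by rewrite !cpx_simp /GRing.scale /= !mul0r !addr0 addrC; congr (_ + _); rewrite mulrC.
Qed.

(** The real inner product of the plane. *)
Definition ip (z w : R[i]) : R :=
  complex.Re z * complex.Re w + complex.Im z * complex.Im w.

Definition dspeed t : R := ip (g1 t) (g2 t) / v t.

Lemma is_derive_sqsum (X Y : R -> R) (t dX dY : R) :
  is_derive t 1 X dX -> is_derive t 1 Y dY ->
  is_derive t 1 (fun s => X s ^+ 2 + Y s ^+ 2) (2 * (X t * dX + Y t * dY)).
Proof.
move=> h1 h2; apply: (is_derive_eq (is_deriveD (is_deriveM h1 h1) (is_deriveM h2 h2))).
by rewrite /GRing.scale /=; ring.
Qed.

Lemma is_derive_normc (c : R -> R[i]) (t : R) (w : R[i]) : rdiff c t w ->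
  c t != 0 -> is_derive t 1 (fun s => normc (c s)) (ip (c t) w / normc (c t)).
Proof.
move=> /rdiff_ReIm[h1 h2] c0; have n0 : 0 < normc (c t) by rewrite normc_gt0.
have hN := is_derive_sqsum h1 h2.
pose q s := complex.Re (c s) ^+ 2 + complex.Im (c s) ^+ 2.
have qE s : q s = normc (c s) ^+ 2 by rewrite normc_sqr.
have nE : (fun s => normc (c s)) = Num.sqrt \o q.
  apply/funext => s /=; rewrite qE sqrtr_sqr ger0_norm //; exact: normc_ge0.
have N0 : 0 < q t by rewrite qE exprn_gt0.
have sE : Num.sqrt (q t) = normc (c t).
  by rewrite qE sqrtr_sqr ger0_norm // normc_ge0.
have hs : is_derive (q t) 1 Num.sqrt (2 * normc (c t))^-1.
  by rewrite -sE; exact: is_derive1_sqrt.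
have hN' : is_derive t 1 q (2 * ip (c t) w) by exact: hN.
have h := is_derive1_comp hs hN'.
rewrite nE; apply: (is_derive_eq h).
by field; rewrite gt_eqF.
Qed.

Lemma is_derive_speed (t : R) : is_derive t 1 v (dspeed t).
Proof.
apply: is_derive_normc (rdiff_g1 t) _; rewrite -normc_gt0; exact: speed_gt0.
Qed.

Definition dT t : R[i] :=
  (- dspeed t / v t ^+ 2)%:C * g1 t + ((v t)^-1)%:C * g2 t.

Lemma TE : T = (fun s => ((v s)^-1)%:C * g1 s).
Proof. by apply/funext => s; rewrite /tangent mulrC fmorphV. Qed.

Lemma rdiff_T t : rdiff T t (dT t).
Proof.
rewrite TE /dT; apply: rdiff_scale (rdiff_g1 t).
have h := is_derive_speed t; have v0 := speed_gt0 t.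
have vn : v t != 0 by rewrite gt_eqF.
apply: (is_derive_eq (is_deriveV vn h)).
by move: (dspeed t) (v t) vn => D V Vn; rewrite /GRing.scale /=; field.
Qed.

Lemma cont_T t : {for t, continuous T}.
Proof. exact: rdiff_continuous (rdiff_T t). Qed.

Lemma cont_speed t : {for t, continuous v}.
Proof.
apply: differentiable_continuous; apply/derivable1_diffP.
exact: (@ex_derive _ _ _ _ _ _ _ (is_derive_speed t)).
Qed.

Lemma cont_dT t : {for t, continuous dT}.
Proof.
have vn : v t != 0 by rewrite gt_eqF // speed_gt0.
have [a1 a2] := (ccont_ReIm _ _).1 (@cont_g1 t).
have [b1 b2] := (ccont_ReIm _ _).1 (@cont_g2 t).
have cV := rcontV (@cont_speed t) vn.
have cds : {for t, continuous dspeed}.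
  exact: (rcontM (rcontD (rcontM a1 b1) (rcontM a2 b2)) cV).
have v2 : v t ^+ 2 != 0 by rewrite expf_neq0.
have cV2 := rcontV (rcontM (@cont_speed t) (@cont_speed t)) v2.
have c1 := ccont_real (rcontM (rcontN cds) cV2).
exact: (ccontD (ccontM c1 (@cont_g1 t)) (ccontM (ccont_real cV) (@cont_g2 t))).
Qed.

Lemma normc_T t : normc (T t) = 1.
Proof.
rewrite /tangent normcM normcV normcR ger0_norm ?normc_ge0 //.
by rewrite divff // gt_eqF // speed_gt0.
Qed.

Lemma g1E t : g1 t = (v t)%:C * T t.
Proof.
by rewrite /tangent mulrCA divff ?mulr1 // fmorph_eq0 gt_eqF // speed_gt0.
Qed.

(** The rate of turning of the tangent with respect to the parameter, that is
    the curvature times the speed. *)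
Definition curv t : R := complex.Re (T t) * complex.Im (dT t) -
  complex.Im (T t) * complex.Re (dT t).

(** The tangent has constant length, so its derivative is orthogonal to it. *)
Lemma dTE t : dT t = 'i * (curv t)%:C * T t.
Proof.
have n1 s : complex.Re (T s) ^+ 2 + complex.Im (T s) ^+ 2 = 1.
  by rewrite -normc_sqr normc_T expr1n.
have /rdiff_ReIm[h1 h2] := rdiff_T t.
have orth : complex.Re (T t) * complex.Re (dT t) +
    complex.Im (T t) * complex.Im (dT t) = 0.
  have h := is_derive_sqsum h1 h2.
  have E : (fun s => complex.Re (T s) ^+ 2 + complex.Im (T s) ^+ 2) = cst (1 : R).
    by apply/funext => s; rewrite n1.
  rewrite E in h; have := @derive_val _ _ _ _ _ _ _ h.
  rewrite derive_cst => e; lra.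
have N := n1 t.
set a := complex.Re (T t) in orth N *; set b := complex.Im (T t) in orth N *.
apply: complex_ext; rewrite !cpx_simp /curv -/a -/b.
  have -> : (0 * (a * complex.Im (dT t) - b * complex.Re (dT t)) - 1 * 0) * a -
     (0 * 0 + 1 * (a * complex.Im (dT t) - b * complex.Re (dT t))) * b =
     - a * (a * complex.Re (dT t) + b * complex.Im (dT t)) +
     complex.Re (dT t) * (a ^+ 2 + b ^+ 2) by ring.
  by rewrite orth N mulr0 add0r mulr1.
have -> : (0 * (a * complex.Im (dT t) - b * complex.Re (dT t)) - 1 * 0) * b +
     (0 * 0 + 1 * (a * complex.Im (dT t) - b * complex.Re (dT t))) * a =
     - b * (a * complex.Re (dT t) + b * complex.Im (dT t)) +
     complex.Im (dT t) * (a ^+ 2 + b ^+ 2) by ring.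
by rewrite orth N mulr0 add0r mulr1.
Qed.

End Curve.

(** * Normal coordinates along the curve *)

Section MeanValue.
Context {R : realType}.

Lemma normc_iR (s : R) (X : R[i]) : normc ('i * s%:C * X) = `|s| * normc X.
Proof. by rewrite !normcM normc_i mul1r normcR. Qed.

Lemma normc_iM (X : R[i]) : normc ('i * X) = normc X.
Proof. by rewrite normcM normc_i mul1r. Qed.

Lemma rdiff_lin (w : R[i]) (t : R) : rdiff (fun s => s%:C * w) t w.
Proof.
move=> e e0; exists 1 => // s _.
have -> : s%:C * w - t%:C * w - (s - t)%:C * w = 0 by ring.
by rewrite normc0 mulr_ge0 // ltW.
Qed.

Lemma rdiffB (f g : R -> R[i]) t v w : rdiff f t v -> rdiff g t w ->
  rdiff (fun s => f s - g s) t (v - w).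
Proof.
move=> hf hg; have hN : rdiff (fun s => - g s) t (- w).
  move=> e /hg[d d0 dP]; exists d => // s /dP.
  have -> : - g s - - g t - (s - t)%:C * - w = - (g s - g t - (s - t)%:C * w) by ring.
  by rewrite normcN.
exact: rdiffD hf hN.
Qed.

Lemma mvt_abs (F f : R -> R[i]) (lo hi M : R) :
  (forall t, lo <= t <= hi -> rdiff F t (f t)) ->
  (forall t, lo <= t <= hi -> normc (f t) <= M) ->
  forall t t', lo <= t <= hi -> lo <= t' <= hi ->
  normc (F t' - F t) <= 2 * M * `|t' - t|.
Proof.
move=> dF fM t t' /andP[t1 t2] /andP[t3 t4].
have [tt|tt] := leP t t'.
  rewrite ger0_norm ?subr_ge0 //; apply: (normc_mvt tt) => s /andP[s1 s2].
    by apply: dF; rewrite (le_trans t1) ?(le_trans s2).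
  by apply: fM; rewrite (le_trans t1) ?(le_trans s2).
have -> : `|t' - t| = t - t' by rewrite distrC ger0_norm // subr_ge0 ltW.
rewrite normcC.
apply: (normc_mvt (ltW tt)) => s /andP[s1 s2].
  by apply: dF; rewrite (le_trans t3) ?(le_trans s2).
by apply: fM; rewrite (le_trans t3) ?(le_trans s2).
Qed.

(** A locally constant predicate on a segment is constant: its indicator
    would otherwise violate the intermediate value theorem. *)
Lemma segment_induction (B : R -> Prop) (x y : R) : x <= y ->
  (forall u, x <= u <= y -> exists2 e, 0 < e &
     forall u', `|u' - u| < e -> (B u' <-> B u)) ->
  B x <-> B y.
Proof.
move=> xy loc; pose f u : R := if `[< B u >] then 0 else 1.
have cf u : x <= u <= y -> {for u, continuous f}.
  move=> uP; apply/rcontP => e e0; have [d d0 dP] := loc u uP.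
  exists d => // s /dP h; rewrite /f.
  by rewrite (_ : `[< B s >] = `[< B u >]) ?subrr ?normr0 //; exact: asbool_equiv_eq.
have noival c : f c <> 1 / 2.
  by rewrite /f; case: ifP => _; lra.
have [Bx|Bx] := pselect (B x); have [By|By] := pselect (B y); split => //.
- move=> _; exfalso; have [|c _ /noival//] := IVT (v := 1 / 2) xy (seg_within cf).
  by rewrite /f asboolT // asboolF // /Num.min /Num.max ltr01; lra.
- move=> _; exfalso; have [|c _ /noival//] := IVT (v := 1 / 2) xy (seg_within cf).
  by rewrite /f asboolF // asboolT // /Num.min /Num.max ltr10; lra.
Qed.

End MeanValue.

Section Collar.
Context {R : realType}.
Variable gamma : R -> R[i].
Hypothesis gammaJ : smooth_jordan_curve gamma.

Local Notation g1 := (cderiv gamma).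
Local Notation g2 := (cderiv (cderiv gamma)).
Local Notation v := (speed gamma).
Local Notation T := (tangent gamma).
Local Opaque tangent cderiv speed dT.
Local Notation dT := (dT gamma).

(** Normal coordinates: [t] is the parameter of the foot point and [s] the signed
    distance to it; [collar_t] and [collar_s] are the partial derivatives. *)
Definition collar (t s : R) : R[i] := gamma t + 'i * s%:C * T t.
Definition collar_t (t s : R) : R[i] := g1 t + 'i * s%:C * dT t.
Definition collar_s (t s : R) : R[i] := 'i * T t.

Lemma collar_dt t s : rdiff (fun t => collar t s) t (collar_t t s).
Proof.
apply: rdiffD; first exact: rdiff_gamma.
have h := rdiff_T gammaJ t; move=> e e0.
have m0 : 0 < `|s| + 1 by rewrite ltr_wpDl.
have [|d d0 dP] := h (e / (`|s| + 1)); first exact: divr_gt0.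
exists d => // y /dP k.
have -> : 'i * s%:C * T y - 'i * s%:C * T t - (y - t)%:C * ('i * s%:C * dT t) =
  'i * s%:C * (T y - T t - (y - t)%:C * dT t).
  by move: (T y) (T t) (dT t) => A1 A2 A3; ring.
rewrite normc_iR.
apply: (le_trans (ler_wpM2l (normr_ge0 s) k)).
rewrite mulrA; apply: ler_wpM2r => //.
rewrite mulrCA ger_pMr // ler_pdivrMr // mul1r; lra.
Qed.

Lemma collar_ds t s : rdiff (collar t) s (collar_s t s).
Proof.
move=> e e0; exists 1 => // y _.
have -> : collar t y - collar t s - (y - s)%:C * collar_s t s = 0.
  by rewrite /collar /collar_s; ring.
by rewrite normc0 mulr_ge0 // ltW.
Qed.

Lemma cont_collar_dt t s : {for t, continuous (fun t => collar_t t s)}.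
Proof.
apply: ccontD; first exact: cont_g1.
by apply: ccontM; [exact: ccont_cst|exact: cont_dT].
Qed.

(** Parallel curves have the same unit tangents as the curve; only the speed
    depends on [s], through the curvature. *)
Lemma collar_tE t s : collar_t t s = (v t - s * curv gamma t)%:C * T t.
Proof.
rewrite /collar_t (g1E gammaJ) (dTE gammaJ).
have -> : 'i * s%:C * ('i * (curv gamma t)%:C * T t) =
  ('i ^+ 2) * ((s * curv gamma t)%:C * T t) by rewrite rmorphM /=; ring.
by rewrite sqrCi rmorphB; ring.
Qed.

(** By periodicity a bounded window of parameters suffices; [-3, 3] leaves room
    for half a period around the parameters in [-2, 2] used later. *)
Definition curve_bounds (v0 C : R) : Prop :=
  [/\ 0 < v0, 1 <= C & forall t, -3 <= t <= 3 ->
    [/\ v0 <= v t, normc (g1 t) <= C, normc (g2 t) <= C & normc (dT t) <= C]].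

Lemma curve_bounds_exist : exists v0 C, curve_bounds v0 C.
Proof.
have m33 : -3 <= 3 :> R by lra.
have [c cP cmin] := EVT_min m33 (seg_within (fun t _ => @cont_speed _ _ gammaJ t)).
have [M1 M10 M1P] := seg_cbounded (a := -3) (b := 3) (fun t _ => @cont_g1 _ _ gammaJ t).
have [M2 M20 M2P] := seg_cbounded (a := -3) (b := 3) (fun t _ => @cont_g2 _ _ gammaJ t).
have [M3 M30 M3P] := seg_cbounded (a := -3) (b := 3) (fun t _ => @cont_dT _ _ gammaJ t).
exists (v c), (1 + M1 + M2 + M3); split; [exact: speed_gt0|lra|].
move=> t tP; have := M1P t tP; have := M2P t tP; have := M3P t tP.
split; [|lra|lra|lra].
by apply: cmin; rewrite in_itv.
Qed.

Variables (v0 C : R).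
Hypothesis cb : curve_bounds v0 C.
Let I (t : R) := -3 <= t <= 3.
Let v00 : 0 < v0. Proof. by case: cb. Qed.
Let C1 : 1 <= C. Proof. by case: cb. Qed.
Let vI t : I t -> v0 <= v t. Proof. by case: cb => _ _ h /h[]. Qed.
Let g1I t : I t -> normc (g1 t) <= C. Proof. by case: cb => _ _ h /h[]. Qed.
Let g2I t : I t -> normc (g2 t) <= C. Proof. by case: cb => _ _ h /h[]. Qed.
Let dTI t : I t -> normc (dT t) <= C. Proof. by case: cb => _ _ h /h[]. Qed.

Let C0 : 0 <= C. Proof. exact: le_trans ler01 C1. Qed.

Lemma lip_gamma t t' : I t -> I t' -> normc (gamma t' - gamma t) <= 2 * C * `|t' - t|.
Proof.
apply: (mvt_abs (f := g1)) => // s _; exact: rdiff_gamma.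
Qed.

Lemma lip_g1 t t' : I t -> I t' -> normc (g1 t' - g1 t) <= 2 * C * `|t' - t|.
Proof.
apply: (mvt_abs (f := g2)) => // s _; exact: rdiff_g1.
Qed.

Lemma lip_T t t' : I t -> I t' -> normc (T t' - T t) <= 2 * C * `|t' - t|.
Proof.
apply: (mvt_abs (f := dT)) => // s _; exact: rdiff_T.
Qed.

Lemma taylor_gamma t t' : I t -> I t' ->
  normc (gamma t' - gamma t - (t' - t)%:C * g1 t) <= 4 * C * `|t' - t| ^+ 2.
Proof.
move=> It It'.
have -> : gamma t' - gamma t - (t' - t)%:C * g1 t =
  (gamma t' - t'%:C * g1 t) - (gamma t - t%:C * g1 t) by rewrite rmorphB; ring.
pose lo := Num.min t t'; pose hi := Num.max t t'.
have [lt ut] : lo <= t <= hi /\ lo <= t' <= hi.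
  by rewrite /lo /hi !ge_min !le_max !lexx !orbT.
have dF s : lo <= s <= hi -> rdiff (fun s => gamma s - s%:C * g1 t) s (g1 s - g1 t).
  by move=> _; apply: rdiffB; [exact: rdiff_gamma|exact: rdiff_lin].
have fM s : lo <= s <= hi -> normc (g1 s - g1 t) <= 2 * C * `|t' - t|.
  move=> /andP[s1 s2].
  have [k1 k2] : -3 <= s /\ s <= 3.
    have [[a1 a2] [b1 b2]] := (andP It, andP It').
    split; first by apply: le_trans s1; rewrite le_min a1.
    by apply: (le_trans s2); rewrite ge_max a2.
  have Is : I s by rewrite /I k1.
  apply: (le_trans (lip_g1 It Is)); apply: ler_wpM2l; first by apply: mulr_ge0.
  move: s1 s2; rewrite /lo /hi /Num.min /Num.max; case: ltgtP => tt s1 s2.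
  - by rewrite !ger0_norm; lra.
  - by rewrite !ler0_norm; lra.
  - have -> : s = t by lra.
    by rewrite subrr normr0.
apply: (le_trans (mvt_abs dF fM lt ut)).
by rewrite le_eqVlt; apply/orP; left; apply/eqP; rewrite expr2; ring.
Qed.

Definition collar_Lip : R := 4 * C + 1.

Lemma collar_patch a b c d : -3 <= a -> b <= 3 -> -1 <= c -> d <= 1 ->
  C1_patch collar collar_t collar_s collar_Lip a b c d.
Proof.
move=> a3 b3 c1 d1.
have It t : a <= t <= b -> I t.
  by move=> /andP[t1 t2]; rewrite /I (le_trans a3 t1) (le_trans t2 b3).
have Is s : c <= s <= d -> `|s| <= 1.
  by move=> /andP[s1 s2]; rewrite ler_norml (le_trans c1 s1) (le_trans s2 d1).
split.
- by move=> t s _ _; exact: collar_dt.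
- by move=> t s _ _; exact: collar_ds.
- by move=> t s _ _; exact: cont_collar_dt.
- by move=> t s _ _; exact: ccont_cst.
- move=> t s /It tP /Is sP; apply: (le_trans (normcD _ _)).
  rewrite normc_iR.
  have h := g1I tP; have : `|s| * normc (dT t) <= 1 * C.
    by apply: ler_pM; rewrite ?normc_ge0 // dTI.
  by move: C0; rewrite /collar_Lip; lra.
- move=> t s _ _; rewrite normc_iM (normc_T gammaJ).
  by move: C0; rewrite /collar_Lip; lra.
- move=> t s t' s' /It tP /Is sP /It t'P /Is s'P.
  have -> : collar t s - collar t' s' = (gamma t - gamma t') +
    ('i * s%:C * (T t - T t') + 'i * (s - s')%:C * T t').
    rewrite /collar rmorphB; move: (gamma t) (gamma t') (T t) (T t') => A1 A2 A3 A4; ring.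
  apply: (le_trans (normcD _ _)).
  apply: (le_trans (lerD (lip_gamma t'P tP) (normcD _ _))).
  rewrite !normc_iR (normc_T gammaJ) mulr1.
  have h : `|s| * normc (T t - T t') <= 1 * (2 * C * `|t - t'|).
    by apply: ler_pM; rewrite ?normc_ge0 //; exact: lip_T.
  have ts : 0 <= `|t - t'| by []. have ss : 0 <= `|s - s'| by [].
  have hC : 0 <= C * `|s - s'| by exact: mulr_ge0.
  by rewrite /collar_Lip; lra.
Qed.

(** The partial derivatives are jointly continuous, so there is an expansion in
    both variables; the hypothesis turns the pair of partial derivatives into
    one complex factor, as required by [cauchy_patch]. *)
Lemma collar_taylor (t1 s1 k : R) : collar_s t1 s1 = 'i * k%:C * collar_t t1 s1 ->
  forall e, 0 < e -> exists2 r, 0 < r & forall t s,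
  `|t - t1| < r -> `|s - s1| < r ->
  [/\ normc (collar t s - collar t1 s1 -
        collar_t t1 s1 * ((t - t1)%:C + 'i * (k * (s - s1))%:C)) <=
        e * (`|t - t1| + `|s - s1|),
      normc (collar_t t s - collar_t t1 s1) <= e &
      normc (collar_s t s - collar_s t1 s1) <= e].
Proof.
move=> kE e e0; pose A := `|s1| + 1.
have A0 : 0 < A by rewrite ltr_wpDl.
have e20 : 0 < e / 2 by rewrite divr_gt0.
have e40 : 0 < e / 4 by rewrite divr_gt0.
have eA0 : 0 < e / 4 / A by exact: divr_gt0.
have [r1 r10 h1] := rdiff_gamma gammaJ t1 e20.
have [r2 r20 h2] := rdiff_T gammaJ t1 (divr_gt0 e20 A0).
have [r3 r30 h3] := (ccontP _ _).1 (@cont_T _ _ gammaJ t1) _ e20.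
have [r4 r40 h4] := (ccontP _ _).1 (@cont_g1 _ _ gammaJ t1) _ e40.
have [r5 r50 h5] := (ccontP _ _).1 (@cont_dT _ _ gammaJ t1) _ eA0.
have B0 : 0 < normc (dT t1) + 1 by rewrite ltr_wpDl // normc_ge0.
pose r6 := e / 4 / (normc (dT t1) + 1).
have r60 : 0 < r6 by exact: divr_gt0.
exists (Num.min (Num.min (Num.min r1 r2) (Num.min r3 r4)) (Num.min (Num.min r5 r6) 1)).
  by rewrite !lt_min r10 r20 r30 r40 r50 r60 ltr01.
move=> t s; rewrite !lt_min.
move=> /andP[/andP[/andP[/h1 k1 /h2 k2] /andP[/h3 k3 /h4 k4]] /andP[/andP[/h5 k5 _] _]].
move=> /andP[_ /andP[/andP[_ k6] k7]].
have sA : `|s| <= A.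
  by rewrite -[s](subrK s1) /A addrC; apply: le_trans (ler_normD _ _) _; lra.
split.
- have -> : collar t s - collar t1 s1 -
      collar_t t1 s1 * ((t - t1)%:C + 'i * (k * (s - s1))%:C) =
    (gamma t - gamma t1 - (t - t1)%:C * g1 t1) +
    ('i * s1%:C * (T t - T t1 - (t - t1)%:C * dT t1) +
     'i * (s - s1)%:C * (T t - T t1)).
    have -> : collar_t t1 s1 * ((t - t1)%:C + 'i * (k * (s - s1))%:C) =
      (t - t1)%:C * collar_t t1 s1 + (s - s1)%:C * ('i * k%:C * collar_t t1 s1).
      by rewrite [(k * _)%:C]rmorphM; move: (collar_t t1 s1) => A1; ring.
    rewrite -kE /collar /collar_t /collar_s !rmorphB.
    by move: (gamma t) (gamma t1) (T t) (T t1) (g1 t1) (dT t1) => A1 A2 A3 A4 A5 A6; ring.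
  apply: (le_trans (normcD _ _)); apply: (le_trans (lerD k1 (normcD _ _))).
  rewrite !normc_iR.
  have q1 : `|s1| * normc (T t - T t1 - (t - t1)%:C * dT t1) <=
      A * (e / 2 / A * `|t - t1|).
    by apply: ler_pM; rewrite ?normc_ge0 // /A; lra.
  have q2 : `|s - s1| * normc (T t - T t1) <= `|s - s1| * (e / 2).
    by apply: ler_wpM2l => //; exact: ltW.
  have q3 : A * (e / 2 / A * `|t - t1|) = e / 2 * `|t - t1|.
    by field; rewrite gt_eqF.
  have q4 := mulr_ge0 (ltW e0) (normr_ge0 (s - s1)).
  by move: q1 q2 q3 q4; lra.
- have -> : collar_t t s - collar_t t1 s1 = (g1 t - g1 t1) +
     ('i * s%:C * (dT t - dT t1) + 'i * (s - s1)%:C * dT t1).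
    rewrite /collar_t rmorphB.
    by move: (g1 t) (g1 t1) (dT t) (dT t1) => A1 A2 A3 A4; ring.
  apply: (le_trans (normcD _ _)); apply: (le_trans (lerD (ltW k4) (normcD _ _))).
  rewrite !normc_iR.
  have q1 : `|s| * normc (dT t - dT t1) <= A * (e / 4 / A).
    by apply: ler_pM; rewrite ?normc_ge0 //; exact: ltW.
  have q2 : A * (e / 4 / A) = e / 4 by field; rewrite gt_eqF.
  have q3 : `|s - s1| * normc (dT t1) <= r6 * (normc (dT t1) + 1).
    by apply: ler_pM; rewrite ?normc_ge0 //; [exact: ltW|rewrite lerDl].
  have q4 : r6 * (normc (dT t1) + 1) = e / 4.
    by rewrite /r6; field; rewrite gt_eqF.
  by move: q1 q2 q3 q4 e0; lra.
- have -> : collar_s t s - collar_s t1 s1 = 'i * (T t - T t1).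
    by rewrite /collar_s; move: (T t) (T t1) => A1 A2; ring.
  by rewrite normc_iM; move: k3 e0; lra.
Qed.

End Collar.

(** * Distances in normal coordinates *)

Section Geometry.
Context {R : realType}.
Variable gamma : R -> R[i].
Hypothesis gammaJ : smooth_jordan_curve gamma.

Local Notation g1 := (cderiv gamma).
Local Notation v := (speed gamma).
Local Notation T := (tangent gamma).
Local Notation Phi := (collar gamma).

Lemma gamma_int (n : int) t : gamma (t + n%:~R) = gamma t.
Proof.
have per s : gamma (s + 1) = gamma s by case: gammaJ => _ h _ _; exact: h.
have pn (k : nat) s : gamma (s + k%:R) = gamma s.
  elim: k s => [|k IHk] s; first by rewrite addr0.
  by rewrite -natr1 addrA per IHk.
case: n => k; first exact: pn.
by rewrite NegzE mulrNz -pmulrn -{2}[t](subrK k.+1%:R) pn.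
Qed.

Lemma near_rep (t x : R) : exists2 t', gamma t' = gamma x & `|t' - t| <= 1 / 2.
Proof.
pose n := Num.floor (x - t + 1 / 2).
have /andP[n1 n2] := floor_itv (x - t + 1 / 2); rewrite -/n intrD in n1 n2.
exists (x + (- n)%:~R); first exact: gamma_int.
by rewrite mulrNz ler_norml; apply/andP; split; lra.
Qed.

Lemma gamma_inj t t' : gamma t = gamma t' -> `|t' - t| <= 1 / 2 -> t = t'.
Proof.
move=> gtt; rewrite ler_norml => /andP[h1 h2].
pose n := Num.floor t; pose n' := Num.floor t'.
have /andP[n1 n2] := floor_itv t; rewrite -/n intrD in n1 n2.
have /andP[n3 n4] := floor_itv t'; rewrite -/n' intrD in n3 n4.
have E : t - n%:~R = t' - n'%:~R.
  case: gammaJ => _ _ inj _; apply: inj.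
  - by rewrite in_itv /=; apply/andP; split; lra.
  - by rewrite in_itv /=; apply/andP; split; lra.
  by rewrite -!mulrNz !gamma_int.
have E2 : (n' - n)%:~R = t' - t by rewrite intrB; lra.
suff : n' - n = 0 by move=> n0; move: E2; rewrite n0; lra.
have k1 : (n' - n)%:~R < (1 : int)%:~R :> R by rewrite E2; lra.
have k2 : (-1 : int)%:~R < (n' - n)%:~R :> R by rewrite E2 mulrNz; lra.
rewrite !ltr_int in k1 k2; lia.
Qed.

Variables (v0 C : R).
Hypothesis cb : curve_bounds gamma v0 C.
Let I (t : R) := -3 <= t <= 3.
Let v00 : 0 < v0. Proof. by case: cb. Qed.
Let C1 : 1 <= C. Proof. by case: cb. Qed.
Let C0 : 0 <= C. Proof. exact: le_trans ler01 C1. Qed.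
Let vI t : I t -> v0 <= v t. Proof. by case: cb => _ _ h /h[]. Qed.

Lemma normc_continuous (z : R[i]) : {for z, continuous (@normc R)}.
Proof.
apply/(cvgrPdist_lt (FF := nbhs_filter z)) => e e0; apply/nbhs_normcP; exists e => // y.
apply: le_lt_trans; rewrite ler_norml.
have := normcB y (y - z); have := normcD (y - z) z.
rewrite subrK opprB subrKC; lra.
Qed.

(** For close parameters the chord is compared with the velocity; for the others
    compactness and injectivity bound it from below. *)
Lemma gamma_bilip : exists2 m, 0 < m & forall t t', I t -> I t' ->
  `|t' - t| <= 1 / 2 -> m * `|t' - t| <= normc (gamma t' - gamma t).
Proof.
pose dl := v0 / (8 * C).
have Cp : 0 < C by exact: lt_le_trans ltr01 C1.
have dl0 : 0 < dl by rewrite divr_gt0 // mulr_gt0.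
pose f (p : R * R) := normc (gamma (p.1 + p.2) - gamma p.1).
have cf (p : R * R) : {for p, continuous f}.
  have cg (q : R * R -> R) : {for p, continuous q} -> {for p, continuous (gamma \o q)}.
    by move=> cq; apply: (continuous_comp cq); exact: cont_gamma.
  have c1 := cg _ (@cvg_fst _ _ _ _ _ : {for p, continuous fst}).
  have c2 : {for p, continuous (fun q : R * R => q.1 + q.2)}.
    by apply: cvgD; [exact: cvg_fst|exact: cvg_snd].
  have c3 : {for p, continuous (fun q : R * R => gamma (q.1 + q.2) - gamma q.1)}.
    by apply: cvgB; [exact: (cg _ c2)|exact: c1].
  exact: (continuous_comp c3 (@normc_continuous _)).
have [m1 m10 m1P] : exists2 m1, 0 < m1 & forall t d, I t -> dl <= d <= 1 / 2 ->
    m1 <= normc (gamma (t + d) - gamma t).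
  have [dl2|dl2] := leP dl (1 / 2); last first.
    exists 1 => // t d _ /andP[d1 d2]; exfalso.
    by have := le_lt_trans (le_trans d1 d2) dl2; rewrite ltxx.
  pose D : set (R * R) := `[-3, 3] `*` `[dl, 1 / 2].
  have D0 : D !=set0.
    by exists (0, dl); split => /=; rewrite in_itv /=; apply/andP; split; lra.
  have Dc : compact D by apply: compact_setX; exact: segment_compact.
  have Df : {within D, continuous f}.
    by apply: continuous_subspaceT => p; exact: cf.
  have [[c d]] := compact_EVT_min D0 Dc Df.
  rewrite inE => -[/= cP0 dP0] fmin.
  have cP : -3 <= c <= 3 by move: cP0; rewrite in_itv.
  have dP : dl <= d <= 1 / 2 by move: dP0; rewrite in_itv.
  exists (f (c, d)).
    rewrite normc_gt0 subr_eq0; apply/eqP => /esym E.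
    have [d1 d2] := andP dP.
    have dp : 0 < d by exact: lt_le_trans d1.
    have /= cd : c + d - c = d by ring.
    have := gamma_inj E; rewrite cd ger0_norm ?(ltW dp) // => /(_ d2) /eqP.
    by rewrite -subr_eq0 opprD addrA subrr sub0r oppr_eq0 gt_eqF.
  move=> t s tI sP; apply: (fmin (t, s)).
  by rewrite inE; split => /=; rewrite in_itv.
have near t t' : I t -> I t' -> `|t' - t| <= dl ->
    v0 / 2 * `|t' - t| <= normc (gamma t' - gamma t).
  move=> tI tI' tdl; have h := taylor_gamma gammaJ cb tI tI'.
  have h2 := normc_tri 0 (gamma t' - gamma t) (gamma t' - gamma t - (t' - t)%:C * g1 t).
  have h3 : v0 * `|t' - t| <= normc ((t' - t)%:C * g1 t).
    by rewrite normcM normcR mulrC; apply: ler_wpM2l => //; exact: vI.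
  have h4 := normcB (gamma t' - gamma t) (gamma t' - gamma t - (t' - t)%:C * g1 t).
  rewrite subKr in h4.
  have h5 : 4 * C * `|t' - t| ^+ 2 <= v0 / 2 * `|t' - t|.
    rewrite expr2 mulrA; apply: ler_wpM2r => //.
    have -> : v0 / 2 = 4 * C * dl by rewrite /dl; field; rewrite gt_eqF.
    by apply: ler_wpM2l => //; rewrite mulr_ge0.
  by move: h h3 h4 h5; lra.
exists (Num.min (v0 / 2) m1); first by rewrite lt_min m10 divr_gt0.
move=> t t' tI tI' tt; have [tdl|tdl] := leP `|t' - t| dl.
  apply: le_trans (near _ _ tI tI' tdl); apply: ler_wpM2r => //.
  by rewrite ge_min lexx.
have far : m1 <= normc (gamma t' - gamma t).
  have [t0|t0] := leP t t'.
    have -> : t' = t + (t' - t) by ring.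
    apply: m1P => //; move: tt tdl; rewrite ger0_norm ?subr_ge0 // => -> /ltW ->.
    by [].
  have -> : gamma t' - gamma t = - (gamma (t' + (t - t')) - gamma t').
    by rewrite subrKC opprB.
  rewrite normcN; apply: m1P => //.
  have e : `|t' - t| = t - t' by rewrite distrC ger0_norm // subr_ge0 ltW.
  by rewrite -e tt ltW.
apply: le_trans far; rewrite -[leRHS]mulr1; apply: ler_pM => //.
- by rewrite le_min ltW ?divr_gt0 //= ltW.
- by rewrite ge_min lexx orbT.
- by apply: (le_trans tt); lra.
Qed.

Lemma ip_le (z w : R[i]) : `|ip z w| <= 2 * (normc z * normc w).
Proof.
apply: (le_trans (ler_normD _ _)); rewrite !normrM mulr2n mulrDl mul1r.
by apply: lerD; apply: ler_pM => //; rewrite ?Re_le_normc ?Im_le_normc.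
Qed.

(** The curve is tangent to second order to its tangent line, uniformly; this
    gives balls of a fixed radius touching the curve on either side. *)
Lemma curve_reach : exists2 K, 0 < K & forall t t', I t -> I t' ->
  `|t' - t| <= 1 / 2 ->
  `|ip ('i * T t) (gamma t' - gamma t)| <= K * normc (gamma t' - gamma t) ^+ 2.
Proof.
have [m m0 mP] := gamma_bilip.
have Cp : 0 < C by exact: lt_le_trans ltr01 C1.
exists (8 * C / m ^+ 2); first by rewrite divr_gt0 ?mulr_gt0 ?exprn_gt0.
move=> t t' tI tI' tt.
have -> : ip ('i * T t) (gamma t' - gamma t) =
   ip ('i * T t) (gamma t' - gamma t - (t' - t)%:C * g1 t).
  rewrite (g1E gammaJ t); move: (gamma t' - gamma t) (T t) (v t) => A B D.
  by rewrite /ip !cpx_simp; ring.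
apply: (le_trans (ip_le _ _)); rewrite normc_iM (normc_T gammaJ) mul1r.
apply: (le_trans (ler_wpM2l _ (taylor_gamma gammaJ cb tI tI'))) => //.
have h : (m * `|t' - t|) ^+ 2 <= normc (gamma t' - gamma t) ^+ 2.
  by apply: lerXn2r; rewrite ?nnegrE ?mulr_ge0 ?normc_ge0 ?(ltW m0) // mP.
have -> : 2 * (4 * C * `|t' - t| ^+ 2) = 8 * C / m ^+ 2 * (m * `|t' - t|) ^+ 2.
  by field; rewrite gt_eqF.
by apply: ler_wpM2l => //; rewrite divr_ge0 ?mulr_ge0 ?exprn_ge0 ?(ltW m0).
Qed.

(** In the expansion of the squared distance from [Phi t s] to a point of the
    curve, [curve_reach] absorbs the mixed term if [s] is small: the foot point
    is a nearest point of the curve. *)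
Lemma collar_dist : exists2 s0, 0 < s0 & forall t s x, -2 <= t <= 2 -> `|s| <= s0 ->
  `|s| <= normc (Phi t s - gamma x).
Proof.
have [K K0 KP] := curve_reach.
exists (1 / (2 * K)); first by rewrite divr_gt0 // mulr_gt0.
move=> t s x /andP[tI1 tI2] sK; have [t' <- tt] := near_rep t x.
have [a1 a2] : - (1/2) <= t' - t /\ t' - t <= 1/2 by apply/andP; rewrite -ler_norml.
have tI : I t by apply/andP; split; lra.
have tI' : I t' by apply/andP; split; lra.
have h := KP _ _ tI tI' tt.
set A := gamma t' - gamma t in h.
have nT : normc ('i * T t) ^+ 2 = 1 by rewrite normc_iM (normc_T gammaJ) expr1n.
have E : normc (Phi t s - gamma t') ^+ 2 =
    normc A ^+ 2 - 2 * (s * ip ('i * T t) A) + s ^+ 2.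
  have -> : Phi t s - gamma t' = s%:C * ('i * T t) - A.
    by rewrite /collar /A; move: (gamma t) (gamma t') (T t) => X Y Z; ring.
  have -> : s ^+ 2 = s ^+ 2 * normc ('i * T t) ^+ 2 by rewrite nT mulr1.
  move: ('i * T t) => B; rewrite !normc_sqr /ip.
  by rewrite !cpx_simp; ring.
have sA : 0 <= normc A ^+ 2 - 2 * (s * ip ('i * T t) A).
  rewrite subr_ge0; apply: (le_trans (ler_norm _)).
  rewrite normrM normrM (ger0_norm (ler0n _ _)).
  have h1 : `|s| * `|ip ('i * T t) A| <= 1 / (2 * K) * (K * normc A ^+ 2).
    by apply: ler_pM.
  have h2 : 1 / (2 * K) * (K * normc A ^+ 2) = normc A ^+ 2 / 2.
    by field; rewrite gt_eqF.
  by move: h1 h2; lra.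
rewrite -(@ler_pXn2r _ 2) ?nnegrE ?normc_ge0 // E real_normK ?num_real //.
by rewrite lerDr.
Qed.

(** Written in the frame at [t'], the increment is [v x + i y] with
    [x = t - t'] and [y = s - s'], up to an error which is a small multiple
    of [x]. *)
Lemma collar_bilip : exists2 dl, 0 < dl & exists2 m, 0 < m &
  forall t s t' s', I t -> I t' -> `|t - t'| <= dl -> `|s| <= dl ->
  m * (`|t - t'| + `|s - s'|) <= normc (Phi t s - Phi t' s').
Proof.
pose c := Num.min v0 1 / 2.
have c0 : 0 < c by rewrite divr_gt0 // lt_min v00 ltr01.
have Cp : 0 < C by exact: lt_le_trans ltr01 C1.
exists (c / 2 / (6 * C)); first by apply: divr_gt0; [exact: divr_gt0|exact: mulr_gt0].
exists (c / 2); first by rewrite divr_gt0.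
move=> t s t' s' tI tI' tt ss.
set x := t - t' in tt *; set y := s - s'.
have h1 := taylor_gamma gammaJ cb tI' tI; rewrite -/x in h1.
have h2 := lip_T gammaJ cb tI' tI; rewrite -/x in h2.
pose Z := (v t' * x)%:C + 'i * y%:C.
have ZE : Phi t s - Phi t' s' = Z * T t' + ((gamma t - gamma t' - x%:C * g1 t') +
    'i * s%:C * (T t - T t')).
  have e1 : (v t' * x)%:C = (v t')%:C * x%:C :> R[i] by rewrite rmorphM.
  have e2 : y%:C = s%:C - s'%:C :> R[i] by rewrite /y rmorphB.
  rewrite (g1E gammaJ t') /collar /Z e1 e2; move: (x%:C : R[i]) => X.
  by move: (gamma t) (gamma t') (T t) (T t') (v t') => a1 a2 a3 a4 a5; ring.
have Zl : c * (`|x| + `|y|) <= normc (Z * T t').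
  rewrite normcM (normc_T gammaJ) mulr1.
  have r1 := Re_le_normc Z; have r2 := Im_le_normc Z.
  have e1 : complex.Re Z = v t' * x by rewrite /Z !cpx_simp; ring.
  have e2 : complex.Im Z = y by rewrite /Z !cpx_simp; ring.
  rewrite e1 e2 normrM in r1 r2.
  have vp : Num.min v0 1 <= `|v t'|.
    by apply: le_trans (ler_norm _); apply: le_trans (vI tI'); rewrite ge_min lexx.
  have q1 : Num.min v0 1 * `|x| <= normc Z.
    by apply: le_trans r1; apply: ler_wpM2r.
  have q2 : Num.min v0 1 * `|y| <= normc Z.
    apply: le_trans r2; rewrite -[leRHS]mul1r; apply: ler_wpM2r => //.
    by rewrite ge_min lexx orbT.
  by rewrite /c; move: q1 q2; lra.
have err : normc ((gamma t - gamma t' - x%:C * g1 t') + 'i * s%:C * (T t - T t')) <=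
    c / 2 * `|x|.
  apply: (le_trans (normcD _ _)); rewrite normc_iR.
  have q1 : 4 * C * `|x| ^+ 2 <= 4 * C * (c / 2 / (6 * C) * `|x|).
    by apply: ler_wpM2l; rewrite ?mulr_ge0 // expr2; apply: ler_wpM2r.
  have q2 : `|s| * normc (T t - T t') <= c / 2 / (6 * C) * (2 * C * `|x|).
    by apply: ler_pM; rewrite ?normc_ge0.
  have q3 : 4 * C * (c / 2 / (6 * C) * `|x|) + c / 2 / (6 * C) * (2 * C * `|x|) =
    c / 2 * `|x| by field; rewrite gt_eqF.
  by move: h1 q1 q2 q3; lra.
have := normc_lowerD (Z * T t') ((gamma t - gamma t' - x%:C * g1 t') +
    'i * s%:C * (T t - T t')).
rewrite -ZE; have cy : 0 <= c * `|y| by rewrite mulr_ge0 // ltW.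
by move: Zl err; lra.
Qed.

(** At a nearest point of the curve the derivative of the squared distance
    vanishes, so [z] lies on the normal through that point. *)
Lemma nearest_point (z : R[i]) (t0 : R) : exists t s : R,
  [/\ `|t - t0| <= 1 / 2, z = Phi t s &
      forall x, `|s| <= normc (z - gamma x)].
Proof.
pose X t := complex.Re (gamma t - z); pose Y t := complex.Im (gamma t - z).
pose N t := X t ^+ 2 + Y t ^+ 2.
have NE t : N t = normc (z - gamma t) ^+ 2 by rewrite normcC normc_sqr.
have dNz t : rdiff (fun t => gamma t - z) t (g1 t - 0).
  apply: rdiffB; first exact: rdiff_gamma.
  move=> e e0; exists 1 => // s _; rewrite subrr mulr0 subr0 normc0.
  by rewrite mulr_ge0 // ltW.
have dN (t : R) : is_derive t 1 N (2 * (X t * complex.Re (g1 t) + Y t * complex.Im (g1 t))).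
  have /rdiff_ReIm[] := dNz t; rewrite subr0; exact: is_derive_sqsum.
have cN t : {for t, continuous N}.
  apply: differentiable_continuous; apply/derivable1_diffP.
  exact: (@ex_derive _ _ _ _ _ _ _ (dN t)).
have le0 : t0 - 1 / 2 <= t0 + 1 / 2 by lra.
have [t tP tmin] := EVT_min le0 (seg_within (fun t _ => cN t)).
have tt : `|t - t0| <= 1 / 2 by rewrite ler_distl; move: tP; rewrite in_itv.
have gmin x : N t <= N x.
  have [x' gx xx] := near_rep t0 x; have -> : N x = N x' by rewrite /N /X /Y gx.
  by apply: tmin; rewrite in_itv /= -ler_distl.
have le1 : t - 1 <= t + 1 by lra.
have crit : ip (gamma t - z) (g1 t) = 0.
  have dd u : u \in `]t - 1, t + 1[ -> derivable N u 1.
    by move=> _; exact: (@ex_derive _ _ _ _ _ _ _ (dN u)).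
  have tin : t \in `]t - 1, t + 1[ by rewrite in_itv /=; apply/andP; split; lra.
  have h := derive1_at_min le1 dd tin (fun u _ => gmin u).
  have d1 := @derive_val _ _ _ _ _ _ _ h; have d2 := @derive_val _ _ _ _ _ _ _ (dN t).
  by move: d1; rewrite d2 /ip -/(X t) -/(Y t); lra.
have orth : ip (gamma t - z) (T t) = 0.
  have E : ip (gamma t - z) (g1 t) = v t * ip (gamma t - z) (T t).
    rewrite (g1E gammaJ t); move: (gamma t - z) (T t) (v t) => A B D.
    by rewrite /ip !cpx_simp; ring.
  by apply/eqP; move/eqP: crit; rewrite E mulf_eq0 gt_eqF ?(speed_gt0 gammaJ).
pose s := ip (z - gamma t) ('i * T t).
have zE : z = Phi t s.
  have nT : complex.Re (T t) ^+ 2 + complex.Im (T t) ^+ 2 = 1.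
    by rewrite -normc_sqr (normc_T gammaJ) expr1n.
  rewrite /collar /s; move: nT orth; move: (gamma t) (T t) => A B nT orth.
  suff : z - A = 'i * (ip (z - A) ('i * B))%:C * B.
    by move=> <-; rewrite subrKC.
  have D : ip (z - A) B = 0.
    by rewrite -oppr0 -orth /ip !cpx_simp; ring.
  move: D; move: (z - A) => W; rewrite /ip => D.
  apply: complex_ext; rewrite !cpx_simp; move: nT D;
    move: (complex.Re B) (complex.Im B) => a b nT D.
    transitivity (complex.Re W * (a ^+ 2 + b ^+ 2) -
      a * (complex.Re W * a + complex.Im W * b)); last by ring.
    by rewrite nT D; ring.
  transitivity (complex.Im W * (a ^+ 2 + b ^+ 2) -
      b * (complex.Re W * a + complex.Im W * b)); last by ring.
  by rewrite nT D; ring.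
exists t, s; split => // x.
have -> : `|s| = normc (z - gamma t).
  rewrite {1}zE /collar addrAC subrr add0r normc_iR (normc_T gammaJ); exact/esym/mulr1.
rewrite -(@ler_pXn2r _ 2) ?nnegrE ?normc_ge0 // -!NE; exact: gmin.
Qed.

End Geometry.

(** * The two sides of the curve *)

Section Sides.
Context {R : realType}.
Variables (Omega : set R[i]) (gamma : R -> R[i]).
Hypothesis hOmega : smooth_jordan_domain Omega gamma.

Local Notation Phi := (collar gamma).

Lemma domain_curve : smooth_jordan_curve gamma.
Proof. by case: hOmega. Qed.

Let oO : open Omega. Proof. by case: hOmega => -[]. Qed.

Lemma boundaryE z : boundary Omega z <-> exists x, gamma x = z.
Proof.
case: hOmega => _ _ _ <- _; split => [[x _ <-]|[x <-]]; first by exists x.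
by exists x.
Qed.

Lemma closure_normcP (A : set R[i]) z : closure A z <->
  forall e, 0 < e -> exists2 y, A y & normc (y - z) < e.
Proof.
split=> [cA e e0|h B /nbhs_normcP[e e0 eB]].
  have [|y [Ay yB]] := cA [set y | normc (y - z) < e].
    by apply/nbhs_normcP; exists e.
  by exists y.
by have [y Ay /eB] := h e e0; exists y.
Qed.

Lemma closure_domain z : closure Omega z -> Omega z \/ boundary Omega z.
Proof.
move=> cz; have [Oz|nOz] := pselect (Omega z); first by left.
by right; split => // /interior_subset.
Qed.

(** [Omega] and the complement of its closure are open, so membership in [Omega]
    is locally constant along a path avoiding the boundary. *)
Lemma path_stay (c : R -> R[i]) (x y : R) : x <= y ->
  (forall u, x <= u <= y -> {for u, continuous c}) ->
  (forall u, x <= u <= y -> ~ boundary Omega (c u)) ->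
  Omega (c x) <-> Omega (c y).
Proof.
move=> xy cc nb; apply: (@segment_induction _ (fun u => Omega (c u))) => // u uP.
have /ccontP cu := cc u uP.
have [Ou|nOu] := pselect (Omega (c u)).
  have [e e0 eO] := (open_normcP _).1 oO _ Ou.
  by have [d d0 dP] := cu e e0; exists d => // u' /dP/eO.
have ncl : ~ closure Omega (c u) by move=> /closure_domain[//|]; exact: nb.
have [e e0 eO] : exists2 e, 0 < e & forall y, normc (y - c u) < e -> ~ Omega y.
  apply: contrapT => H; apply: ncl; apply/closure_normcP => e e0.
  apply: contrapT => H'; apply: H; exists e => // w we Ow; apply: H'; by exists w.
by have [d d0 dP] := cu e e0; exists d => // u' /dP/eO.
Qed.

Lemma cont_collar_s t s : {for s, continuous (Phi t)}.
Proof. exact: rdiff_continuous (collar_ds gamma t s). Qed.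

Lemma cont_collar_t t s : {for t, continuous (fun t => Phi t s)}.
Proof. exact: rdiff_continuous (collar_dt domain_curve t s). Qed.

Lemma domain_bounded : exists M, forall z, Omega z -> normc z <= M.
Proof.
case: hOmega => -[_ _ _ [M [Mr MP]]] _ _ _ _.
exists (complex.Re (M + 1)) => z Oz.
have MM : M < M + 1 by rewrite ltrDl.
have h : (normc z)%:C <= M + 1 := MP _ MM z Oz.
by move: h; rewrite lecE => /andP[].
Qed.

(** The inner side of the collar lies in the domain and the outer side does
    not meet it: otherwise both sides would lie in the domain, whose closure
    would then be open. *)
Lemma collar_sides : exists2 s0, 0 < s0 &
  forall t, -2 <= t <= 2 -> [/\ (forall s, 0 < s -> s < s0 -> Omega (Phi t s)),
   (forall s, - s0 < s -> s <= 0 -> ~ Omega (Phi t s)) &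
   (forall s x, `|s| <= s0 -> `|s| <= normc (Phi t s - gamma x))].
Proof.
have gJ := domain_curve.
have [v0 [C cb]] := curve_bounds_exist gJ.
have [s0 s00 dist] := collar_dist gJ cb.
exists s0 => //.
have nb t s : -2 <= t <= 2 -> `|s| <= s0 -> s != 0 -> ~ boundary Omega (Phi t s).
  move=> tP sP sn /boundaryE[x xE]; have := dist t s x tP sP.
  by rewrite xE subrr normc0 normr_le0; exact/negP.
have inner t s : -2 <= t <= 2 -> 0 < s -> s < s0 -> Omega (Phi t s).
  move=> tP sp ss0; case: hOmega => _ _ _ _ /(_ t).
  rewrite near_withinE => /nbhs_ballP[d /= d0 dP].
  pose x := Num.min (d / 2) s.
  have x0 : 0 < x by rewrite lt_min divr_gt0.
  have xs : x <= s by rewrite ge_min lexx orbT.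
  have xd : x <= d / 2 by rewrite ge_min lexx.
  have Ox : Omega (Phi t x).
    apply: dP => //; rewrite /ball /= sub0r normrN gtr0_norm //.
    by move: xd d0; lra.
  apply: ((path_stay xs _ _).1 Ox) => u /andP[u1 u2].
    exact: cont_collar_s.
  have u0 : 0 < u by exact: lt_le_trans u1.
  apply: nb => //; last by rewrite gt_eqF.
  by rewrite gtr0_norm // ltW // (le_lt_trans u2).
have zero t : ~ Omega (Phi t 0).
  have -> : Phi t 0 = gamma t by rewrite /collar rmorph0 mulr0 mul0r addr0.
  have : boundary Omega (gamma t) by apply/boundaryE; exists t.
  by case=> _; rewrite (interior_id _).1.
have outer t s : -2 <= t <= 2 -> - s0 < s -> s < 0 -> ~ Omega (Phi t s).
  move=> tP s1 s2 Os.
  have step1 t' : -2 <= t' <= 2 -> Omega (Phi t' s).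
    move=> t'P; have [tt|tt] := leP t t'.
      apply: ((path_stay (c := fun t => Phi t s) tt _ _).1 Os) => u /andP[u1 u2].
        exact: cont_collar_t.
      apply: nb; [|by rewrite ltr0_norm //; lra|by rewrite lt_eqF].
      by move: tP t'P u1 u2; lra.
    apply: ((path_stay (c := fun t => Phi t s) (ltW tt) _ _).2 Os) => u /andP[u1 u2].
      exact: cont_collar_t.
    apply: nb; [|by rewrite ltr0_norm //; lra|by rewrite lt_eqF].
    by move: tP t'P u1 u2; lra.
  have step2 t' s' : -2 <= t' <= 2 -> - s0 < s' -> s' < 0 -> Omega (Phi t' s').
    move=> t'P s'1 s'2; have [tt|tt] := leP s s'.
      apply: ((path_stay (c := Phi t') tt _ _).1 (step1 _ t'P)) => u /andP[u1 u2].
        exact: cont_collar_s.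
      by apply: nb => //; [rewrite ltr0_norm; lra|rewrite lt_eqF; lra].
    apply: ((path_stay (c := Phi t') (ltW tt) _ _).2 (step1 _ t'P)) => u /andP[u1 u2].
      exact: cont_collar_s.
    by apply: nb => //; [rewrite ltr0_norm; lra|rewrite lt_eqF; lra].
  have bcl p : boundary Omega p -> closure Omega p by case.
  have copen p : closure Omega p ->
      exists2 e, 0 < e & forall z, normc (z - p) < e -> closure Omega z.
    move=> /closure_domain[Op|bp].
      have [e e0 eO] := (open_normcP _).1 oO _ Op; exists e => // z /eO.
      exact: subset_closure.
    have /boundaryE[x xE] := bp; have [u uE u2] := near_rep gJ 0 x.
    exists s0 => // z zp.
    have [tau [sig [tu zE smin]]] := nearest_point gJ z u.
    have sig0 : `|sig| < s0 by apply: le_lt_trans (smin u) _; rewrite uE xE.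
    have tP' : -2 <= tau <= 2.
      move: u2 tu; rewrite subr0 !ler_norml => /andP[a1 a2] /andP[a3 a4].
      by apply/andP; split; lra.
    move: sig0; rewrite ltr_norml => /andP[g1 g2].
    have [sn|sp|sz] := ltgtP sig 0.
    - by rewrite zE; apply: subset_closure; exact: step2.
    - by rewrite zE; apply: subset_closure; exact: inner.
    - apply: bcl; apply/boundaryE; exists tau.
      by rewrite zE sz /collar rmorph0 mulr0 mul0r addr0.
  (* The closure being open and closed, it contains the whole ray issued from a
     point of the domain, which is bounded. *)
  have [M MP] := domain_bounded.
  have [q Oq] : Omega !=set0 by case: hOmega => -[].
  pose y := `|M| + 2 + normc q.
  have y0 : 0 <= y by rewrite addr_ge0 ?normc_ge0 // addr_ge0.
  have loc u : 0 <= u <= y -> exists2 e, 0 < e & forall u', `|u' - u| < e ->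
      (closure Omega (q + u'%:C) <-> closure Omega (q + u%:C)).
    have sub (u' : R) : q + u'%:C - (q + u%:C) = (u' - u)%:C.
      by rewrite opprD addrACA subrr add0r rmorphB.
    move=> _; have [cu|ncu] := pselect (closure Omega (q + u%:C)).
      have [e e0 eP] := copen _ cu; exists e; first exact: e0.
      move=> u' uu; split=> [_|_]; first exact: cu.
      by apply: eP; rewrite sub normcR; exact: uu.
    have [e e0 eP] : exists2 e, 0 < e &
        forall z, normc (z - (q + u%:C)) < e -> ~ closure Omega z.
      have : open (~` closure Omega) by apply: closed_openC; exact: closed_closure.
      by move=> /open_normcP/(_ _ ncu).
    exists e; first exact: e0.
    move=> u' uu; split=> cl; exfalso; last exact: ncu cl.
    by apply: eP cl; rewrite sub normcR; exact: uu.
  have cq0 : closure Omega (q + (0 : R)%:C).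
    by rewrite rmorph0 addr0; exact: subset_closure.
  have := (segment_induction y0 loc).1 cq0.
  move=> /closure_normcP/(_ 1 ltr01)[w /MP Mw wq].
  have h1 := normc_tri w (q + y%:C) q.
  have h2 := normcD w (- q).
  have h3 : normc (q + y%:C - q) = y.
    by rewrite addrAC subrr add0r normcR ger0_norm.
  rewrite normcN in h2; rewrite normcC in wq; rewrite h3 in h1.
  have := ler_norm M; rewrite /y in h1; lra.
move=> t tP; split.
- by move=> s; exact: inner.
- move=> s s1; rewrite le_eqVlt => /predU1P[->|s2]; first exact: zero.
  exact: outer.
- by move=> s x; exact: dist.
Qed.

End Sides.

(** * Cauchy's formula up to the boundary *)

Section L2L1.
Context {R : realType}.
Local Notation mu := (@lebesgue_measure R).

Lemma l1_le (D : R -> R[i]) t : l1 D t <= 2 * normc (D t).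
Proof.
rewrite mulr2n mulrDl mul1r; apply: lerD; [exact: Re_le_normc|exact: Im_le_normc].
Qed.

(** The inequality [2 N <= lam + N ^ 2 / lam] with a free parameter plays the role
    of the Cauchy-Schwarz inequality: a small square integral [eta] and a
    suitable [lam] give a small integral. *)
Lemma L2_l1 (D : R -> R[i]) (v : R -> R) (a b v0 lam eta : R) : a <= b ->
  measurable_fun (`[a, b] : set (measurableTypeR R)) (fun t => complex.Re (D t)) ->
  measurable_fun (`[a, b] : set (measurableTypeR R)) (fun t => complex.Im (D t)) ->
  measurable_fun (`[a, b] : set (measurableTypeR R)) v ->
  0 < v0 -> (forall t, a <= t <= b -> v0 <= v t) -> 0 < lam ->
  (\int[mu]_(t in `[a, b]) (normc (D t) ^+ 2 * v t)%:E <= eta%:E)%E ->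
  cintegrable a b D /\
  \int[mu]_(t in `[a, b]) l1 D t <= lam * (b - a) + eta / (lam * v0).
Proof.
move=> ab mR mI mv v00 vv lam0 hI.
pose q t := normc (D t) ^+ 2 * v t.
have q0 t : a <= t <= b -> 0 <= q t.
  by move=> /vv h; apply: mulr_ge0; [exact: sqr_ge0|exact: le_trans (ltW v00) h].
have mq : measurable_fun (`[a, b] : set (measurableTypeR R)) q.
  apply: measurable_funM => //.
  rewrite (_ : (fun t => _) = (fun t => complex.Re (D t) * complex.Re (D t) +
     complex.Im (D t) * complex.Im (D t))); last first.
    by apply/funext => t; rewrite normc_sqr !expr2.
  by apply: measurable_funD; apply: measurable_funM.
have iq : mu.-integrable `[a, b] (fun t => (q t)%:E).
  apply/integrableP; split; first by apply/measurable_EFinP.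
  apply: (@le_lt_trans _ _ eta%:E); last exact: ltry.
  apply: le_trans hI; rewrite le_eqVlt; apply/orP; left; apply/eqP.
  apply: eq_integral => t; rewrite inE /= in_itv /= => tP.
  by rewrite ger0_norm // q0.
pose g t := lam + (lam * v0)^-1 * q t.
have ig : mu.-integrable `[a, b] (fun t => (g t)%:E).
  by apply: rintegrableD; [exact: integrable_cst_itv|exact: rintegrableZ].
have lv0 : 0 < lam * v0 by exact: mulr_gt0.
have bnd t : a <= t <= b -> l1 D t <= g t.
  move=> tP; apply: (le_trans (l1_le _ _)); rewrite /g.
  set N := normc (D t).
  apply: (@le_trans _ _ (lam + N ^+ 2 / lam)).
    rewrite -subr_ge0; have -> : lam + N ^+ 2 / lam - 2 * N = (lam - N) ^+ 2 / lam.
      by field; rewrite gt_eqF.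
    by rewrite divr_ge0 ?sqr_ge0 // ltW.
  rewrite lerD2l /q -/N ler_pdivlMl //.
  have -> : lam * v0 * (N ^+ 2 / lam) = N ^+ 2 * v0 by field; rewrite gt_eqF.
  by apply: ler_wpM2l; [exact: sqr_ge0|exact: vv].
have RI (f : R -> R) : measurable_fun (`[a, b] : set (measurableTypeR R)) f ->
    (forall t, `|f t| <= l1 D t) -> mu.-integrable `[a, b] (fun t => (f t)%:E).
  move=> mf fl; apply: (le_integrable (measurable_seg a b) _ _ ig).
    by apply/measurable_EFinP.
  move=> t /=; rewrite in_itv /= => tP; rewrite lee_fin.
  by apply: (le_trans (fl t)); apply: le_trans (ler_norm _); exact: bnd.
have iD : cintegrable a b D.
  by split; apply: RI => // t; rewrite /l1 ?lerDl ?lerDr.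
split => //.
apply: (le_trans (le_Rintegral (measurable_seg a b) (l1_integrable iD) ig _)).
  by move=> t /=; rewrite in_itv /=; exact: bnd.
rewrite RintegralD; [|exact: measurable_seg|exact: integrable_cst_itv|exact: rintegrableZ].
rewrite RintegralZl; [|exact: measurable_seg|exact: iq].
rewrite Rintegral_cst_itv // lerD2l mulrC; apply: ler_wpM2r.
  by rewrite invr_ge0 ltW.
have fq : (\int[mu]_(t in `[a, b]) (q t)%:E)%E \is a fin_num.
  apply: integrable_fin_num iq; exact: measurable_seg.
by rewrite -lee_fin /Rintegral fineK.
Qed.

End L2L1.

Section LocalCauchy.
Context {R : realType}.
Local Notation mu := (@lebesgue_measure R).
Variables (Omega : set R[i]) (gamma : R -> R[i]) (h u : R[i] -> R[i]).
Variables (z0 la lb : R[i]) (r a b sg rho m v0 C : R).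

Local Notation g1 := (cderiv gamma).
Local Notation v := (speed gamma).
Local Notation T := (tangent gamma).
Local Notation Phi := (collar gamma).

Hypothesis gJ : smooth_jordan_curve gamma.
Hypothesis cb : curve_bounds gamma v0 C.
Hypothesis ab : a < b.
Hypothesis a1 : -1 <= a.
Hypothesis b1 : b <= 1.
Hypothesis sg0 : 0 < sg.
Hypothesis sg1 : sg <= 1.
Hypothesis inO : forall t s, a <= t <= b -> 0 < s <= sg ->
  Omega (Phi t s) /\ normc (Phi t s - z0) < r.
Hypothesis m0 : 0 < m.
Hypothesis bil : forall t s t' s', a <= t <= b -> a <= t' <= b ->
  0 <= s <= sg -> 0 <= s' <= sg ->
  m * (`|t - t'| + `|s - s'|) <= normc (Phi t s - Phi t' s').
Hypothesis jac : forall t s, a <= t <= b -> 0 <= s <= sg -> 0 < v t - s * curv gamma t.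
Hypothesis rho0 : 0 < rho.
Hypothesis far : forall z t s, normc (z - z0) < 3 * rho -> a <= t <= b -> 0 <= s <= sg ->
  [\/ t = a, t = b | s = sg] -> rho <= normc (Phi t s - z).
Hypothesis hh : holomorphic_on (disc z0 r `&` Omega) h.
Hypothesis lim_a : forall e, 0 < e -> exists2 d, 0 < d & forall s, 0 < s -> s < d ->
  normc (h (Phi a s) - la) < e.
Hypothesis lim_b : forall e, 0 < e -> exists2 d, 0 < d & forall s, 0 < s -> s < d ->
  normc (h (Phi b s) - lb) < e.
Hypothesis meas_Re : measurable_fun (`[a, b] : set (measurableTypeR R))
  (fun t => complex.Re (u (gamma t))).
Hypothesis meas_Im : measurable_fun (`[a, b] : set (measurableTypeR R))
  (fun t => complex.Im (u (gamma t))).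
Hypothesis L2lim : forall e, 0 < e -> exists2 d, 0 < d & forall s, 0 < s -> s < d ->
  (\int[mu]_(t in `[a, b]) (normc (h (Phi t s) - u (gamma t)) ^+ 2 * v t)%:E <= e%:E)%E.

Let I t : a <= t <= b -> -3 <= t <= 3.
Proof. by move=> /andP[t1 t2]; apply/andP; split; move: a1 b1; lra. Qed.

Let abW : a <= b. Proof. exact: ltW. Qed.

Lemma h_cdiff t s : a <= t <= b -> 0 < s <= sg -> exists l, cdiff h (Phi t s) l.
Proof.
move=> tP sP; have [Oz dz] := inO tP sP.
by apply/derivable_cdiffP; apply: hh; split => //; apply/discE.
Qed.

Lemma h_cont t s : a <= t <= b -> 0 < s <= sg -> {for Phi t s, continuous h}.
Proof. by move=> tP sP; have [l] := h_cdiff tP sP; exact: cdiff_continuous. Qed.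

Lemma cont_hPhi_t t s : a <= t <= b -> 0 < s <= sg ->
  {for t, continuous (fun t => h (Phi t s))}.
Proof.
move=> tP sP; apply: (ccont_comp (c := fun t => Phi t s)); last exact: h_cont.
exact: rdiff_continuous (collar_dt gJ t s).
Qed.

Lemma cont_hPhi_s t s : a <= t <= b -> 0 < s <= sg ->
  {for s, continuous (fun s => h (Phi t s))}.
Proof.
move=> tP sP; apply: (ccont_comp (c := Phi t)); last exact: h_cont.
exact: rdiff_continuous (collar_ds gamma t s).
Qed.

Let vv t : a <= t <= b -> v0 <= v t.
Proof. by move=> /I h1; case: cb => _ _ /(_ t h1)[]. Qed.

Let v00 : 0 < v0. Proof. by case: cb. Qed.

Let mcont (f : R -> R) : (forall t, a <= t <= b -> {for t, continuous f}) ->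
  measurable_fun (`[a, b] : set (measurableTypeR R)) f.
Proof.
by move=> cf; apply/measurable_EFinP; exact: (measurable_int mu (rcont_integrable cf)).
Qed.

Let mv : measurable_fun (`[a, b] : set (measurableTypeR R)) v.
Proof. by apply: mcont => t _; exact: cont_speed. Qed.

Lemma diff_l1 s lam eta : 0 < s <= sg -> 0 < lam ->
  (\int[mu]_(t in `[a, b]) (normc (h (Phi t s) - u (gamma t)) ^+ 2 * v t)%:E <= eta%:E)%E ->
  cintegrable a b (fun t => h (Phi t s) - u (gamma t)) /\
  \int[mu]_(t in `[a, b]) l1 (fun t => h (Phi t s) - u (gamma t)) t <=
    lam * (b - a) + eta / (lam * v0).
Proof.
move=> sP lam0 hI; apply: (L2_l1 abW _ _ mv v00 vv lam0 hI).
  rewrite (_ : (fun t => _) = fun t => complex.Re (h (Phi t s)) - complex.Re (u (gamma t))).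
    apply: measurable_funB => //; apply: mcont => t tP.
    by have /ccont_ReIm[] := cont_hPhi_t tP sP.
  by apply/funext => t; rewrite cReD cReN.
rewrite (_ : (fun t => _) = fun t => complex.Im (h (Phi t s)) - complex.Im (u (gamma t))).
  apply: measurable_funB => //; apply: mcont => t tP.
  by have /ccont_ReIm[] := cont_hPhi_t tP sP.
by apply/funext => t; rewrite cImD cImN.
Qed.

(** The boundary function differs from the continuous function [h] on a parallel
    arc by a square integrable function. *)
Lemma u_integrable : cintegrable a b (fun t => u (gamma t)).
Proof.
have [d d0 dP] := L2lim ltr01.
pose s := Num.min (d / 2) sg.
have s0 : 0 < s by rewrite lt_min divr_gt0.
have sd : s < d by rewrite gt_min; apply/orP; left; rewrite ltr_pdivrMr // ltr_pMr // ltr1n.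
have sP : 0 < s <= sg by rewrite s0 ge_min lexx orbT.
have [i1 _] := diff_l1 sP ltr01 (dP s s0 sd).
have i2 : cintegrable a b (fun t => h (Phi t s)).
  by apply: ccont_cintegrable => t tP; exact: cont_hPhi_t.
apply: eq_cintegrable (cintegrableB i2 i1) => t _.
by rewrite opprB subrKC.
Qed.

Lemma diff_l1_small e : 0 < e -> exists2 d, 0 < d & forall s, 0 < s -> s < d ->
  s <= sg -> cintegrable a b (fun t => h (Phi t s) - u (gamma t)) /\
  \int[mu]_(t in `[a, b]) l1 (fun t => h (Phi t s) - u (gamma t)) t <= e.
Proof.
move=> e0; have bap : 0 < b - a by rewrite subr_gt0.
pose lam := e / 2 / (b - a); have lam0 : 0 < lam by rewrite !divr_gt0.
pose eta := e / 2 * (lam * v0).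
have lv : 0 < lam * v0 by exact: mulr_gt0.
have eta0 : 0 < eta by rewrite mulr_gt0 // divr_gt0.
have [d d0 dP] := L2lim eta0; exists d => // s s0 sd sS.
have sP : 0 < s <= sg by rewrite s0.
have [i1 i2] := diff_l1 sP lam0 (dP s s0 sd); split => //.
apply: (le_trans i2); rewrite le_eqVlt; apply/orP; left; apply/eqP.
by rewrite /eta /lam; field; rewrite !gt_eqF.
Qed.

(** The limit as value on the curve makes [h] continuous along the normal, so the
    sides of the rectangle can be followed down to the curve. *)
Definition side_h (x : R) (l : R[i]) (s : R) : R[i] :=
  if s <= 0 then l else h (Phi x s).

Lemma side_h_cont x l s : a <= x <= b -> 0 <= s <= sg ->
  (forall e, 0 < e -> exists2 d, 0 < d & forall s, 0 < s -> s < d ->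
     normc (h (Phi x s) - l) < e) ->
  {for s, continuous (side_h x l)}.
Proof.
move=> xP /andP[s0 sS] liml; have [sz|sn] := eqVneq s 0.
  apply/ccontP => e e0; have [d d0 dP] := liml e e0; exists d => // y.
  rewrite sz subr0 /side_h lexx; case: (leP y 0) => y0 yd.
    by rewrite subrr normc0.
  by apply: dP => //; move: yd; rewrite gtr0_norm.
have sp : 0 < s by rewrite lt_def sn.
have sP : 0 < s <= sg by rewrite sp.
have /ccontP hc := cont_hPhi_s xP sP.
apply/ccontP => e e0; have [d d0 dP] := hc e e0.
exists (Num.min d s); first by rewrite lt_min d0.
move=> y; rewrite lt_min => /andP[yd ys].
have y0 : 0 < y by move: ys; rewrite ltr_norml => /andP[]; lra.
by rewrite /side_h !leNgt y0 sp /=; exact: dP.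
Qed.

Definition w_bottom (t : R) : R[i] := u (gamma t) * g1 t.
Definition w_top (t : R) : R[i] := h (Phi t sg) * collar_t gamma t sg.
Definition w_side (x : R) (l : R[i]) (s : R) : R[i] :=
  side_h x l s * collar_s gamma x s.

Lemma w_bottom_integrable : cintegrable a b w_bottom.
Proof. by apply: (cintegrableM u_integrable) => t _; exact: cont_g1. Qed.

Lemma w_top_integrable : cintegrable a b w_top.
Proof.
apply: ccont_cintegrable => t tP; apply: ccontM.
  by apply: cont_hPhi_t => //; rewrite sg0 /=.
exact: (cont_collar_dt gJ).
Qed.

Lemma w_side_integrable x l : a <= x <= b ->
  (forall e, 0 < e -> exists2 d, 0 < d & forall s, 0 < s -> s < d ->
     normc (h (Phi x s) - l) < e) ->
  cintegrable 0 sg (w_side x l).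
Proof.
move=> xP liml; apply: ccont_cintegrable => s sP; apply: ccontM.
  exact: side_h_cont.
exact: ccont_cst.
Qed.

(** The part of the boundary of the collar rectangle that lies inside the
    domain. *)
Definition inner_int (n : nat) (z : R[i]) : R[i] :=
  cauchy_int 0 sg (w_side b lb) (Phi b) n z -
  cauchy_int a b w_top (fun t => Phi t sg) n z -
  cauchy_int 0 sg (w_side a la) (Phi a) n z.

Let mul_sub3 (N A1 A2 A3 : R[i]) :
  N * (A1 - A2 - A3) = N * A1 + -1 * (N * A2) + -1 * (N * A3).
Proof. ring. Qed.

Let sub3E (A1 A2 A3 : R[i]) : A1 - A2 - A3 = A1 + -1 * A2 + -1 * A3.
Proof. ring. Qed.

Lemma inner_int_cdiff n z : normc (z - z0) < 3 * rho ->
  cdiff (inner_int n) z (n%:R * inner_int n.+1 z).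
Proof.
move=> zP.
have aP : a <= a <= b by rewrite lexx.
have bP : a <= b <= b by rewrite lexx andbT.
have sP : 0 <= sg <= sg by rewrite lexx ltW.
have c1 : cdiff (cauchy_int 0 sg (w_side b lb) (Phi b) n) z
    (n%:R * cauchy_int 0 sg (w_side b lb) (Phi b) n.+1 z).
  apply: (cauchy_int_cdiff n (w_side_integrable bP lim_b) _ rho0).
    by move=> s _; exact: cont_collar_s.
  by move=> s sP'; apply: far => //; apply: Or32.
have c2 : cdiff (cauchy_int a b w_top (fun t => Phi t sg) n) z
    (n%:R * cauchy_int a b w_top (fun t => Phi t sg) n.+1 z).
  apply: (cauchy_int_cdiff n w_top_integrable _ rho0).
    by move=> t _; exact: rdiff_continuous (collar_dt gJ t sg).
  by move=> t tP; apply: far => //; apply: Or33.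
have c3 : cdiff (cauchy_int 0 sg (w_side a la) (Phi a) n) z
    (n%:R * cauchy_int 0 sg (w_side a la) (Phi a) n.+1 z).
  apply: (cauchy_int_cdiff n (w_side_integrable aP lim_a) _ rho0).
    by move=> s _; exact: cont_collar_s.
  by move=> s sP'; apply: far => //; apply: Or31.
have -> : n%:R * inner_int n.+1 z =
  n%:R * cauchy_int 0 sg (w_side b lb) (Phi b) n.+1 z +
  -1 * (n%:R * cauchy_int a b w_top (fun t => Phi t sg) n.+1 z) +
  -1 * (n%:R * cauchy_int 0 sg (w_side a la) (Phi a) n.+1 z).
  exact: mul_sub3.
have -> : inner_int n = (fun y => cauchy_int 0 sg (w_side b lb) (Phi b) n y +
   -1 * cauchy_int a b w_top (fun t => Phi t sg) n y +
   -1 * cauchy_int 0 sg (w_side a la) (Phi a) n y).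
  apply/funext => y; exact: sub3E.
exact: (cdiffD (cdiffD c1 (cdiffZ (-1) c2)) (cdiffZ (-1) c3)).
Qed.

Lemma inner_int_bound : exists B, forall z, normc (z - z0) < 2 * rho ->
  normc (inner_int 1 z) <= B.
Proof.
eexists => z zP; rewrite /inner_int; apply: (le_trans (normcB _ _)).
have aP : a <= a <= b by rewrite lexx.
have bP : a <= b <= b by rewrite lexx andbT.
have sP : 0 <= sg <= sg by rewrite lexx ltW.
have z3 : normc (z - z0) < 3 * rho by move: rho0; lra.
apply: lerD; first apply: (le_trans (normcB _ _)); first apply: lerD.
- apply: (cauchy_int_bound (w_side_integrable bP lim_b) _ rho0).
    by move=> s _; exact: cont_collar_s.
  by move=> s sP'; apply: far => //; apply: Or32.
- apply: (cauchy_int_bound w_top_integrable _ rho0).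
    by move=> t _; exact: rdiff_continuous (collar_dt gJ t sg).
  by move=> t tP; apply: far => //; apply: Or33.
- apply: (cauchy_int_bound (w_side_integrable aP lim_a) _ rho0).
    by move=> s _; exact: cont_collar_s.
  by move=> s sP'; apply: far => //; apply: Or31.
Qed.

Section AtPoint.
Variables t1 s1 : R.
Hypothesis t1P : a < t1 < b.
Hypothesis s1P : 0 < s1 < sg.
Local Notation z := (Phi t1 s1).

Let t1ab : a <= t1 <= b. Proof. by case/andP: t1P => *; rewrite !ltW. Qed.
Let s1sg : 0 <= s1 <= sg. Proof. by case/andP: s1P => *; rewrite !ltW. Qed.

Let low t s : a <= t <= b -> 0 <= s <= sg ->
  m * (`|t - t1| + `|s - s1|) <= normc (Phi t s - z).
Proof. by move=> tP sP; exact: bil. Qed.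

Let kneq t s : a <= t <= b -> 0 <= s <= sg -> 0 < `|t - t1| + `|s - s1| ->
  Phi t s - z != 0.
Proof.
move=> tP sP d0; rewrite -normc_gt0; apply: lt_le_trans (low tP sP).
exact: mulr_gt0.
Qed.

(** The rectangle lifted off the curve lies in the domain of [h]. *)
Lemma rectint_collar e : 0 < e -> e < s1 ->
  rectint Phi (collar_t gamma) (collar_s gamma) (fun w => h w / (w - z)) a b e sg =
  h z * ('i * (2 * pi)%:C).
Proof.
move=> e0 es; have [s10 s1s] := andP s1P.
(* the ratio of the lengths of the two partial derivatives *)
pose k := (v t1 - s1 * curv gamma t1)^-1.
have J0 := jac t1ab s1sg.
have PsE : collar_s gamma t1 s1 = 'i * k%:C * collar_t gamma t1 s1.
  rewrite (collar_tE gJ) /collar_s; move: (T t1) => X.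
  rewrite mulrA -(mulrA 'i) (_ : k%:C * _%:C = 1) ?mulr1 //.
  by rewrite -(rmorphM (real_complex R)) /k mulVf ?gt_eqF.
have ce : -1 <= e by lra.
have a3 : -3 <= a by move: a1; lra.
have b3 : b <= 3 by move: b1; lra.
have sP1 : e < s1 < sg by rewrite es.
have k0 : 0 < k by rewrite invr_gt0.
have Pt0 : collar_t gamma t1 s1 != 0.
  by rewrite (collar_tE gJ) -normc_gt0 normcM normcR (normc_T gJ) mulr1 gtr0_norm.
apply: (cauchy_patch (collar_patch gJ cb a3 b3 ce sg1)
   t1P sP1 k0 PsE Pt0 m0 _ (collar_taylor gJ PsE)).
- by move=> t s tP /andP[h1 h2]; apply: low => //; apply/andP; split; lra.
- move=> t s tP /andP[h1 h2]; apply: h_cdiff => //; apply/andP; split; lra.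
Qed.

Let ker_low t s : a <= t <= b -> 0 <= s <= s1 / 2 -> m * (s1 / 2) * 1 <= normc (Phi t s - z).
Proof.
move=> tP /andP[h1 h2]; have [s10 s1s] := andP s1P.
have sP : 0 <= s <= sg by apply/andP; split; lra.
apply: le_trans (low tP sP); rewrite mulr1; apply: ler_wpM2l; first exact: ltW.
have := normr_ge0 (t - t1); rewrite (ler0_norm (x := s - s1)); lra.
Qed.

(** Sliding the base curve inwards changes the Cauchy kernel by [O(e)]. *)
Lemma kernel_slide : exists2 B, 0 <= B & forall e : R, 0 <= e -> e <= s1 / 2 ->
  forall t, a <= t <= b ->
  normc (collar_t gamma t e / (Phi t e - z)) <= B /\
  normc (g1 t / (gamma t - z) - collar_t gamma t e / (Phi t e - z)) <= B * e.
Proof.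
have [s10 s1s] := andP s1P.
pose m1 := m * (s1 / 2); have m10 : 0 < m1 by rewrite mulr_gt0 // divr_gt0.
have [_ C1 cbI] := cb; have C0 : 0 <= C by lra.
pose B1 := (1 / m1 + (2 * C) / m1 ^+ 2) * C.
pose B2 := 2 * C / m1.
have B10 : 0 <= B1.
  by rewrite mulr_ge0 // addr_ge0 // divr_ge0 ?mulr_ge0 ?exprn_ge0 // ltW.
have B20 : 0 <= B2 by rewrite divr_ge0 ?mulr_ge0 // ltW.
exists (B1 + B2); first exact: addr_ge0.
move=> e e0 es t tP; have [_ g1C g2C dTC] := cbI _ (I tP).
have eh : 0 <= e <= s1 / 2 by rewrite e0.
have zh : 0 <= (0 : R) <= s1 / 2 by rewrite lexx divr_ge0 // ltW.
have NC : normc (collar_t gamma t e) <= 2 * C.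
  rewrite /collar_t; apply: (le_trans (normcD _ _)); rewrite normc_iR ger0_norm //.
  have e1 : e <= 1 by move: sg1; lra.
  have : e * normc (dT gamma t) <= 1 * C by apply: ler_pM => //; exact: normc_ge0.
  move: g1C C1 => /=; lra.
have k0 := ker_low tP zh; have ke := ker_low tP eh.
have P0 : Phi t 0 = gamma t by rewrite /collar mulr0 mul0r addr0.
have k0' : m1 * 1 <= normc (gamma t - z) by rewrite -P0.
split.
  rewrite normcM normcV; apply: (@le_trans _ _ B2); last by rewrite lerDr.
  apply: ler_pM => //; [exact: normc_ge0|by rewrite invr_ge0 normc_ge0|].
  rewrite lef_pV2 ?posrE //; first by rewrite -[m1]mulr1.
  by apply: lt_le_trans ke; rewrite mulr1.
have E1 : normc (g1 t - collar_t gamma t e) <= e * C.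
  have -> : g1 t - collar_t gamma t e = - ('i * e%:C * dT gamma t).
    rewrite /collar_t; move: (g1 t) (dT gamma t) => x y; ring.
  rewrite normcN normc_iR ger0_norm //; exact: ler_wpM2l.
have E2 : normc ((Phi t e - z) - (gamma t - z)) <= e * C * 1.
  have -> : (Phi t e - z) - (gamma t - z) = 'i * e%:C * T t.
    by rewrite {1}/collar; move: (gamma t) (T t) (Phi t1 s1) => x y w; ring.
  rewrite normc_iR (normc_T gJ) mulr1 ger0_norm // mulr1; exact: ler_peMr.
apply: (le_trans (quotient_error m10 ltr01 E1 E2 k0' ke)).
rewrite divr1; apply: (@le_trans _ _ (B1 * e)); last first.
  by apply: ler_wpM2r => //; rewrite lerDl.
rewrite /B1 -mulrA (mulrC C e); apply: ler_wpM2r; first exact: mulr_ge0.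
rewrite lerD2l; apply: ler_wpM2r => //; rewrite invr_ge0 exprn_ge0 //; exact: ltW.
Qed.

(** The integrand is continuous down to the curve, hence bounded: the missing
    piece of length [e] contributes [O(e)]. *)
Lemma side_slide x l : a <= x <= b -> 0 < `|x - t1| ->
  (forall e, 0 < e -> exists2 d, 0 < d & forall s, 0 < s -> s < d ->
     normc (h (Phi x s) - l) < e) ->
  exists2 B, 0 <= B & forall e : R, 0 < e -> e <= sg ->
  normc (cauchy_int 0 sg (w_side x l) (Phi x) 1 z -
    cint e sg (fun s => h (Phi x s) / (Phi x s - z) * collar_s gamma x s)) <= B * e.
Proof.
move=> xP x0 liml.
pose f s := w_side x l s * (Phi x s - z)^-1 ^+ 1.
have cf s : 0 <= s <= sg -> {for s, continuous f}.
  move=> sP; apply: ccontM.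
    by apply: ccontM; [exact: side_h_cont|exact: ccont_cst].
  apply: (ccontV (f := fun s => Phi x s - z)).
    apply: ccontD; [exact: cont_collar_s|exact: ccont_cst].
  by apply: kneq => //; rewrite ltr_wpDr.
have [B B0 BP] := seg_cbounded cf; exists (2 * B); first exact: mulr_ge0.
have fi : cintegrable 0 sg f by exact: ccont_cintegrable.
move=> e e0 es; have eP : 0 <= e <= sg by rewrite ltW.
rewrite /cauchy_int -/f (cint_split eP fi).
have -> : cint e sg (fun s => h (Phi x s) / (Phi x s - z) * collar_s gamma x s) =
    cint e sg f.
  apply: eq_cint => s /andP[s1' s2']; rewrite /f /w_side /side_h leNgt.
  rewrite (lt_le_trans e0 s1') /= expr1.
  by move: (h _) (collar_s _ _ _) (_^-1) => A1 A2 A3; ring.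
rewrite addrK; have := normc_cint_bound (M := B) (ltW e0) (cintegrableS (lexx 0) es fi).
rewrite subr0; apply => t /andP[h1 h2]; apply: BP; rewrite h1 /=; exact: le_trans h2 es.
Qed.

Let five_terms (X1 X2 Y1 Y2 Sa Sb W Qb Qa : R[i]) (n1 n2 na nb : R) :
  Y1 - Y2 = X1 - X2 -> normc X1 <= n1 -> normc X2 <= n2 ->
  normc (Qa - Sa) <= na -> normc (Qb - Sb) <= nb ->
  normc (Y1 + (Qb - W - Qa) - (Y2 + Sb - W - Sa)) <= n1 + n2 + nb + na.
Proof.
move=> E3 N1 N2 Na Nb.
have -> : Y1 + (Qb - W - Qa) - (Y2 + Sb - W - Sa) =
    (Y1 - Y2) + (Qb - Sb) + - (Qa - Sa) by ring.
rewrite E3; apply: (le_trans (normcD _ _)); rewrite normcN; apply: lerD => //.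
apply: (le_trans (normcD _ _)); apply: lerD => //.
by apply: (le_trans (normcD _ _)); rewrite normcN; apply: lerD.
Qed.

Let five_small (X1 X2 Y1 Y2 Sa Sb W Qb Qa : R[i]) (K U Ba Bb s e : R) :
  0 <= K -> 0 <= U -> 0 <= Ba -> 0 <= Bb -> 0 <= e -> s <= e ->
  Y1 - Y2 = X1 - X2 -> normc X1 <= 2 * (K * s * U) -> normc X2 <= 2 * (K * e) ->
  normc (Qa - Sa) <= Ba * s -> normc (Qb - Sb) <= Bb * s ->
  normc (Y1 + (Qb - W - Qa) - (Y2 + Sb - W - Sa)) <= (2 * (K * U) + 2 * K + Ba + Bb) * e.
Proof.
move=> K0 U0 Ba0 Bb0 e0 se E3 N1 N2 Na Nb.
apply: (le_trans (five_terms W E3 N1 N2 Na Nb)).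
have F1 : K * s * U <= K * U * e.
  by rewrite -mulrA (mulrC s) mulrA; apply: ler_wpM2l => //; exact: mulr_ge0.
have F2 : Ba * s <= Ba * e by exact: ler_wpM2l.
have F3 : Bb * s <= Bb * e by exact: ler_wpM2l.
rewrite !mulrDl; lra.
Qed.

(** Pass to the limit in [rectint_collar]: on the base [h] converges to [u] in the
    mean and the kernels converge uniformly, and the sides converge by
    [side_slide]. *)
Lemma collar_cauchy :
  cauchy_int a b w_bottom gamma 1 z + inner_int 1 z = h z * ('i * (2 * pi)%:C).
Proof.
have [s10 s1s] := andP s1P; have [at1 t1b] := andP t1P.
have [K K0 KP] := kernel_slide.
have aP : a <= a <= b by rewrite lexx.
have bP : a <= b <= b by rewrite lexx andbT.
have [Ba Ba0 BaP] : exists2 B, 0 <= B & forall e : R, 0 < e -> e <= sg ->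
  normc (cauchy_int 0 sg (w_side a la) (Phi a) 1 z -
    cint e sg (fun s => h (Phi a s) / (Phi a s - z) * collar_s gamma a s)) <= B * e.
  by apply: side_slide => //; rewrite normr_gt0 subr_eq0 lt_eqF.
have [Bb Bb0 BbP] : exists2 B, 0 <= B & forall e : R, 0 < e -> e <= sg ->
  normc (cauchy_int 0 sg (w_side b lb) (Phi b) 1 z -
    cint e sg (fun s => h (Phi b s) / (Phi b s - z) * collar_s gamma b s)) <= B * e.
  by apply: side_slide => //; rewrite normr_gt0 subr_eq0 gt_eqF.
pose U := \int[mu]_(t in `[a, b]) l1 (fun t => u (gamma t)) t.
have U0 : 0 <= U by apply: Rintegral_ge0 => t _; rewrite addr_ge0.
apply/eqP; rewrite -subr_eq0; apply/eqP.
apply: (@small_eq0 R _ (2 * (K * U) + 2 * K + Ba + Bb)) => e e0 _.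
have [d d0 dP] := diff_l1_small e0.
pose s := Num.min (d / 2) (Num.min (s1 / 2) e).
have s0 : 0 < s by rewrite !lt_min !divr_gt0.
have [sd s12 se] : [/\ s < d, s <= s1 / 2 & s <= e].
  split; last by rewrite /s !ge_min lexx !orbT.
    by rewrite gt_min; apply/orP; left; rewrite ltr_pdivrMr // ltr_pMr // ltr1n.
  by rewrite /s !ge_min lexx !orbT.
have ssg : s <= sg by lra.
have sP : 0 < s <= sg by rewrite s0.
have [Di Dl] := dP s s0 sd ssg.
have ss1 : s < s1 by lra.
rewrite -(rectint_collar s0 ss1) /rectint.
have -> : cint a b (fun t => h (Phi t sg) / (Phi t sg - z) * collar_t gamma t sg) =
    cauchy_int a b w_top (fun t => Phi t sg) 1 z.
  apply: eq_cint => t _; rewrite /w_top expr1.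
  by move: (h _) (collar_t _ _ _) (_^-1) => A1 A2 A3; ring.
pose k0 t := g1 t / (gamma t - z).
pose ke t := collar_t gamma t s / (Phi t s - z).
have P0 t : Phi t 0 = gamma t by rewrite /collar mulr0 mul0r addr0.
have ck0 t : a <= t <= b -> {for t, continuous k0}.
  move=> tP; apply: ccontM; first exact: cont_g1.
  apply: (ccontV (f := fun t => gamma t - z)).
    apply: ccontD; [exact: cont_gamma|exact: ccont_cst].
  by rewrite -P0; apply: kneq => //; rewrite ?lexx ?(ltW sg0) // ltr_wpDl // normr_gt0; lra.
have cke t : a <= t <= b -> {for t, continuous ke}.
  move=> tP; apply: ccontM; first exact: (cont_collar_dt gJ).
  apply: (ccontV (f := fun t => Phi t s - z)).
    apply: ccontD; [exact: rdiff_continuous (collar_dt gJ t s)|exact: ccont_cst].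
  by apply: kneq => //; rewrite ?ssg ?(ltW s0) // ltr_wpDl // normr_gt0; lra.
have iu := u_integrable.
have ck t : a <= t <= b -> {for t, continuous (fun t => k0 t - ke t)}.
  by move=> tP; apply: ccontD; [exact: ck0|apply: ccontN; exact: cke].
have i1 := cintegrableM iu ck.
have i2 := cintegrableM Di cke.
have i3 := cintegrableM iu ck0.
have i4 : cintegrable a b (fun t => h (Phi t s) * ke t).
  apply: ccont_cintegrable => t tP; apply: ccontM; [exact: cont_hPhi_t|exact: cke].
have E1 : cauchy_int a b w_bottom gamma 1 z = cint a b (fun t => u (gamma t) * k0 t).
  by apply: eq_cint => t _; rewrite /w_bottom /k0 expr1 mulrA.
have E2 : cint a b (fun t => h (Phi t s) / (Phi t s - z) * collar_t gamma t s) =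
    cint a b (fun t => h (Phi t s) * ke t).
  apply: eq_cint => t _; rewrite /ke.
  by move: (h _) (collar_t _ _ _) (_^-1) => A1 A2 A3; ring.
have E3 : cint a b (fun t => u (gamma t) * k0 t) - cint a b (fun t => h (Phi t s) * ke t) =
   cint a b (fun t => u (gamma t) * (k0 t - ke t)) -
   cint a b (fun t => (h (Phi t s) - u (gamma t)) * ke t).
  rewrite -!cintB //; apply: eq_cint => t _.
  by move: (h _) (u _) (k0 t) (ke t) => A1 A2 A3 A4; ring.
have N1 : normc (cint a b (fun t => u (gamma t) * (k0 t - ke t))) <= 2 * (K * s * U).
  by apply: normc_cintM_le => // t tP; have [] := KP s (ltW s0) s12 t tP.
have N2 : normc (cint a b (fun t => (h (Phi t s) - u (gamma t)) * ke t)) <= 2 * (K * e).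
  apply: (@le_trans _ _ (2 * (K * \int[mu]_(t in `[a, b])
      l1 (fun t => h (Phi t s) - u (gamma t)) t))).
    by apply: normc_cintM_le => // t tP; have [] := KP s (ltW s0) s12 t tP.
  by rewrite ler_pM2l //; apply: ler_wpM2l.
have Na := BaP s s0 ssg; have Nb := BbP s s0 ssg.
rewrite E1 E2 /inner_int.
exact: (five_small (cauchy_int a b w_top (fun t => Phi t sg) 1 z) K0 U0 Ba0 Bb0 (ltW e0) se E3 N1 N2 Na Nb).
Qed.

End AtPoint.

End LocalCauchy.

(** * The localized Cauchy integral *)


Section PlaneContinuity.
Context {R : realType}.
Implicit Types f g : R[i] -> R[i].

Lemma zcontM f g p : {for p, continuous f} -> {for p, continuous g} ->
  {for p, continuous (fun z => f z * g z)}.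
Proof. by move=> fc gc; exact: (cvgM fc gc). Qed.

Lemma zcontB f g p : {for p, continuous f} -> {for p, continuous g} ->
  {for p, continuous (fun z => f z - g z)}.
Proof. by move=> fc gc; exact: (cvgB fc gc). Qed.

Lemma zcont_cst k p : {for p, continuous (fun _ : R[i] => k : R[i])}.
Proof.
by apply/continuous_normcP => e e0; exists 1 => // y _; rewrite subrr normc0.
Qed.

End PlaneContinuity.

Section Cutoff.
Context {R : realType}.
Variables (z0 : R[i]) (rho : R).
Hypothesis rho0 : 0 < rho.

Definition clamp (x : R) : R := Num.max 0 (Num.min 1 x).

Lemma clamp_lip x y : `|clamp x - clamp y| <= `|x - y|.
Proof.
rewrite /clamp /Num.max /Num.min.
case: (ltP 1 x) => x1; case: (ltP 1 y) => y1; rewrite ?ltr01 ?subrr ?normr0 //.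
- case: (ltP 0 y) => y0; rewrite ?subr0 !ger0_norm; lra.
- case: (ltP 0 x) => x0; rewrite ?sub0r ?normr1 ?normrN ?normr1 ?ler0_norm; lra.
- case: (ltP 0 x) => x0; case: (ltP 0 y) => y0; rewrite ?subrr ?normr0 ?subr0 ?sub0r ?normrN //.
    by rewrite !ger0_norm; lra.
  by rewrite (ger0_norm (ltW y0)) ler0_norm; lra.
Qed.

(** Equal to [1] up to distance [rho] from [z0] and to [0] from distance
    [2 * rho] on. *)
Definition cutoff (z : R[i]) : R := clamp (2 - normc (z - z0) / rho).

Lemma cutoff_ge0 z : 0 <= cutoff z.
Proof. by rewrite /cutoff /clamp le_max lexx. Qed.

Lemma cutoff_le1 z : cutoff z <= 1.
Proof. by rewrite /cutoff /clamp ge_max ler01 ge_min lexx. Qed.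

Lemma cutoff_lip y z : `|cutoff y - cutoff z| <= rho^-1 * normc (y - z).
Proof.
apply: (le_trans (clamp_lip _ _)).
have -> : 2 - normc (y - z0) / rho - (2 - normc (z - z0) / rho) =
  rho^-1 * (normc (z - z0) - normc (y - z0)) by ring.
rewrite normrM ger0_norm ?invr_ge0 ?(ltW rho0) //; apply: ler_wpM2l.
  by rewrite invr_ge0 ltW.
have h1 := normc_tri y z z0; have h2 := normc_tri z y z0.
have h3 := normcC y z.
by rewrite ler_norml; apply/andP; split; lra.
Qed.

Lemma cutoff1 z : normc (z - z0) <= rho -> cutoff z = 1.
Proof.
move=> h; have : normc (z - z0) / rho <= 1 by rewrite ler_pdivrMr // mul1r.
by move=> h1; rewrite /cutoff /clamp min_l ?max_r //; lra.
Qed.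

Lemma cutoff0 z : 2 * rho <= normc (z - z0) -> cutoff z = 0.
Proof.
move=> h; have : 2 <= normc (z - z0) / rho by rewrite ler_pdivlMr.
by move=> h1; rewrite /cutoff /clamp max_l // ge_min; apply/orP; right; lra.
Qed.

Lemma cutoff_continuous z : {for z, continuous (fun y => (cutoff y)%:C : R[i])}.
Proof. exact: (@Psi_continuous _ _ _ cutoff_lip z). Qed.

End Cutoff.

Section Localization.
Context {R : realType}.
Local Notation mu := (@lebesgue_measure R).
Variables (Omega : set R[i]) (gamma : R -> R[i]) (h : R[i] -> R[i]).
Variables (z0 : R[i]) (r a b rho t0 v0 C m : R).
Variables (w : R -> R[i]) (inner : nat -> R[i] -> R[i]).
Hypothesis hOmega : smooth_jordan_domain Omega gamma.
Hypothesis cb : curve_bounds gamma v0 C.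
Hypothesis t0P : a < t0 < b.
Hypothesis a1 : -1 <= a.
Hypothesis b1 : b <= 1.
Hypothesis ba : b - a <= 1 / 2.
Hypothesis z0E : gamma t0 = z0.
Hypothesis rho0 : 0 < rho.
Hypothesis r3 : 3 * rho < r.
Hypothesis m0 : 0 < m.
Hypothesis bil : forall t, a <= t <= b -> m * `|t - t0| <= normc (gamma t - z0).
Hypothesis iw : cintegrable a b w.
Hypothesis inner_cdiff : forall n z, normc (z - z0) < 3 * rho ->
  cdiff (inner n) z (n%:R * inner n.+1 z).
Hypothesis inner_bound : exists B, forall z, normc (z - z0) < 2 * rho ->
  normc (inner 1 z) <= B.
Hypothesis cauchy : forall z, Omega z -> normc (z - z0) < 3 * rho ->
  cauchy_int a b w gamma 1 z + inner 1 z = h z * ('i * (2 * pi)%:C).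

Local Notation psi := (cutoff z0 rho).
Let gJ : smooth_jordan_curve gamma. Proof. exact: domain_curve hOmega. Qed.
Let kappa : R[i] := ('i * (2 * pi)%:C)^-1.

Let psiL := cutoff_lip z0 rho0.
Let cg t : a <= t <= b -> {for t, continuous gamma}.
Proof. by move=> _; exact: cont_gamma. Qed.

(** With [w = u gamma'] this is the Cauchy integral of the boundary function of
    [h], cut off near [z0]. *)
Definition local_f (z : R[i]) : R[i] :=
  kappa * cauchy_int a b (fun t => w t * (psi (gamma t))%:C) gamma 1 z.

Definition local_g (z : R[i]) : R[i] :=
  kappa * lip_transform a b w gamma psi z - (psi z)%:C * (kappa * inner 1 z).

Lemma curve_far z : Omega z ->
  exists2 d, 0 < d & forall t, d <= normc (gamma t - z).
Proof.
have oO : open Omega by case: hOmega => -[].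
move/open_normcP: (oO) => oP Oz; have [e e0 eP] := oP z Oz.
exists e => // t; rewrite leNgt; apply/negP => /eP Og.
have /(boundaryE hOmega) : exists x, gamma x = gamma t by exists t.
by case=> _; rewrite (interior_id _).1.
Qed.

Let iwpsi : cintegrable a b (fun t => w t * (psi (gamma t))%:C).
Proof.
apply: cintegrableM iw _ => t tP.
by apply: (ccont_comp (F := fun y => (psi y)%:C)); [exact: cg|exact: cutoff_continuous].
Qed.

Lemma local_f_holomorphic : holomorphic_on Omega local_f.
Proof.
move=> z Oz; have [d d0 dP] := curve_far Oz.
apply/derivable_cdiffP; eexists; apply: cdiffZ.
exact: (cauchy_int_cdiff 1 iwpsi cg d0 (fun t _ => dP t)).
Qed.

Let ker_split (p q : R) (x y : R[i]) :
  x * p%:C * y = x * ((p - q)%:C * y) + q%:C * (x * y).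
Proof. by rewrite (rmorphB (real_complex R)) /=; ring. Qed.

(** Write [psi (gamma t) = psi z + (psi (gamma t) - psi z)]: the first term
    reproduces [psi * h] by the local Cauchy formula, and the second one
    compensates the pole of the kernel. *)
Lemma local_fE z : Omega z -> local_f z = (psi z)%:C * h z + local_g z.
Proof.
move=> Oz; have [d d0 dP] := curve_far Oz.
have gz t : gamma t - z != 0 by rewrite -normc_gt0 (lt_le_trans d0).
have ck t : a <= t <= b -> {for t, continuous (fun t => (gamma t - z)^-1)}.
  move=> tP; apply: (ccontV (f := fun t => gamma t - z)) => //.
  by apply: ccontD; [exact: cg|exact: ccont_cst].
have i1 := cintegrableM iw ck.
have i2 : cintegrable a b (fun t => w t * lip_kernel gamma psi z t).
  exact: (lip_kernel_integrable iw cg psiL).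
have E : cauchy_int a b (fun t => w t * (psi (gamma t))%:C) gamma 1 z =
    lip_transform a b w gamma psi z + (psi z)%:C * cauchy_int a b w gamma 1 z.
  rewrite /cauchy_int /lip_transform -cintZ // -cintD //; last exact: cintegrableZ.
  apply: eq_cint => t _; rewrite /lip_kernel expr1; exact: ker_split.
rewrite /local_f /local_g E.
have [zl|zg] := ltP (normc (z - z0)) (3 * rho); last first.
  by rewrite (@cutoff0 _ _ _ rho0 z) ?mul0r ?addr0 ?subr0 ?add0r //; move: rho0; lra.
have kn : 'i * (2 * pi)%:C != 0 :> R[i].
  by rewrite -normc_gt0 normcM normc_i mul1r normcR gtr0_norm ?mulr_gt0 ?pi_gt0.
have := cauchy Oz zl; move: (cauchy_int a b w gamma 1 z) (inner 1 z) => X Y XY.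
have -> : h z = kappa * (X + Y) by rewrite XY mulrC mulfK.
by move: (lip_transform a b w gamma psi z) ((psi z)%:C) => A1 A2; ring.
Qed.

Lemma local_g_continuous p : {for p, continuous local_g}.
Proof.
have inj q : exists t0, forall t, a <= t <= b -> gamma t = q -> t = t0.
  have [[x xP xq]|nx] := pselect (exists2 x, a <= x <= b & gamma x = q).
    exists x => t tP tq; apply: (gamma_inj gJ); first by rewrite tq.
    by rewrite ler_norml; move: tP xP ba => /andP[? ?] /andP[? ?] ?; apply/andP; split; lra.
  by exists 0 => t tP tq; case: nx; exists t.
have cM : {for p, continuous (fun z => kappa * lip_transform a b w gamma psi z)}.
  by apply: zcontM; [exact: zcont_cst|exact: (lip_transform_continuous iw cg psiL inj)].
apply: (zcontB cM); have [pl|pg] := ltP (normc (p - z0)) (3 * rho).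
  apply: zcontM; first exact: cutoff_continuous.
  by apply: zcontM; [exact: zcont_cst|exact: cdiff_continuous (inner_cdiff 1 pl)].
apply/(cvg_normcP (nbhs_filter p)) => e e0; apply/nbhs_normcP.
exists rho => // y yp; have yz := normc_tri y p z0; rewrite (normcC p y) in yz.
rewrite !(@cutoff0 _ _ _ rho0) ?mul0r ?subrr ?normc0 //; by move: rho0; lra.
Qed.

Lemma local_g_bound : exists2 B, 0 <= B & forall z, normc (local_g z) <= B.
Proof.
have [B BP] := inner_bound.
have B0 : 0 <= B.
  by apply: le_trans (BP z0 _); [exact: normc_ge0|rewrite subrr normc0 mulr_gt0].
have L0 := le_trans (normc_ge0 _) (lip_transform_bound iw cg psiL z0).
exists (normc kappa * (2 * (rho^-1 * \int[mu]_(t in `[a, b]) l1 w t)) + normc kappa * B).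
  by apply: addr_ge0; apply: mulr_ge0 => //; exact: normc_ge0.
move=> z; apply: (le_trans (normcB _ _)); apply: lerD.
  rewrite normcM; apply: ler_wpM2l; first exact: normc_ge0.
  exact: (lip_transform_bound iw cg psiL).
have k0 := normc_ge0 kappa.
have [zl|zg] := ltP (normc (z - z0)) (2 * rho); last first.
  by rewrite (@cutoff0 _ _ _ rho0) // mul0r normc0; exact: mulr_ge0.
rewrite normcM normcR (ger0_norm (cutoff_ge0 _ _ _)) -[leRHS]mul1r.
apply: ler_pM; [exact: cutoff_ge0|exact: normc_ge0|exact: cutoff_le1|].
by rewrite normcM; apply: ler_wpM2l => //; exact: BP.
Qed.

Let mul_sum3 (N A1 A2 A3 : R[i]) :
  N * (A1 + A2 + -1 * A3) = N * A1 + N * A2 + -1 * (N * A3).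
Proof. ring. Qed.

Let near_split (k A1 A2 A3 A4 : R[i]) :
  A4 + (k * (A1 + A2) - k * A3) - A4 = k * (A1 + A2 + -1 * A3).
Proof. ring. Qed.

(** Where [psi = 1], the difference is [local_g], whose density contains the
    factor [psi (gamma t) - 1]: it vanishes for [t] near [t0], and the rest of
    the curve stays away from [z0]. *)
Lemma local_f_smooth :
  extends_smoothly_near Omega (disc z0 r) z0 (fun z => local_f z - h z).
Proof.
have [_ C1 cbI] := cb; have C0 : 0 < C by lra.
have [at0 t0b] := andP t0P.
(* the curve stays within [rho] of [z0], where [psi = 1], during the time [eta] *)
have [eta e0 [e1 e2 e3]] : exists2 eta, 0 < eta &
    [/\ a <= t0 - eta, t0 + eta <= b & 2 * C * eta <= rho].
  exists (Num.min (Num.min (t0 - a) (b - t0)) (rho / (2 * C))).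
    by rewrite !lt_min !subr_gt0 at0 t0b divr_gt0 // mulr_gt0.
  split.
  - by rewrite lerBrDr -lerBrDl !ge_min lexx.
  - by rewrite -lerBrDl !ge_min lexx orbT.
  - by rewrite mulrC -ler_pdivlMr ?mulr_gt0 // !ge_min lexx !orbT.
pose q := Num.min rho (m * eta / 2).
have me0 : 0 < m * eta by exact: mulr_gt0.
have q0 : 0 < q by rewrite lt_min rho0 divr_gt0.
have [qr qm] : q <= rho /\ q <= m * eta / 2 by rewrite /q !ge_min !lexx orbT.
pose w1 t := w t * (psi (gamma t) - 1)%:C.
have iw1 : cintegrable a b w1.
  apply: cintegrableM iw _ => t tP.
  rewrite (_ : (fun t => _) = fun t => (psi (gamma t))%:C + (-1)%:C); last first.
    by apply/funext => s; rewrite -rmorphD.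
  apply: ccontD; last exact: ccont_cst.
  by apply: (ccont_comp (F := fun y => (psi y)%:C)); [exact: cg|exact: cutoff_continuous].
have w10 t : t0 - eta <= t <= t0 + eta -> w1 t = 0.
  move=> /andP[s1 s2]; rewrite /w1 cutoff1 ?subrr ?mulr0 // -z0E.
  have I1 : -3 <= t <= 3 by apply/andP; split; move: a1 b1; lra.
  have I2 : -3 <= t0 <= 3 by apply/andP; split; move: a1 b1; lra.
  apply: (le_trans (lip_gamma gJ cb I2 I1)); apply: le_trans e3.
  by apply: ler_wpM2l; [rewrite mulr_ge0 // ltW|rewrite ler_norml; apply/andP; split; lra].
have iL : cintegrable a (t0 - eta) w1 by apply: cintegrableS iw1 => //; lra.
have iR : cintegrable (t0 + eta) b w1 by apply: cintegrableS iw1 => //; lra.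
pose J n z := cauchy_int a (t0 - eta) w1 gamma n z +
  cauchy_int (t0 + eta) b w1 gamma n z + -1 * inner n z.
have farJ t z : a <= t <= b -> eta <= `|t - t0| -> normc (z - z0) < q ->
    m * eta / 2 <= normc (gamma t - z).
  move=> tP et zq; have h1 := bil tP; have h2 := normc_tri z (gamma t) z0.
  have : m * eta <= m * `|t - t0| by rewrite ler_pM2l.
  by lra.
have Jd n z : normc (z - z0) < q -> cdiff (J n) z (n%:R * J n.+1 z).
  move=> zq.
  have c1 : cdiff (cauchy_int a (t0 - eta) w1 gamma n) z
      (n%:R * cauchy_int a (t0 - eta) w1 gamma n.+1 z).
    apply: (cauchy_int_cdiff n iL (d := m * eta / 2)).
    - by move=> t _; exact: cont_gamma.
    - by rewrite divr_gt0.
    - move=> t /andP[s1 s2]; apply: farJ zq; first by apply/andP; split; lra.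
      by rewrite ler0_norm; lra.
  have c2 : cdiff (cauchy_int (t0 + eta) b w1 gamma n) z
      (n%:R * cauchy_int (t0 + eta) b w1 gamma n.+1 z).
    apply: (cauchy_int_cdiff n iR (d := m * eta / 2)).
    - by move=> t _; exact: cont_gamma.
    - by rewrite divr_gt0.
    - move=> t /andP[s1 s2]; apply: farJ zq; first by apply/andP; split; lra.
      by rewrite ger0_norm; lra.
  have c3 : cdiff (inner n) z (n%:R * inner n.+1 z).
    by apply: inner_cdiff; move: rho0; lra.
  have -> : n%:R * J n.+1 z = n%:R * cauchy_int a (t0 - eta) w1 gamma n.+1 z +
     n%:R * cauchy_int (t0 + eta) b w1 gamma n.+1 z + -1 * (n%:R * inner n.+1 z).
    exact: mul_sum3.
  exact: (cdiffD (cdiffD c1 c2) (cdiffZ (-1) c3)).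
have oV : open (disc z0 q).
  apply/open_normcP => z /discE zq; exists (q - normc (z - z0)).
    by rewrite subr_gt0.
  by move=> y yz; apply/discE; apply: (le_lt_trans (normc_tri z y z0)); lra.
exists (disc z0 q), (fun z => kappa * J 1%N z); split.
- exact: oV.
- by apply/discE; rewrite subrr normc0.
- by move=> z /discE zq; apply/discE; move: rho0 r3; lra.
- move=> z /discE zq Oz.
  have p1 : psi z = 1 by apply: cutoff1; lra.
  rewrite local_fE // /local_g p1 !mul1r.
  have -> : lip_transform a b w gamma psi z = cauchy_int a (t0 - eta) w1 gamma 1 z +
      cauchy_int (t0 + eta) b w1 gamma 1 z.
    have [d d0 dP] := curve_far Oz.
    have gz t : gamma t - z != 0 by rewrite -normc_gt0 (lt_le_trans d0).
    have ck t : a <= t <= b -> {for t, continuous (fun t => (gamma t - z)^-1)}.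
      move=> tP; apply: (ccontV (f := fun t => gamma t - z)) => //.
      by apply: ccontD; [exact: cg|exact: ccont_cst].
    have i1 := cintegrableM iw1 ck.
    have -> : lip_transform a b w gamma psi z =
        cint a b (fun t => w1 t * (gamma t - z)^-1).
      apply: eq_cint => t _; rewrite /lip_kernel /w1 p1.
      by move: (w t) (_^-1) ((psi (gamma t) - 1)%:C) => A1 A2 A3; ring.
    have P1 : a <= t0 - eta <= b by apply/andP; split; lra.
    have P2 : t0 - eta <= t0 + eta <= b by apply/andP; split; lra.
    rewrite (cint_split P1 i1) (cint_split P2); last first.
      by apply: cintegrableS i1 => //; lra.
    rewrite [X in _ + (X + _)](_ : _ = 0) ?add0r //.
    have im : cintegrable (t0 - eta) (t0 + eta) (fun t => w1 t * (gamma t - z)^-1).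
      by apply: cintegrableS i1 => //; lra.
    rewrite -(subrr (cint (t0 - eta) (t0 + eta) (fun t => w1 t * (gamma t - z)^-1))).
    rewrite -cintB //; apply: eq_cint => t tP.
    by rewrite w10 // mul0r subrr.
  exact/esym/near_split.
- move=> p [Vp _]; exists (disc z0 q), (fun z => kappa * J 1 z); split => //.
  move=> k; apply: (@tower_Ck R (disc z0 q) (fun n z => (n`!)%:R * J n.+1 z) oV _ k 0%N kappa).
    move=> n z /discE zq; rewrite factS mulnC natrM -mulrA.
    by apply: cdiffZ; exact: Jd.
  by move=> z _; rewrite fact0 mul1r.
Qed.

End Localization.

(** * Square integrals *)


Section Pieces.
Context {R : realType}.
Local Notation mu := (@lebesgue_measure R).

(** The sets [A] and [B] may overlap: on their union [f] is compared with [q], and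
    with a constant elsewhere. *)
Lemma integral_pieces (D A B : set (measurableTypeR R)) (f q : R -> R) (K : R) :
  measurable D -> measurable A -> measurable B -> measurable_fun D f ->
  measurable_fun A q -> measurable_fun B q ->
  (forall t, 0 <= f t) -> (forall t, 0 <= q t) -> 0 <= K ->
  (forall t, D t -> A t \/ B t -> f t <= K + q t) ->
  (forall t, D t -> ~ A t -> ~ B t -> f t <= K) ->
  (\int[mu]_(t in D) (f t)%:E <=
   K%:E * mu D + (\int[mu]_(t in A) (q t)%:E + \int[mu]_(t in B) (q t)%:E))%E.
Proof.
move=> mD mA mB mf qA qB f0 q0 K0 in1 out1.
pose Q t := (q t)%:E.
have rest (E : set (measurableTypeR R)) : measurable E -> measurable_fun E q ->
    measurable_fun D (Q \_ E) /\
    (\int[mu]_(t in D) (Q \_ E) t <= \int[mu]_(t in E) (q t)%:E)%E.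
  move=> mE qE; have mQ : measurable_fun E Q by apply/measurable_EFinP.
  split.
    apply: (measurable_restrict _ mE mD).1; apply: (measurable_funS mE _ mQ).
    by move=> t [].
  rewrite -integral_mkcondr; apply: ge0_subset_integral => //.
  - exact: measurableI.
  - by move=> t _; rewrite lee_fin.
have rest0 (E : set (measurableTypeR R)) t : (0 <= (Q \_ E) t)%E.
  by apply: erestrict_ge0 => s _; rewrite lee_fin.
have [mqA lA] := rest A mA qA; have [mqB lB] := rest B mB qB.
have mS : measurable_fun D (fun t => (Q \_ A) t + (Q \_ B) t)%E.
  exact: emeasurable_funD.
apply: (@le_trans _ _ (\int[mu]_(t in D) (K%:E + ((Q \_ A) t + (Q \_ B) t)))%E).
  apply: ge0_le_integral => //.
  - by move=> t _; rewrite lee_fin.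
  - by apply/measurable_EFinP.
  - by apply: emeasurable_funD.
  move=> t Dt; have [At|nAt] := pselect (A t).
    apply: (@le_trans _ _ (K%:E + Q t)%E); first by rewrite -EFinD lee_fin; apply: in1 => //; left.
    apply: leeD => //; rewrite -[leLHS]adde0; apply: leeD; last exact: rest0.
    by rewrite patchE mem_set.
  have [Bt|nBt] := pselect (B t).
    apply: (@le_trans _ _ (K%:E + Q t)%E); first by rewrite -EFinD lee_fin; apply: in1 => //; right.
    apply: leeD => //; rewrite -[leLHS]add0e; apply: leeD; first exact: rest0.
    by rewrite [leRHS]patchE mem_set.
  rewrite -[leLHS]adde0; apply: leeD; first by rewrite lee_fin; exact: out1.
  by apply: adde_ge0; exact: rest0.
rewrite ge0_integralD //; last first.
  by move=> t _; apply: adde_ge0; exact: rest0.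
rewrite integral_cst //; apply: leeD => //.
by rewrite ge0_integralD //; apply: leeD.
Qed.

Lemma sqr_sum3 (x y z : R[i]) :
  normc x ^+ 2 <= 3 * (normc (x - y) ^+ 2 + normc (z - y) ^+ 2 + normc z ^+ 2).
Proof.
have E : x = (x - y) + - (z - y) + z by ring.
have h : normc x <= normc (x - y) + normc (z - y) + normc z.
  rewrite {1}E; apply: (le_trans (normcD _ _)); apply: lerD => //.
  by apply: (le_trans (normcD _ _)); rewrite normcN.
have := normc_ge0 x; move: h.
move: (normc x) (normc (x - y)) (normc (z - y)) (normc z) => X A B D h X0.
apply: (@le_trans _ _ ((A + B + D) ^+ 2)); first by rewrite lerXn2r ?nnegrE //; lra.
rewrite -subr_ge0.
have -> : 3 * (A ^+ 2 + B ^+ 2 + D ^+ 2) - (A + B + D) ^+ 2 =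
  (A - B) ^+ 2 + (B - D) ^+ 2 + (A - D) ^+ 2 by ring.
by rewrite !addr_ge0 // sqr_ge0.
Qed.

Lemma sqr_sum2 (x y : R[i]) :
  normc (x + y) ^+ 2 <= 2 * (normc x ^+ 2 + normc y ^+ 2).
Proof.
have := normcD x y; have := normc_ge0 (x + y).
move: (normc _) (normc x) (normc y) => X A B X0 h.
apply: (@le_trans _ _ ((A + B) ^+ 2)); first by rewrite lerXn2r ?nnegrE //; lra.
rewrite -subr_ge0.
have -> : 2 * (A ^+ 2 + B ^+ 2) - (A + B) ^+ 2 = (A - B) ^+ 2 by ring.
by rewrite sqr_ge0.
Qed.

End Pieces.

Section ArcBound.
Context {R : realType}.
Local Notation mu := (@lebesgue_measure R).

Lemma measurable_sqr_weight (D : set (measurableTypeR R)) (f : R -> R[i]) (v : R -> R) :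
  measurable_fun D (fun t => complex.Re (f t)) ->
  measurable_fun D (fun t => complex.Im (f t)) -> measurable_fun D v ->
  measurable_fun D (fun t => normc (f t) ^+ 2 * v t).
Proof.
move=> mR mI mv; apply: measurable_funM => //.
rewrite (_ : (fun t => _) = (fun t => complex.Re (f t) * complex.Re (f t) +
   complex.Im (f t) * complex.Im (f t))); last first.
  by apply/funext => t; rewrite normc_sqr !expr2.
by apply: measurable_funD; apply: measurable_funM.
Qed.

Lemma rcont_measurable (f : R -> R) a b :
  (forall t, a <= t <= b -> {for t, continuous f}) ->
  measurable_fun (`[a, b] : set (measurableTypeR R)) f.
Proof.
by move=> cf; apply/measurable_EFinP; exact: (measurable_int mu (rcont_integrable cf)).
Qed.

Lemma ccont_measurable (f : R -> R[i]) a b :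
  (forall t, a <= t <= b -> {for t, continuous f}) ->
  measurable_fun (`[a, b] : set (measurableTypeR R)) (fun t => complex.Re (f t)) /\
  measurable_fun (`[a, b] : set (measurableTypeR R)) (fun t => complex.Im (f t)).
Proof.
by move=> cf; split; apply: rcont_measurable => t /cf /ccont_ReIm[].
Qed.

Variables (gamma : R -> R[i]) (h u : R[i] -> R[i]) (x y sg v0 C : R).
Local Notation v := (speed gamma).
Local Notation Phi := (collar gamma).
Hypothesis gJ : smooth_jordan_curve gamma.
Hypothesis cb : curve_bounds gamma v0 C.
Hypothesis xy : x <= y.
Hypothesis x3 : -3 <= x.
Hypothesis y3 : y <= 3.
Hypothesis sg0 : 0 < sg.
Hypothesis hc : forall t s, x <= t <= y -> 0 < s <= sg ->
  {for t, continuous (fun t => h (Phi t s))}.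
Hypothesis mRe : measurable_fun (`[x, y] : set (measurableTypeR R))
  (fun t => complex.Re (u (gamma t))).
Hypothesis mIm : measurable_fun (`[x, y] : set (measurableTypeR R))
  (fun t => complex.Im (u (gamma t))).
Hypothesis lim : forall e : R, 0 < e -> exists2 d : R, 0 < d & forall s : R, 0 < s -> s < d ->
  (\int[mu]_(t in `[x, y]) (normc (h (Phi t s) - u (gamma t)) ^+ 2 * v t)%:E <= e%:E)%E.

Let mv : measurable_fun (`[x, y] : set (measurableTypeR R)) v.
Proof. by apply: rcont_measurable => t _; exact: cont_speed. Qed.

Let v_ge0 t : 0 <= v t. Proof. exact: ltW (speed_gt0 gJ t). Qed.

(** Convergence in the quadratic mean bounds the square integrals on the
    curves close to the boundary: compare with one fixed curve. *)
Lemma arc_bound : exists2 M : R, 0 <= M & exists2 d : R, 0 < d & forall s : R, 0 < s -> s < d ->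
  (\int[mu]_(t in `[x, y]) (normc (h (Phi t s)) ^+ 2 * v t)%:E <= M%:E)%E.
Proof.
have [d1 d10 d1P] := lim ltr01.
pose s1 := Num.min (d1 / 2) sg.
have s10 : 0 < s1 by rewrite lt_min divr_gt0.
have s1d : s1 < d1 by rewrite gt_min; apply/orP; left; rewrite ltr_pdivrMr // ltr_pMr // ltr1n.
have s1P : 0 < s1 <= sg by rewrite s10 ge_min lexx orbT.
have [H H0 HP] := seg_cbounded (fun t tP => hc tP s1P).
have [_ C1 cbI] := cb; have C0 : 0 <= C by lra.
have mh s : 0 < s <= sg ->
    measurable_fun (`[x, y] : set (measurableTypeR R)) (fun t => complex.Re (h (Phi t s))) /\
    measurable_fun (`[x, y] : set (measurableTypeR R)) (fun t => complex.Im (h (Phi t s))).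
  by move=> sP; apply: ccont_measurable => t tP; exact: hc.
have md s : 0 < s <= sg -> measurable_fun (`[x, y] : set (measurableTypeR R))
    (fun t => normc (h (Phi t s) - u (gamma t)) ^+ 2 * v t).
  move=> /mh[m1 m2]; apply: measurable_sqr_weight => //.
    rewrite (_ : (fun t => _) = fun t => complex.Re (h (Phi t s)) - complex.Re (u (gamma t))).
      exact: measurable_funB.
    by apply/funext => t; rewrite cReD cReN.
  rewrite (_ : (fun t => _) = fun t => complex.Im (h (Phi t s)) - complex.Im (u (gamma t))).
    exact: measurable_funB.
  by apply/funext => t; rewrite cImD cImN.
pose K := 3 * (1 + 1 + H ^+ 2 * C * (y - x)).
have K0 : 0 <= K.
  have : 0 <= H ^+ 2 * C * (y - x) by rewrite !mulr_ge0 ?exprn_ge0 ?subr_ge0.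
  by rewrite /K; lra.
exists K => //; exists (Num.min d1 sg); first by rewrite lt_min d10.
move=> s s0; rewrite lt_min => /andP[sd ss].
have sP : 0 < s <= sg by rewrite s0 ltW.
pose A s t := (normc (h (Phi t s) - u (gamma t)) ^+ 2 * v t)%:E.
have A0 s' t : (0 <= A s' t)%E by rewrite lee_fin mulr_ge0 ?sqr_ge0.
have mA s' : 0 < s' <= sg -> measurable_fun (`[x, y] : set (measurableTypeR R)) (A s').
  by move=> s'P; apply/measurable_EFinP; exact: md.
have mxy := measurable_seg x y.
apply: (@le_trans _ _ (\int[mu]_(t in `[x, y]) (3%:E * (A s t + A s1 t + (H ^+ 2 * C)%:E)))%E).
  apply: ge0_le_integral => //.
  - by move=> t _; rewrite lee_fin mulr_ge0 ?sqr_ge0.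
  - apply/measurable_EFinP; have [m1 m2] := mh s sP; exact: measurable_sqr_weight.
  - apply: measurable_funeM; apply: emeasurable_funD => //.
    by apply: emeasurable_funD; exact: mA.
  move=> t; rewrite /= in_itv /= => tP; rewrite /A -!EFinD -EFinM lee_fin.
  apply: (le_trans (ler_wpM2r (v_ge0 t) (sqr_sum3 _ (u (gamma t)) (h (Phi t s1))))).
  rewrite -mulrA ler_pM2l // !mulrDl lerD2l.
  have I1 : -3 <= t <= 3 by move: tP => /andP[? ?]; apply/andP; split; move: x3 y3; lra.
  have [_ vC _ _] := cbI _ I1.
  apply: ler_pM => //; first exact: sqr_ge0.
  by rewrite lerXn2r ?nnegrE ?normc_ge0 //; exact: HP.
rewrite ge0_integralZl_EFin //; last 2 first.
- by move=> t _; rewrite !adde_ge0 // lee_fin mulr_ge0 // sqr_ge0.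
- by apply: emeasurable_funD => //; apply: emeasurable_funD; exact: mA.
rewrite ge0_integralD //; last 3 first.
- by move=> t _; exact: adde_ge0.
- by apply: emeasurable_funD; exact: mA.
- by move=> t _; rewrite lee_fin mulr_ge0 // sqr_ge0.
rewrite ge0_integralD //; [|exact: mA|exact: mA].
rewrite [leRHS]EFinM; apply: lee_wpmul2l; first by rewrite lee_fin.
rewrite !EFinD; apply: leeD; first by apply: leeD; exact: d1P.
rewrite (integral_cst mu mxy) /= lebesgue_measure_itv /= lte_fin.
case: ltP => _; first by rewrite -EFinB -EFinM.
by rewrite mule0 lee_fin !mulr_ge0 ?exprn_ge0 ?subr_ge0.
Qed.

End ArcBound.

(** * Membership in the Hardy space *)


Section Hardy.
Context {R : realType}.
Local Notation mu := (@lebesgue_measure R).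
Variables (Omega : set R[i]) (gamma : R -> R[i]) (h u F S : R[i] -> R[i]).
Variables (z0 : R[i]) (r a b rho v0 C sg B M1 d1 : R).
Local Notation v := (speed gamma).
Local Notation Phi := (collar gamma).
Local Notation psi := (cutoff z0 rho).
Local Notation E0 := (disc z0 r `&` boundary Omega).
Hypothesis hOmega : smooth_jordan_domain Omega gamma.
Hypothesis cb : curve_bounds gamma v0 C.
Hypothesis rho0 : 0 < rho.
Hypothesis r3 : 3 * rho < r.
Hypothesis sg0 : 0 < sg.
Hypothesis sg1 : sg <= 1.
Hypothesis inO : forall t s : R, -2 <= t <= 2 -> 0 < s < sg -> Omega (Phi t s).
Hypothesis wrap : forall t : R, 0 <= t < 1 -> normc (gamma t - z0) < 3 * rho ->
  a <= t <= b \/ a + 1 <= t <= b + 1.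
Hypothesis hF : holomorphic_on Omega F.
Hypothesis FE : forall z, Omega z -> F z = (psi z)%:C * h z + S z.
Hypothesis cS : forall p, {for p, continuous S}.
Hypothesis B0 : 0 <= B.
Hypothesis BS : forall z, normc (S z) <= B.
Hypothesis hu : L2_arc gamma E0 u.
Hypothesis hnt : nontangential_limit_ae Omega gamma E0 h u.
Hypothesis hcont : forall t s : R, a <= t <= b \/ a + 1 <= t <= b + 1 -> 0 < s < sg ->
  {for t, continuous (fun t => h (Phi t s))}.
Hypothesis d10 : 0 < d1.
Hypothesis arcs : forall s : R, 0 < s -> s < d1 ->
  (\int[mu]_(t in `[a, b]) (normc (h (Phi t s)) ^+ 2 * v t)%:E <= M1%:E)%E /\
  (\int[mu]_(t in `[(a + 1)%R, (b + 1)%R]) (normc (h (Phi t s)) ^+ 2 * v t)%:E <= M1%:E)%E.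

(** The boundary function of [psi * h + S]. *)
Definition glued_u (p : R[i]) : R[i] := (psi p)%:C * u p + S p.

Let gJ : smooth_jordan_curve gamma. Proof. exact: domain_curve hOmega. Qed.
Let C0 : 0 <= C. Proof. by case: cb => _ C1 _; exact: le_trans ler01 C1. Qed.
Let v00 : 0 < v0. Proof. by case: cb. Qed.
Let v_ge0 t : 0 <= v t. Proof. exact: ltW (speed_gt0 gJ t). Qed.
Let D : set (measurableTypeR R) := `[0, 1[%classic.
Let mD : measurable D. Proof. exact: measurable_itv. Qed.
Let muD : mu D = 1%E.
Proof. by rewrite /D lebesgue_measure_itv /= lte_fin ltr01 sube0. Qed.
Let DI (t : R) : D t -> 0 <= t < 1. Proof. by rewrite /D /= in_itv. Qed.

Lemma speed_parallel s t : speed (parallel gamma s) t = normc (collar_t gamma t s).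
Proof. by rewrite /speed (rdiff_cderiv (collar_dt gJ t s)).2. Qed.

Lemma speed_parallel_le (s t : R) : 0 <= t < 1 -> 0 < s -> s < sg ->
  speed (parallel gamma s) t <= 2 * C.
Proof.
move=> /andP[t0 t1] s0 ss; rewrite speed_parallel /collar_t.
have I1 : -3 <= t <= 3 by apply/andP; split; lra.
have [_ _ /(_ t I1)[_ g1C _ dTC]] := cb.
apply: (le_trans (normcD _ _)); rewrite normc_iR gtr0_norm // mulr2n mulrDl !mul1r.
apply: lerD => //; rewrite -[leRHS]mul1r; apply: ler_pM => //; first exact: ltW.
  exact: normc_ge0.
by move: sg1; lra.
Qed.

Let sqr_psi (p x : R[i]) : normc ((psi p)%:C * x) ^+ 2 <= normc x ^+ 2.
Proof.
rewrite lerXn2r ?nnegrE ?normc_ge0 // normcM normcR ger0_norm ?cutoff_ge0 //.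
by rewrite ler_piMl ?normc_ge0 // cutoff_le1.
Qed.

Let sqr_S (p : R[i]) : normc (S p) ^+ 2 <= B ^+ 2.
Proof. by rewrite lerXn2r ?nnegrE ?normc_ge0. Qed.

(** On a parallel curve [psi * h] vanishes except on the arc over [a, b], where
    the square integrals of [h] are bounded; [S] is bounded.  When [a < 0], the
    parameters in [0, 1[ of this arc partly lie in [a + 1, b + 1]. *)
Lemma hardy_bound : exists M : R, \forall eps \near 0^'+,
  (\int[mu]_(t in `[0%R, 1%R[)
     (normc (F (parallel gamma eps t)) ^+ 2 * speed (parallel gamma eps) t)%:E <= M%:E)%E.
Proof.
pose K1 := 4 * C / v0; pose K := 4 * C * B ^+ 2.
have K10 : 0 <= K1 by rewrite /K1 divr_ge0 ?mulr_ge0 // ltW.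
have K0 : 0 <= K by rewrite /K !mulr_ge0 // sqr_ge0.
exists (K + (K1 * M1 + K1 * M1)); near=> eps.
have e0 : 0 < eps by near: eps; exact: nbhs_right_gt.
have es : eps < sg by near: eps; exact: nbhs_right_lt.
have ed : eps < d1 by near: eps; exact: nbhs_right_lt.
have er : eps < rho by near: eps; exact: nbhs_right_lt.
have [i1 i2] := arcs e0 ed.
have eP : 0 < eps < sg by rewrite e0.
pose q t := K1 * (normc (h (Phi t eps)) ^+ 2 * v t).
pose f t := normc (F (Phi t eps)) ^+ 2 * speed (parallel gamma eps) t.
have Q0 t : 0 <= normc (h (Phi t eps)) ^+ 2 * v t by rewrite mulr_ge0 ?sqr_ge0.
have mQ x y : (forall t, x <= t <= y -> a <= t <= b \/ a + 1 <= t <= b + 1) ->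
    measurable_fun (`[x, y] : set (measurableTypeR R))
      (fun t => normc (h (Phi t eps)) ^+ 2 * v t).
  move=> xy; have [m1 m2] := ccont_measurable (fun t tP => hcont (xy t tP) eP).
  by apply: measurable_sqr_weight => //; apply: rcont_measurable => t _; exact: cont_speed.
have mQa : measurable_fun (`[a, b] : set (measurableTypeR R))
    (fun t => normc (h (Phi t eps)) ^+ 2 * v t) by apply: mQ => t; left.
have mQb : measurable_fun (`[a + 1, b + 1] : set (measurableTypeR R))
    (fun t => normc (h (Phi t eps)) ^+ 2 * v t) by apply: mQ => t; right.
have Oe t : 0 <= t <= 1 -> Omega (Phi t eps).
  by move=> /andP[h1 h2]; apply: inO => //; apply/andP; split; lra.
have mf : measurable_fun D f.
  apply: (measurable_funS (measurable_seg 0 1)).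
    by move=> t; rewrite /D /= !in_itv /= => /andP[-> /ltW ->].
  have cF t : 0 <= t <= 1 -> {for t, continuous (fun t => F (Phi t eps))}.
    move=> tP; apply: (ccont_comp (c := fun t => Phi t eps)).
      exact: rdiff_continuous (collar_dt gJ t eps).
    by have /derivable_cdiffP[l /cdiff_continuous] := hF (Oe t tP).
  have [m1 m2] := ccont_measurable cF.
  apply: measurable_sqr_weight => //; apply: rcont_measurable => t _.
  rewrite (_ : speed _ = fun t => normc (collar_t gamma t eps)); last first.
    by apply/funext => s; exact: speed_parallel.
  by apply: ccont_normc; exact: (cont_collar_dt gJ).
have f_ge0 t : 0 <= f t by rewrite mulr_ge0 ?sqr_ge0 // /speed normc_ge0.
have fS t : D t -> f t <= 2 * (normc ((psi (Phi t eps))%:C * h (Phi t eps)) ^+ 2 + B ^+ 2) * (2 * C).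
  move=> /DI tP; apply: ler_pM; [exact: sqr_ge0|exact: normc_ge0| |exact: speed_parallel_le].
  have tP' : 0 <= t <= 1 by case/andP: tP => -> /ltW ->.
  rewrite (FE (Oe t tP')); apply: (le_trans (sqr_sum2 _ _)).
  by rewrite ler_pM2l // lerD2l.
have := @integral_pieces R D `[a, b]%classic `[a + 1, b + 1]%classic f q K mD
  (measurable_seg _ _) (measurable_seg _ _) mf.
have mq x y : measurable_fun (`[x, y] : set (measurableTypeR R))
      (fun t => normc (h (Phi t eps)) ^+ 2 * v t) ->
    measurable_fun (`[x, y] : set (measurableTypeR R)) q.
  by move=> m1; apply: measurable_funM.
move=> /(_ (mq _ _ mQa) (mq _ _ mQb) f_ge0 (fun t => mulr_ge0 K10 (Q0 t)) K0) H.
have {}H := H _ _.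
apply: (le_trans (H _ _)).
- move=> t Dt _; apply: (le_trans (fS t Dt)).
  have := sqr_psi (Phi t eps) (h (Phi t eps)).
  move: (normc (_ * _) ^+ 2) => X XH.
  have vt : v0 <= v t.
    have I1 : -3 <= t <= 3 by case/DI/andP: Dt => ? ?; apply/andP; split; lra.
    by have [_ _ /(_ t I1)[]] := cb.
  have : 4 * C * X <= q t.
    rewrite /q /K1 mulrCA; set N := normc _ ^+ 2.
    have -> : N * (4 * C / v0 * v t) = 4 * C * (N * (v t / v0)) by ring.
    apply: ler_wpM2l; first by rewrite mulr_ge0.
    apply: (le_trans XH); rewrite ler_peMr ?sqr_ge0 // ler_pdivlMr // mul1r.
    exact: vt.
  by rewrite /K; lra.
- move=> t Dt nA nB; apply: (le_trans (fS t Dt)).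
  have -> : psi (Phi t eps) = 0.
    apply: cutoff0 => //; rewrite leNgt; apply/negP => hz.
    have hg : normc (gamma t - z0) < 3 * rho.
      apply: (le_lt_trans (normc_tri (Phi t eps) _ _)).
      have -> : normc (gamma t - Phi t eps) = eps.
        rewrite normcC /collar addrAC subrr add0r normc_iR (normc_T gJ) mulr1.
        by rewrite gtr0_norm.
      by move: er hz; lra.
    by case: (wrap (DI Dt) hg) => hh; [apply: nA|apply: nB]; rewrite /= in_itv.
  rewrite mul0r normc0 expr0n /= add0r /K.
  by rewrite le_eqVlt; apply/orP; left; apply/eqP; ring.
rewrite muD mule1 !EFinD; apply: leeD => //.
have iq x y (M' : R) : measurable_fun (`[x, y] : set (measurableTypeR R))
      (fun t => normc (h (Phi t eps)) ^+ 2 * v t) ->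
    (\int[mu]_(t in `[x, y]) (normc (h (Phi t eps)) ^+ 2 * v t)%:E <= M'%:E)%E ->
    (\int[mu]_(t in `[x, y]) (q t)%:E <= (K1 * M')%:E)%E.
  move=> m1 le1; rewrite /q; under eq_integral do rewrite EFinM.
  rewrite ge0_integralZl_EFin //.
  - by rewrite [leRHS]EFinM; apply: lee_wpmul2l; rewrite ?lee_fin.
  - by move=> t _; rewrite lee_fin.
  - by apply/measurable_EFinP.
by apply: leeD; apply: iq.
Unshelve. all: by end_near.
Qed.

Let arc_boundaryE : arc_params gamma (boundary Omega) = D.
Proof.
apply/seteqP; split => t; first by case.
by move=> Dt; split => //; apply/(boundaryE hOmega); exists t.
Qed.

Let A : set (measurableTypeR R) := arc_params gamma E0.

Let AP t : A t <-> D t /\ normc (gamma t - z0) < r.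
Proof.
split; first by move=> [Dt [/discE ? _]].
move=> [Dt dt]; split => //; split; first exact/discE.
by apply/(boundaryE hOmega); exists t.
Qed.

Let mcontT (f : R -> R) : (forall t, {for t, continuous f}) ->
  measurable_fun [set: measurableTypeR R] f.
Proof. by move=> cf; apply: continuous_measurable_fun => t; exact: cf. Qed.

Lemma measurable_arc_params : measurable A.
Proof.
have mg : measurable_fun D (fun t => normc (gamma t - z0)).
  apply: measurable_funTS; apply: mcontT => t; apply: ccont_normc.
  by apply: ccontD; [exact: cont_gamma|exact: ccont_cst].
have := mg mD `]-oo, r[%classic (measurable_itv _).
congr measurable; apply/seteqP; split => t.
  by move=> [Dt /=]; rewrite in_itv /= => dt; apply/AP.
by move=> /AP[Dt dt]; split => //=; rewrite in_itv.
Qed.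

Let two_terms (X1 X2 X3 X4 X5 : R) : X1 * X4 <= X3 * X4 -> X2 * X4 <= X5 * C ->
  2 * (X1 + X2) * X4 <= 2 * X5 * C + 2 * (X3 * X4).
Proof. by move=> g1 g2; lra. Qed.

Lemma glued_u_L2 : L2_arc gamma (boundary Omega) glued_u.
Proof.
have mA := measurable_arc_params; have [uR uI uL] := hu.
have cpsi t : {for t, continuous (fun t => (psi (gamma t))%:C : R[i])}.
  apply: (ccont_comp (F := fun y => (psi y)%:C)); first exact: cont_gamma.
  exact: cutoff_continuous.
have cSg t : {for t, continuous (fun t => S (gamma t))}.
  by apply: (ccont_comp (F := S)); [exact: cont_gamma|exact: cS].
have mpsi (X : set (measurableTypeR R)) : measurable_fun X (fun t => psi (gamma t)).
  apply: measurable_funTS; apply: mcontT => t.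
  by have /ccont_ReIm[] := cpsi t.
have mS (X : set (measurableTypeR R)) :
    measurable_fun X (fun t => complex.Re (S (gamma t))) /\
    measurable_fun X (fun t => complex.Im (S (gamma t))).
  by split; apply: measurable_funTS; apply: mcontT => t; have /ccont_ReIm[] := cSg t.
have DE : D = A `|` (D `\` A).
  by rewrite setDUK // => t /AP[].
have psi0 t : (D `\` A) t -> psi (gamma t) = 0.
  move=> [Dt nA]; apply: cutoff0 => //; rewrite leNgt; apply/negP => dt.
  by apply: nA; apply/AP; split => //; move: r3 rho0 dt; lra.
have mR : measurable_fun D (fun t => complex.Re (glued_u (gamma t))).
  rewrite DE; apply/measurable_funU => //; first exact: measurableD.
  split.
    rewrite (_ : (fun t => _) = fun t => psi (gamma t) * complex.Re (u (gamma t)) +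
        complex.Re (S (gamma t))).
      by apply: measurable_funD; [exact: measurable_funM|exact: (mS A).1].
    by apply/funext => t; rewrite /glued_u !cpx_simp mul0r subr0.
  apply: (@eq_measurable_fun _ _ _ _ _ (fun t => complex.Re (S (gamma t)))).
    by move=> t /set_mem /psi0 p0; rewrite /glued_u p0 mul0r add0r.
  exact: (mS _).1.
have mI : measurable_fun D (fun t => complex.Im (glued_u (gamma t))).
  rewrite DE; apply/measurable_funU => //; first exact: measurableD.
  split.
    rewrite (_ : (fun t => _) = fun t => psi (gamma t) * complex.Im (u (gamma t)) +
        complex.Im (S (gamma t))).
      by apply: measurable_funD; [exact: measurable_funM|exact: (mS A).2].
    by apply/funext => t; rewrite /glued_u !cpx_simp mul0r addr0.
  apply: (@eq_measurable_fun _ _ _ _ _ (fun t => complex.Im (S (gamma t)))).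
    by move=> t /set_mem /psi0 p0; rewrite /glued_u p0 mul0r add0r.
  exact: (mS _).2.
have mv (X : set (measurableTypeR R)) : measurable_fun X v.
  by apply: measurable_funTS; apply: mcontT => t; exact: cont_speed.
rewrite /L2_arc arc_boundaryE; split; [exact: mR|exact: mI|].
pose f t := normc (glued_u (gamma t)) ^+ 2 * v t.
pose q t := 2 * (normc (u (gamma t)) ^+ 2 * v t).
have q0 t : 0 <= normc (u (gamma t)) ^+ 2 * v t by rewrite mulr_ge0 ?sqr_ge0.
have mq : measurable_fun A (fun t => normc (u (gamma t)) ^+ 2 * v t).
  exact: measurable_sqr_weight.
pose K := 2 * B ^+ 2 * C.
have K0 : 0 <= K by rewrite /K !mulr_ge0 // sqr_ge0.
have vC t : D t -> v t <= C.
  move=> /DI /andP[h1 h2]; have I1 : -3 <= t <= 3 by apply/andP; split; lra.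
  by have [_ _ /(_ t I1)[]] := cb.
have := @integral_pieces R D A set0 f q K mD mA measurable0
  (measurable_sqr_weight mR mI (mv D)) (measurable_funM _ mq).
move=> /(_ (measurable_cst _) (measurable_fun_set0 _)) H.
apply: (@le_lt_trans _ _ (K%:E * mu D + (\int[mu]_(t in A) (q t)%:E +
    \int[mu]_(t in set0) (q t)%:E))%E).
  apply: H => //.
  - by move=> t; rewrite mulr_ge0 ?sqr_ge0.
  - by move=> t; rewrite mulr_ge0.
  - move=> t Dt _; rewrite /f /q /glued_u.
    apply: (le_trans (ler_wpM2r (v_ge0 t) (sqr_sum2 _ _))).
    have h1 := sqr_psi (gamma t) (u (gamma t)); have h2 := sqr_S (gamma t).
    have g1 := ler_wpM2r (v_ge0 t) h1.
    have g2 := ler_pM (sqr_ge0 _) (v_ge0 t) h2 (vC t Dt).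
    exact: two_terms g1 g2.
  - move=> t Dt nA _; rewrite /f /glued_u psi0 // mul0r add0r /K.
    apply: (@le_trans _ _ (B ^+ 2 * C)).
      by apply: ler_pM => //; [exact: sqr_ge0|exact: vC].
    by rewrite -mulrA ler_peMl ?mulr_ge0 ?sqr_ge0 // ler1n.
rewrite integral_set0 adde0 muD mule1.
rewrite /q; under eq_integral do rewrite EFinM.
rewrite ge0_integralZl_EFin //; last 2 first.
- by move=> t _; rewrite lee_fin.
- by apply/measurable_EFinP.
by rewrite lte_add_pinfty ?ltry // lte_mul_pinfty.
Qed.

Lemma nontangential_limitP (G : R[i] -> R[i]) (p l : R[i]) :
  nontangential_limit Omega G p l <-> forall alpha : R, 0 < alpha ->
  forall e : R, 0 < e -> exists2 d, 0 < d & forall z,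
    approach_region Omega alpha p z -> normc (z - p) < d -> normc (G z - l) < e.
Proof.
split=> H alpha al0.
  move=> e e0; have := H alpha al0.
  move=> /(cvg_normcP (within_filter _ (nbhs_filter p))) /(_ e e0) /nbhs_normcP[d d0 dP].
  by exists d => // z Az zd; exact: dP.
apply/(cvg_normcP (within_filter _ (nbhs_filter p))) => e e0.
have [d d0 dP] := H alpha al0 e e0; apply/nbhs_normcP; exists d => // z zd Az.
exact: dP.
Qed.

(** Where [psi] does not vanish the limit of [h] exists almost everywhere;
    elsewhere [h] is multiplied by 0. *)
Lemma glued_u_limit : nontangential_limit_ae Omega gamma (boundary Omega) F glued_u.
Proof.
apply: (@filterS _ _ (ae_filter_ringOfSetsType mu) _ _ _ hnt) => t ht.
rewrite arc_boundaryE => Dt.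
apply/nontangential_limitP => alpha al0 e e0.
set p := gamma t; have e3 : 0 < e / 3 by rewrite divr_gt0.
have [d2 d20 d2P] := (continuous_normcP S p).1 (@cS p) _ e3.
have [rl|rg] := ltP (normc (p - z0)) r; last first.
  have p0 y : normc (y - p) < rho -> psi y = 0.
    move=> yp; apply: cutoff0 => //; have := normc_tri y p z0; rewrite (normcC p y).
    by move: r3 rho0 rg yp; lra.
  exists (Num.min rho d2); first by rewrite lt_min rho0.
  move=> z [Oz _]; rewrite lt_min => /andP[z1 z2].
  rewrite FE // /glued_u (p0 z z1) (p0 p) ?subrr ?normc0 // !mul0r !add0r.
  by apply: (lt_trans (d2P z z2)); rewrite ltr_pdivrMr // ltr_pMr // ltr1n.
have At : A t by apply/AP.
have /nontangential_limitP /(_ alpha al0 _ e3)[d3 d30 d3P] := ht At.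
set l := u p in d3P.
have l0 : 0 < normc l + 1 by rewrite ltr_wpDl // normc_ge0.
exists (Num.min (Num.min d2 d3) (e / 3 * rho / (normc l + 1))).
  by rewrite !lt_min d20 d30 /= divr_gt0 // mulr_gt0.
move=> z Az; rewrite !lt_min => /andP[/andP[z2 z3] z4].
rewrite FE; last by case: Az.
rewrite /glued_u -/l.
have -> : (psi z)%:C * h z + S z - ((psi p)%:C * l + S p) =
    (psi z)%:C * (h z - l) + (psi z - psi p)%:C * l + (S z - S p).
  rewrite (rmorphB (real_complex R)) /=.
  by move: ((psi z)%:C) ((psi p)%:C) (h z) (S z) (S p) => *; ring.
have n1 := d2P z z2.
have n2 : normc ((psi z)%:C * (h z - l)) < e / 3.
  apply: le_lt_trans (d3P z Az z3).
  rewrite normcM normcR ger0_norm ?cutoff_ge0 // ler_piMl ?normc_ge0 //.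
  exact: cutoff_le1.
have n3 : normc ((psi z - psi p)%:C * l) <= e / 3.
  rewrite normcM normcR.
  apply: (@le_trans _ _ (rho^-1 * normc (z - p) * (normc l + 1))).
    apply: ler_pM => //; [exact: normc_ge0|exact: cutoff_lip|by rewrite lerDl].
  rewrite -mulrA ler_pdivrMl //; move: z4; rewrite ltr_pdivlMr // => /ltW h4.
  by rewrite [leRHS]mulrC.
apply: (le_lt_trans (normcD _ _)).
have := normcD ((psi z)%:C * (h z - l)) ((psi z - psi p)%:C * l).
by move: n1 n2 n3; lra.
Qed.

Theorem glued_hardy : hardy2 Omega gamma F glued_u.
Proof.
split; [exact: hF|exact: hardy_bound|exact: glued_u_L2|exact: glued_u_limit].
Qed.

End Hardy.

(** * Consequences of the boundary hypotheses *)


Section BoundaryData.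
Context {R : realType}.
Local Notation mu := (@lebesgue_measure R).
Variables (Omega : set R[i]) (gamma : R -> R[i]) (h u : R[i] -> R[i]) (z0 : R[i]) (r : R).
Local Notation v := (speed gamma).
Local Notation Phi := (collar gamma).
Local Notation E0 := (disc z0 r `&` boundary Omega).
Hypothesis hOmega : smooth_jordan_domain Omega gamma.
Let gJ : smooth_jordan_curve gamma. Proof. exact: domain_curve hOmega. Qed.

Lemma near_right_exists (P : R -> Prop) : (\forall s \near 0^'+, P s) ->
  exists2 d : R, 0 < d & forall s : R, 0 < s -> s < d -> P s.
Proof.
move=> /nbhs_ballP[d /= d0 dP]; exists d => // s s0 sd; apply: dP => //.
by rewrite /ball /= sub0r normrN gtr0_norm.
Qed.

Lemma cvg0_right (I : R -> \bar R) : I @ 0^'+ --> 0%E -> forall e : R, 0 < e ->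
  exists2 d : R, 0 < d & forall s : R, 0 < s -> s < d -> (I s <= e%:E)%E.
Proof.
move=> cI e e0; apply: near_right_exists.
have : nbhs (0%E : \bar R) [set x | (x < e%:E)%E].
  by apply: open_nbhs_nbhs; split; [exact: open_ereal_lt_ereal|rewrite /= lte_fin].
move=> /cI H; have {}H : \forall s \near 0^'+, (I s < e%:E)%E by exact: H.
by apply: filterS H => s /ltW.
Qed.

Lemma curve_in_arc t : normc (gamma t - z0) < r -> E0 (gamma t).
Proof. by move=> d; split; [exact/discE|apply/(boundaryE hOmega); exists t]. Qed.

Lemma normc_collar_gamma t s : normc (Phi t s - gamma t) = `|s|.
Proof. by rewrite /collar addrAC subrr add0r normc_iR (normc_T gJ) mulr1. Qed.

(** A nonempty open interval is not negligible. *)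
Lemma good_point (n : int) (x y : R) :
  nontangential_limit_ae Omega gamma E0 h u -> n%:~R <= x -> x < y -> y <= n%:~R + 1 ->
  (forall t, x < t < y -> normc (gamma t - z0) < r) ->
  exists2 t, x < t < y & nontangential_limit Omega h (gamma t) (u (gamma t)).
Proof.
move=> [N [mN N0 NP]] nx xy yn inD.
have [//|nogood] := pselect (exists2 t, x < t < y &
  nontangential_limit Omega h (gamma t) (u (gamma t))).
have sub : `]x - n%:~R, y - n%:~R[%classic `<=` N.
  move=> t; rewrite /= in_itv /= => /andP[t1 t2]; apply: NP => /= H; apply: nogood.
  have tn : x < t + n%:~R < y by apply/andP; split; lra.
  exists (t + n%:~R) => //; rewrite (gamma_int gJ); apply: H; split.
    by rewrite /= in_itv /=; apply/andP; split; lra.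
  by apply: curve_in_arc; rewrite -(gamma_int gJ n); exact: inD.
pose J : set (measurableTypeR R) := `]x - n%:~R, y - n%:~R[%classic.
have : (mu J <= mu N)%E.
  by apply: le_measure => //; rewrite inE //; exact: measurable_itv.
rewrite N0 /J lebesgue_measure_itv /= lte_fin ltrD2r xy -EFinB lee_fin.
by rewrite opprB addrA subrK subr_le0 leNgt xy.
Qed.

(** By [collar_dist] the normal at a boundary point lies in its approach regions,
    even the narrowest ones. *)
Lemma normal_limit (t s0 : R) (l : R[i]) : 0 < s0 ->
  (forall s, 0 < s -> s < s0 -> Omega (Phi t s)) ->
  (forall s x : R, `|s| <= s0 -> `|s| <= normc (Phi t s - gamma x)) ->
  nontangential_limit Omega h (gamma t) l ->
  forall e : R, 0 < e -> exists2 d : R, 0 < d & forall s : R, 0 < s -> s < d ->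
    normc (h (Phi t s) - l) < e.
Proof.
move=> s00 inO dist nt e e0.
have [d d0 dP] := (nontangential_limitP _ _ _ _).1 nt 1 ltr01 e e0.
exists (Num.min d s0); first by rewrite lt_min d0.
move=> s sp; rewrite lt_min => /andP[sd ss]; apply: dP; last first.
  by rewrite normc_collar_gamma gtr0_norm.
split; first exact: inO.
move=> w /(boundaryE hOmega)[x <-]; rewrite normc_collar_gamma.
have sl : `|s| <= s0 by rewrite gtr0_norm // ltW.
by apply: (le_trans (dist s x sl)); rewrite ler_peMl ?normc_ge0 // lerDl.
Qed.

(** Measurability is known for parameters in [0, 1[ only; translations by
    integers carry it to the other ones. *)
Lemma measurable_shift (D : set (measurableTypeR R)) (n : int) (f : R[i] -> R) :
  measurable D -> (forall t, D t -> n%:~R <= t < n%:~R + 1) ->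
  (forall t, D t -> normc (gamma t - z0) < r) ->
  measurable_fun (arc_params gamma E0 : set (measurableTypeR R)) (fun t => f (gamma t)) ->
  measurable (arc_params gamma E0 : set (measurableTypeR R)) ->
  measurable_fun D (fun t => f (gamma t)).
Proof.
move=> mD Dn Dr mf mA.
rewrite (_ : (fun t => _) = (fun t => f (gamma t)) \o (fun t => t - n%:~R)); last first.
  by apply/funext => t /=; rewrite -mulrNz (gamma_int gJ).
apply: (measurable_comp mA _ mf).
  move=> _ [t Dt <-]; split.
    by rewrite /= in_itv /=; have /andP[? ?] := Dn t Dt; apply/andP; split; lra.
  by rewrite /= -mulrNz (gamma_int gJ); apply: curve_in_arc; exact: Dr.
by apply: measurable_funTS; apply: continuous_measurable_fun => t; apply: cvgB; [exact: cvg_id|exact: cvg_cst].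
Qed.

Lemma measurable_window (a b : R) (f : R[i] -> R) : -1 <= a -> b < 1 ->
  (forall t, a <= t <= b -> normc (gamma t - z0) < r) ->
  measurable_fun (arc_params gamma E0 : set (measurableTypeR R)) (fun t => f (gamma t)) ->
  measurable (arc_params gamma E0 : set (measurableTypeR R)) ->
  measurable_fun (`[a, b] : set (measurableTypeR R)) (fun t => f (gamma t)).
Proof.
move=> a1 b1 Dr mf mA.
have -> : (`[a, b]%classic : set (measurableTypeR R)) =
    (`[a, b] `&` `[(-1)%:~R, (-1)%:~R + 1[) `|` (`[a, b] `&` `[0%:~R, 0%:~R + 1[).
  rewrite -setIUr; apply/esym/setIidPl => t /=; rewrite !in_itv /= => /andP[h1 h2].
  case: (ltP t 0) => t0; [left|right]; rewrite ?mulrNz; apply/andP; split; lra.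
have mI n : measurable ((`[a, b] `&` `[n%:~R, n%:~R + 1[) : set (measurableTypeR R)).
  by apply: measurableI; exact: measurable_itv.
apply/measurable_funU => //; split.
  apply: (measurable_shift (mI _) _ _ mf mA) => t [/=]; rewrite !in_itv => h1 h2; first exact: h2.
  exact: Dr.
apply: (measurable_shift (mI _) _ _ mf mA) => t [/=]; rewrite !in_itv => h1 h2; first exact: h2.
exact: Dr.
Qed.

Lemma measurable_next_window (a b : R) (f : R[i] -> R) :
  measurable_fun (`[a, b] : set (measurableTypeR R)) (fun t => f (gamma t)) ->
  measurable_fun (`[a + 1, b + 1] : set (measurableTypeR R)) (fun t => f (gamma t)).
Proof.
move=> mf.
rewrite (_ : (fun t => _) = (fun t => f (gamma t)) \o (fun t => t - 1)); last first.
  by apply/funext => t /=; have -> : gamma (t - 1) = gamma t by exact: (gamma_int gJ (-1)).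
apply: (measurable_comp (measurable_seg a b) _ mf).
  move=> _ [t /= tP <-]; move: tP; rewrite !in_itv /= => /andP[? ?].
  by apply/andP; split; lra.
by apply: measurable_funTS; apply: continuous_measurable_fun => t; apply: cvgB; [exact: cvg_id|exact: cvg_cst].
Qed.

End BoundaryData.

(** * Choice of the window *)


Section Window.
Context {R : realType}.
Variables (gamma : R -> R[i]) (z0 : R[i]) (t0 de mg : R).
Hypothesis gJ : smooth_jordan_curve gamma.
Hypothesis t0P : 0 <= t0 < 1.
Hypothesis z0E : gamma t0 = z0.
Hypothesis de4 : de <= 1 / 4.
Hypothesis det : de <= 1 - t0.
Hypothesis mg0 : 0 < mg.
Hypothesis gbil : forall t t' : R, -3 <= t <= 3 -> -3 <= t' <= 3 -> `|t' - t| <= 1 / 2 ->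
  mg * `|t' - t| <= normc (gamma t' - gamma t).

Lemma near_param (t q : R) : `|t - t0| <= 1 / 2 -> normc (gamma t - z0) < q ->
  q <= mg * de / 2 -> `|t - t0| < de / 2.
Proof.
move=> tt tq qm.
have [I0 It] : -3 <= t0 <= 3 /\ -3 <= t <= 3.
  have /andP[h1 h2] := t0P; move: (tt); rewrite ler_norml => /andP[h3 h4].
  by split; apply/andP; split; lra.
have h := gbil I0 It tt; rewrite z0E in h.
have : mg * `|t - t0| < mg * (de / 2) by rewrite mulrA; apply: le_lt_trans h _; apply: lt_le_trans qm.
by rewrite ltr_pM2l.
Qed.

(** A parameter in [0, 1[ and [t0] may lie at the two ends of a period; as the
    window does not go beyond 1, only a shift by [-1] can occur. *)
Lemma near_param_circle (t q : R) : 0 <= t < 1 -> normc (gamma t - z0) < q ->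
  q <= mg * de / 2 -> `|t - t0| < de / 2 \/ `|t - 1 - t0| < de / 2.
Proof.
move=> /andP[t1 t2] tq qm; have /andP[h1 h2] := t0P.
have [hn|hn] := leP (`|t - t0|) (1 / 2); first by left; exact: near_param hn tq qm.
have [tt|tt] := leP t0 t.
  right; apply: (@near_param (t - 1) q _ _ qm).
    move: hn; rewrite ger0_norm ?subr_ge0 // => hn.
    by rewrite ler_norml; apply/andP; split; lra.
  by have -> : gamma (t - 1) = gamma t by exact: (gamma_int gJ (-1)).
have h3 : `|t + 1 - t0| < de / 2.
  apply: (@near_param (t + 1) q _ _ qm).
    move: hn; rewrite ltr0_norm ?subr_lt0 // => hn.
    by rewrite ler_norml; apply/andP; split; lra.
  by have -> : gamma (t + 1) = gamma t by exact: (gamma_int gJ 1).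
by move: h3; rewrite ltr_norml => /andP[h3 h4]; move: de4 det; lra.
Qed.

End Window.

Section Constants.
Context {R : realType}.

Lemma window_size (dl r C t0 : R) : 0 < dl -> 0 < r -> 0 < C -> 0 <= t0 < 1 ->
  exists2 de, 0 < de &
    [/\ de <= dl / 2, de <= 1 / 4, de <= 1 - t0, 2 * C * de <= r / 4 &
        t0 = 0 \/ de <= t0].
Proof.
move=> dl0 r0 C0 /andP[t00 t01].
pose d := Num.min (Num.min (dl / 2) (1 / 4)) (Num.min (1 - t0) (r / 4 / (2 * C))).
have d0 : 0 < d by rewrite !lt_min subr_gt0 t01 !divr_gt0 ?mulr_gt0.
have [k1 k2 k3 k4] : [/\ d <= dl / 2, d <= 1 / 4, d <= 1 - t0 & d <= r / 4 / (2 * C)].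
  by split; rewrite /d !ge_min lexx ?orbT.
have k5 x : x <= d -> 2 * C * x <= r / 4.
  by move=> xd; rewrite mulrC -ler_pdivlMr ?mulr_gt0 //; exact: le_trans k4.
have [t0z|t0n] := eqVneq t0 0.
  by exists d => //; split => //; [exact: k5|left].
have t0p : 0 < t0 by rewrite lt_def t0n.
exists (Num.min d t0); first by rewrite lt_min d0.
have [k6 k7] : Num.min d t0 <= d /\ Num.min d t0 <= t0.
  by split; rewrite ge_min lexx ?orbT.
by split; [exact: le_trans k1|exact: le_trans k2|exact: le_trans k3|exact: k5|right].
Qed.

Lemma collar_width (dl s0 r v0 C : R) : 0 < dl -> 0 < s0 -> 0 < r -> 0 < v0 -> 0 < C ->
  exists2 sg, 0 < sg &
    [/\ sg <= 1, sg <= dl, sg <= s0 / 2, sg <= r / 4 & 2 * C * sg <= v0].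
Proof.
move=> dl0 s00 r0 v00 C0.
exists (Num.min (Num.min 1 dl) (Num.min (Num.min (s0 / 2) (r / 4)) (v0 / (2 * C)))).
  by rewrite !lt_min ltr01 dl0 !divr_gt0 // mulr_gt0.
split; try by rewrite !ge_min lexx ?orbT.
by rewrite mulrC -ler_pdivlMr ?mulr_gt0 // !ge_min lexx !orbT.
Qed.

Lemma cutoff_radius (r sg mg m de : R) : 0 < r -> 0 < sg -> 0 < mg -> 0 < m -> 0 < de ->
  exists2 rho, 0 < rho & [/\ 4 * rho <= r, 4 * rho <= sg,
    6 * rho <= mg * de / 2 & 4 * rho <= m * Num.min (de / 2) sg].
Proof.
move=> r0 sg0 mg0 m0 de0; have ms0 : 0 < Num.min (de / 2) sg by rewrite lt_min divr_gt0.
exists (Num.min (Num.min (r / 4) (sg / 4))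
   (Num.min (mg * de / 2 / 6) (m * Num.min (de / 2) sg / 4))).
  by rewrite !lt_min !divr_gt0 ?mulr_gt0.
by split; rewrite mulrC -ler_pdivlMr // !ge_min lexx ?orbT.
Qed.

End Constants.

Section Assembly.
Context {R : realType}.
Variables (Omega : set R[i]) (gamma : R -> R[i]) (h u : R[i] -> R[i]) (z0 : R[i]).
Variables (r t0 v0 C dl m s0 mg de a b sg rho : R).
Local Notation Phi := (collar gamma).
Hypothesis hOmega : smooth_jordan_domain Omega gamma.
Hypothesis r0 : 0 < r.
Hypothesis cb : curve_bounds gamma v0 C.
Hypothesis hh : holomorphic_on (disc z0 r `&` Omega) h.
Hypothesis hu : L2_arc gamma (disc z0 r `&` boundary Omega) u.
Hypothesis hnt :
  nontangential_limit_ae Omega gamma (disc z0 r `&` boundary Omega) h u.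
Hypothesis hlim : forall a b : R, a < b -> b <= a + 1 ->
  gamma @` `[a, b] `<=` disc z0 r `&` boundary Omega ->
  (fun eps : R => \int[lebesgue_measure]_(t in `[a, b])
     (normc (h (parallel gamma eps t) - u (gamma t)) ^+ 2 *
      speed gamma t)%:E)%E @ 0^'+ --> 0%E.
Hypothesis t0P : 0 <= t0 < 1.
Hypothesis z0E : gamma t0 = z0.
Hypothesis m0 : 0 < m.
Hypothesis cbil : forall t s t' s' : R, -3 <= t <= 3 -> -3 <= t' <= 3 ->
  `|t - t'| <= dl -> `|s| <= dl ->
  m * (`|t - t'| + `|s - s'|) <= normc (Phi t s - Phi t' s').
Hypothesis s00 : 0 < s0.
Hypothesis sides : forall t : R, -2 <= t <= 2 ->
  [/\ (forall s, 0 < s -> s < s0 -> Omega (Phi t s)),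
   (forall s, - s0 < s -> s <= 0 -> ~ Omega (Phi t s)) &
   (forall s x, `|s| <= s0 -> `|s| <= normc (Phi t s - gamma x))].
Hypothesis mg0 : 0 < mg.
Hypothesis gbil : forall t t' : R, -3 <= t <= 3 -> -3 <= t' <= 3 ->
  `|t' - t| <= 1 / 2 -> mg * `|t' - t| <= normc (gamma t' - gamma t).
Hypothesis de0 : 0 < de.
Hypothesis de1 : de <= dl / 2.
Hypothesis de4 : de <= 1 / 4.
Hypothesis det : de <= 1 - t0.
Hypothesis window : forall t : R, `|t - t0| <= de -> normc (gamma t - z0) <= r / 4.
Hypothesis aP : t0 - de < a < t0 - de / 2.
Hypothesis bP : t0 + de / 2 < b < t0 + de.
Hypothesis nta : nontangential_limit Omega h (gamma a) (u (gamma a)).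
Hypothesis ntb : nontangential_limit Omega h (gamma b) (u (gamma b)).
Hypothesis sg0 : 0 < sg.
Hypothesis sg1 : sg <= 1.
Hypothesis sgd : sg <= dl.
Hypothesis sgs : sg <= s0 / 2.
Hypothesis sgr : sg <= r / 4.
Hypothesis sgv : 2 * C * sg <= v0.
Hypothesis rho0 : 0 < rho.
Hypothesis rr : 4 * rho <= r.
Hypothesis rs : 4 * rho <= sg.
Hypothesis rm : 6 * rho <= mg * de / 2.
Hypothesis rb : 4 * rho <= m * Num.min (de / 2) sg.

Let gJ : smooth_jordan_curve gamma. Proof. exact: domain_curve hOmega. Qed.

Let order : [/\ t0 - de < a, a < t0 - de / 2, t0 + de / 2 < b & b < t0 + de].
Proof. by have /andP[] := aP; have /andP[] := bP. Qed.

Let ab : a < b. Proof. by move: order de0 => [? ? ? ?]; lra. Qed.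
Let am : -1 <= a. Proof. by move: order t0P de4 => [? ? ? ?] /andP[? ?]; lra. Qed.
Let bm : b < 1. Proof. by move: order det => [? ? ? ?]; lra. Qed.
Let bm1 : b <= 1. Proof. exact: ltW. Qed.
Let ba12 : b - a <= 1 / 2. Proof. by move: order de4 => [? ? ? ?]; lra. Qed.
Let t0ab : a < t0 < b.
Proof. by move: order de0 => [? ? ? ?] ?; apply/andP; split; lra. Qed.

Let tab t : a <= t <= b -> `|t - t0| <= de.
Proof.
by move: order => [? ? ? ?] /andP[? ?]; rewrite ler_norml; apply/andP; split; lra.
Qed.

Let in_window (t : R) : `|t - t0| < de / 2 -> a < t < b.
Proof.
move: order; rewrite ltr_norml => -[? ? ? ?] /andP[? ?].
by apply/andP; split; lra.
Qed.

Let tab2 (t : R) : a <= t <= b \/ a + 1 <= t <= b + 1 -> -2 <= t <= 2.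
Proof. by move: am bm => ? ? [] /andP[? ?]; apply/andP; split; lra. Qed.

Let tab3 (t : R) : a <= t <= b -> -3 <= t <= 3.
Proof. by move: am bm => ? ? /andP[? ?]; apply/andP; split; lra. Qed.

Let gS t : gamma (t - 1) = gamma t. Proof. exact: (gamma_int gJ (-1)). Qed.

Let near_z0 (t : R) : a <= t <= b \/ a + 1 <= t <= b + 1 ->
  normc (gamma t - z0) <= r / 4.
Proof.
case=> tP; first by apply: window; exact: tab.
by rewrite -gS; apply: window; apply: tab; have /andP[? ?] := tP; apply/andP; split; lra.
Qed.

Let near_z0_r (t : R) : a <= t <= b \/ a + 1 <= t <= b + 1 ->
  normc (gamma t - z0) < r.
Proof. by move=> /near_z0; move: r0; lra. Qed.

Let sO t s : -2 <= t <= 2 -> 0 < s <= sg -> Omega (Phi t s).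
Proof.
move=> tP /andP[h1 h2]; have [H _ _] := sides tP; apply: H => //.
by move: sgs s00; lra.
Qed.

Let nearD t s : normc (gamma t - z0) <= r / 4 -> 0 <= s <= sg ->
  normc (Phi t s - z0) < r.
Proof.
move=> tz /andP[h1 h2]; apply: (le_lt_trans (normc_tri (gamma t) _ _)).
by rewrite (normc_collar_gamma hOmega) ger0_norm //; move: sgr r0; lra.
Qed.

Let inO t s : a <= t <= b -> 0 < s <= sg -> Omega (Phi t s) /\ normc (Phi t s - z0) < r.
Proof.
move=> tP sP; split; first by apply: sO => //; apply: tab2; left.
apply: nearD; first by apply: near_z0; left.
by have /andP[/ltW -> ->] := sP.
Qed.

Let bil (t s t' s' : R) : a <= t <= b -> a <= t' <= b -> 0 <= s <= sg -> 0 <= s' <= sg ->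
  m * (`|t - t'| + `|s - s'|) <= normc (Phi t s - Phi t' s').
Proof.
move=> tP t'P /andP[h5 h6] _; apply: cbil; [exact: tab3|exact: tab3| |].
  move: (tab tP) (tab t'P) de1; rewrite !ler_norml => /andP[? ?] /andP[? ?] ?.
  by apply/andP; split; lra.
by rewrite ger0_norm //; exact: le_trans sgd.
Qed.

Let jac (t s : R) : a <= t <= b -> 0 <= s <= sg -> 0 < speed gamma t - s * curv gamma t.
Proof.
move=> tP /andP[h1 h2]; have [v00 C1 cbI] := cb.
have C0 : 0 < C := lt_le_trans ltr01 C1.
have [vt _ _ dTC] := cbI _ (tab3 tP).
have cC : curv gamma t <= C.
  by apply: le_trans dTC; rewrite (dTE gJ) normc_iR (normc_T gJ) mulr1; exact: ler_norm.
have : s * curv gamma t <= sg * C.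
  have [c0|c0] := leP 0 (curv gamma t); first exact: ler_pM.
  apply: (@le_trans _ _ 0); first by rewrite mulr_ge0_le0 // ltW.
  by rewrite mulr_ge0 // ltW.
by move: sgv v00 vt; lra.
Qed.

Let far z (t s : R) : normc (z - z0) < 3 * rho -> a <= t <= b -> 0 <= s <= sg ->
  [\/ t = a, t = b | s = sg] -> rho <= normc (Phi t s - z).
Proof.
move=> zr tP sP tsP.
have t0P' : a <= t0 <= b by have /andP[/ltW -> /ltW ->] := t0ab.
have zs : 0 <= (0 : R) <= sg by rewrite lexx ltW.
have := bil tP t0P' sP zs.
have -> : Phi t0 0 = z0 by rewrite /collar mulr0 mul0r addr0.
have : Num.min (de / 2) sg <= `|t - t0| + `|s - 0|.
  rewrite subr0 ge_min; have n1 := normr_ge0 (t - t0); have n2 := normr_ge0 s.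
  move: n1 n2; case: tsP => -> n1 n2; apply/orP; move: order => [? ? ? ?].
  - by left; have := ler_norm (t0 - a); rewrite distrC; lra.
  - by left; have := ler_norm (b - t0); lra.
  - by right; have := ler_norm sg; lra.
rewrite -(ler_pM2l m0) => k1 k2.
by have := normc_tri z (Phi t s) z0; move: rb k1 k2 zr; lra.
Qed.

Let mA := measurable_arc_params z0 r hOmega.

Let Dab t : a <= t <= b -> normc (gamma t - z0) < r.
Proof. by move=> tP; apply: near_z0_r; left. Qed.

Let mR := let: And3 uR _ _ := hu in
  measurable_window hOmega (f := fun p => complex.Re (u p)) am bm Dab uR mA.
Let mI := let: And3 _ uI _ := hu in
  measurable_window hOmega (f := fun p => complex.Im (u p)) am bm Dab uI mA.

Let arc x y : x < y -> y <= x + 1 ->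
  (forall t, x <= t <= y -> normc (gamma t - z0) < r) -> forall e : R, 0 < e ->
  exists2 d : R, 0 < d & forall s : R, 0 < s -> s < d ->
  (\int[lebesgue_measure]_(t in `[x, y])
    (normc (h (Phi t s) - u (gamma t)) ^+ 2 * speed gamma t)%:E <= e%:E)%E.
Proof.
move=> xy yx Dxy; apply: cvg0_right; apply: hlim => // _ [t /= tP <-].
by apply: (curve_in_arc hOmega); apply: Dxy; move: tP; rewrite in_itv.
Qed.

Let ba1 : b <= a + 1. Proof. by move: ba12; lra. Qed.
Let L2lim := arc ab ba1 Dab.

Let aab : a <= a <= b. Proof. by rewrite lexx ltW. Qed.
Let bab : a <= b <= b. Proof. by rewrite lexx ltW. Qed.

Let lim_a := let: And3 Oa _ da := sides (tab2 (or_introl aab)) in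
  normal_limit hOmega s00 Oa da nta.
Let lim_b := let: And3 Ob _ db := sides (tab2 (or_introl bab)) in
  normal_limit hOmega s00 Ob db ntb.

Local Notation inner :=
  (inner_int gamma h (u (gamma a)) (u (gamma b)) a b sg).

(** A point of the domain close to [z0] lies on the normal at a nearest point of
    the curve, hence in the collar rectangle, on the positive side. *)
Let cauchy z : Omega z -> normc (z - z0) < 3 * rho ->
  cauchy_int a b (w_bottom gamma u) gamma 1 z + inner 1%N z = h z * ('i * (2 * pi)%:C).
Proof.
move=> Oz zr; have [t1 [s1 [t1P zE s1P]]] := nearest_point gJ z t0.
have s1l : `|s1| <= normc (z - z0) by rewrite -z0E; exact: s1P.
have g6 : normc (gamma t1 - z0) < 6 * rho.
  apply: (le_lt_trans (normc_tri z _ _)).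
  by rewrite (normcC _ z) {1}zE (normc_collar_gamma hOmega); lra.
have tt := near_param t0P z0E mg0 gbil t1P g6 rm.
have t1ab := in_window tt.
have t1ab' : a <= t1 <= b by have /andP[/ltW -> /ltW ->] := t1ab.
have [_ notO _] := sides (tab2 (or_introl t1ab')).
have s1p : 0 < s1.
  rewrite ltNge; apply/negP => s1n; apply: (notO s1 _ s1n); last by rewrite -zE.
  by move: s1l sgs rs s00 sg0; rewrite ler0_norm //; lra.
have s1sg : 0 < s1 < sg.
  by rewrite s1p; move: s1l rs sg0; rewrite gtr0_norm //; lra.
rewrite zE.
exact: (collar_cauchy gJ cb ab am bm1 sg0 sg1 inO m0 bil jac hh lim_a lim_b mR mI
  L2lim t1ab s1sg).
Qed.

Let hc t s : a <= t <= b \/ a + 1 <= t <= b + 1 -> 0 < s <= sg ->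
  {for t, continuous (fun t => h (Phi t s))}.
Proof.
move=> tP sP; apply: (ccont_comp (c := fun t => Phi t s)).
  exact: rdiff_continuous (collar_dt gJ t s).
have : derivable h (Phi t s) 1.
  apply: hh; split; last by apply: sO => //; exact: tab2.
  by apply/discE; apply: (nearD (near_z0 tP)); have /andP[/ltW -> ->] := sP.
by move=> /derivable_cdiffP[l /cdiff_continuous].
Qed.

Theorem window_extension : exists f u' : R[i] -> R[i],
  hardy2 Omega gamma f u' /\
  extends_smoothly_near Omega (disc z0 r) z0 (fun z => f z - h z).
Proof.
have iw := w_bottom_integrable gJ cb ab am bm1 sg0 inO hh mR mI L2lim.
have icd := inner_int_cdiff gJ ab sg0 inO rho0 far hh lim_a lim_b.
have ibd := inner_int_bound gJ ab sg0 inO rho0 far hh lim_a lim_b.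
have [B B0 BS] := local_g_bound hOmega rho0 iw ibd.
have r3 : 3 * rho < r by move: rr rho0; lra.
exists (local_f gamma z0 a b rho (w_bottom gamma u)),
  (glued_u u (local_g gamma z0 a b rho (w_bottom gamma u) inner) z0 rho).
split; last first.
  apply: (local_f_smooth hOmega cb t0ab am bm1 z0E rho0 r3 mg0 _ iw icd cauchy).
  move=> t tP; rewrite -z0E; apply: gbil; [|exact: tab3|].
    by apply: tab3; have /andP[/ltW -> /ltW ->] := t0ab.
  by apply: (le_trans (tab tP)); move: de4; lra.
have [x3 y3] : -3 <= a /\ b <= 3 by move: am bm; split; lra.
have [Ma Ma0 [d d0 dP]] := arc_bound gJ cb (ltW ab) x3 y3 sg0
  (fun t s tP => @hc t s (or_introl tP)) mR mI L2lim.
have [x4 y4] : -3 <= a + 1 /\ b + 1 <= 3 by move: am bm; split; lra.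
have [ab1 ba2] : a + 1 < b + 1 /\ b + 1 <= a + 1 + 1 by move: ab ba1; split; lra.
have mR1 := measurable_next_window hOmega (f := fun p => complex.Re (u p)) mR.
have mI1 := measurable_next_window hOmega (f := fun p => complex.Im (u p)) mI.
have [Mb Mb0 [d' d'0 d'P]] := arc_bound gJ cb (ltW ab1) x4 y4 sg0
  (fun t s tP => @hc t s (or_intror tP)) mR1 mI1
  (arc ab1 ba2 (fun t tP => near_z0_r (or_intror tP))).
have dm0 : 0 < Num.min d d' by rewrite lt_min d0.
apply: (@glued_hardy R Omega gamma h u _ _ z0 r a b rho v0 C sg B (Num.max Ma Mb) (Num.min d d')
   hOmega cb rho0 r3 sg0 sg1 _ _ _ _ _ B0 BS hu hnt _ dm0 _).
- by move=> t s tP /andP[h1 /ltW h2]; apply: sO => //; rewrite h1.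
- move=> t tP tz.
  have tz6 : normc (gamma t - z0) < 6 * rho by move: tz rho0; lra.
  case: (near_param_circle gJ t0P z0E de4 det mg0 gbil tP tz6 rm) => /in_window
      /andP[/ltW h1 /ltW h2]; [left|right]; first by rewrite h1.
  by rewrite -lerBrDr h1 -lerBlDr.
- exact: (local_f_holomorphic hOmega rho0 iw).
- exact: (local_fE hOmega rho0 iw cauchy).
- exact: (local_g_continuous hOmega ba12 rho0 iw icd).
- by move=> t s tP /andP[h1 /ltW h2]; apply: hc => //; rewrite h1.
- move=> s sp; rewrite lt_min => /andP[sd sd']; split.
    by apply: (le_trans (dP s sp sd)); rewrite lee_fin le_max lexx.
  by apply: (le_trans (d'P s sp sd')); rewrite lee_fin le_max lexx orbT.
Qed.

End Assembly.

Section ChoiceOfEndpoints.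
Context {R : realType}.
Variables (Omega : set R[i]) (gamma : R -> R[i]) (h u : R[i] -> R[i]) (z0 : R[i]).
Variables (r t0 v0 C de : R).
Hypothesis hOmega : smooth_jordan_domain Omega gamma.
Hypothesis r0 : 0 < r.
Hypothesis cb : curve_bounds gamma v0 C.
Hypothesis hnt :
  nontangential_limit_ae Omega gamma (disc z0 r `&` boundary Omega) h u.
Hypothesis t0P : 0 <= t0 < 1.
Hypothesis z0E : gamma t0 = z0.
Hypothesis de0 : 0 < de.
Hypothesis de4 : de <= 1 / 4.
Hypothesis det : de <= 1 - t0.
Hypothesis der : 2 * C * de <= r / 4.
Hypothesis dep : t0 = 0 \/ de <= t0.

Lemma window_in_disc (t : R) : `|t - t0| <= de -> normc (gamma t - z0) <= r / 4.
Proof.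
move=> tt; have /andP[h1 h2] := t0P.
have /andP[h3 h4] : - de <= t - t0 <= de by rewrite -ler_norml.
have [_ C1 _] := cb; rewrite -z0E.
have I0 : -3 <= t0 <= 3 by apply/andP; split; lra.
have It : -3 <= t <= 3 by apply/andP; split; move: de4; lra.
apply: (le_trans (lip_gamma (domain_curve hOmega) cb I0 It)); apply: le_trans der.
by apply: ler_wpM2l; [rewrite mulr_ge0 // (le_trans ler01)|].
Qed.

Let windowr (t : R) : `|t - t0| <= de -> normc (gamma t - z0) < r.
Proof. by move=> /window_in_disc; move: r0; lra. Qed.

(** If [t0 = 0] the left endpoint is negative, so it comes from the preceding
    period. *)
Lemma good_left : exists2 a, t0 - de < a < t0 - de / 2 &
  nontangential_limit Omega h (gamma a) (u (gamma a)).
Proof.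
have xy : t0 - de < t0 - de / 2 by move: de0; lra.
have inW t : t0 - de < t < t0 - de / 2 -> normc (gamma t - z0) < r.
  move=> /andP[h1 h2]; apply: windowr; rewrite ler_norml; apply/andP; split.
    by lra.
  by move: de0; lra.
move: t0P => /andP[h1 h2]; case: dep => dep'.
  by apply: (good_point hOmega (n := -1) hnt _ xy _ inW);
    rewrite ?mulrN1z; move: de0 de4; lra.
by apply: (good_point hOmega (n := 0) hnt _ xy _ inW);
  rewrite ?mulr0z; move: de0; lra.
Qed.

Lemma good_right : exists2 b, t0 + de / 2 < b < t0 + de &
  nontangential_limit Omega h (gamma b) (u (gamma b)).
Proof.
have xy : t0 + de / 2 < t0 + de by move: de0; lra.
have inW t : t0 + de / 2 < t < t0 + de -> normc (gamma t - z0) < r.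
  move=> /andP[h1 h2]; apply: windowr; rewrite ler_norml; apply/andP; split.
    by move: de0; lra.
  by lra.
move: t0P => /andP[h1 h2].
by apply: (good_point hOmega (n := 0) hnt _ xy _ inW);
  rewrite ?mulr0z; move: de0 det; lra.
Qed.

End ChoiceOfEndpoints.

Theorem theorem4p2 (R : realType) (Omega : set R[i]) (gamma : R -> R[i])
    (z0 : R[i]) (r : R) (h : R[i] -> R[i])
    (hOmega : smooth_jordan_domain Omega gamma)
    (hz0 : boundary Omega z0)
    (hr : 0 < r)
    (hD : simply_connected (disc z0 r `&` Omega))
    (hh : holomorphic_on (disc z0 r `&` Omega) h)
    (hL2 : L2_boundary_limits Omega gamma (disc z0 r `&` boundary Omega) h) :
  exists f u : R[i] -> R[i],
    hardy2 Omega gamma f u /\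
    extends_smoothly_near Omega (disc z0 r) z0 (fun z => f z - h z).
Proof.
have gJ := domain_curve hOmega.
have [v0 [C cb]] := curve_bounds_exist gJ.
have [v00 C1 _] := cb; have C0 : 0 < C := lt_le_trans ltr01 C1.
have [dl dl0 [m m0 cbil]] := collar_bilip gJ cb.
have [s0 s00 sides] := collar_sides hOmega.
have [mg mg0 gbil] := gamma_bilip gJ cb.
have [u [hu hnt hlim]] := hL2.
have [t0 t0P z0E] : exists2 t0, 0 <= t0 < 1 & gamma t0 = z0.
  have [x xE] := (boundaryE hOmega z0).1 hz0.
  exists (x - (Num.floor x)%:~R); last by rewrite -mulrNz (gamma_int gJ).
  have /andP[n1 n2] := floor_itv x; rewrite intrD in n2.
  by move: n1 n2; clear; move=> n1 n2; apply/andP; split; lra.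
have [de de0 [de1 de4 det der dep]] := window_size dl0 hr C0 t0P.
have window := window_in_disc hOmega cb t0P z0E de4 der.
have [a aP nta] := good_left hOmega hr cb hnt t0P z0E de0 de4 der dep.
have [b bP ntb] := good_right hOmega hr cb hnt t0P z0E de0 de4 det der.
have [sg sg0 [sg1 sgd sgs sgr sgv]] := collar_width dl0 s00 hr v00 C0.
have [rho rho0 [rr rs rm rb]] := cutoff_radius hr sg0 mg0 m0 de0.
exact: (window_extension hOmega hr cb hh hu hnt hlim t0P z0E m0 cbil s00 sides mg0 gbil
  de0 de1 de4 det window aP bP nta ntb sg0 sg1 sgd sgs sgr sgv rho0 rr rs rm rb).
Qed.
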